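(* Let $U\in\mathbb{R}^{3\times3}$ be positive definite, symmetric with $\det U=\Delta$, and let $$\mathcal{S}(U):=\bigcup_{\substack{j,k\in\{1,2,3\}\\ j\neq k}}\left\{\frac{\Delta^{1/3}}{(\mathrm{cof}\,U^2)^{1/4}_{jj}},\ \frac{(\mathrm{cof}\,U^2)^{1/4}_{jj}}{(U^2)^{1/4}_{kk}\,\Delta^{1/6}},\ \frac{(U^2)^{1/4}_{kk}}{\Delta^{1/6}}\right\}.$$ Suppose that for some $\kappa\in\mathcal{S}(U)$, $\kappa>0$, $\kappa\neq1$, $$\frac{|\Delta^{1/3}-1|}{\Delta^{1/3}}\sqrt{\Delta^{4/3}+2\Delta+\Delta^{2/3}+2}<\epsilon(\kappa),$$ where $\epsilon(\kappa)\in(0,1)$ is a number, depending only on $\kappa$, such that $$B(\mathbf{1},\epsilon(\kappa))\cap\{A\in\mathbb{R}^{3\times3}:\det A=1\}\subset\tilde{K}^{qc}$$ for every compact set $\tilde K\subset\{A\in\mathbb{R}^{3\times3}:\det A=1\}$ whose quasiconvex hull $\tilde K^{qc}$ contains $$\tilde{K}_{ct}=\bigcup_{i=1}^{3}\mathrm{SO}(3)\tilde U_i,\quad \tilde U_1=\mathrm{diag}(\kappa^2,\tfrac1\kappa,\tfrac1\kappa),\ \tilde U_2=\mathrm{diag}(\tfrac1\kappa,\kappa^2,\tfrac1\kappa),\ \tilde U_3=\mathrm{diag}(\tfrac1\kappa,\tfrac1\kappa,\kappa^2).$$ Let $$K:=\bigcup_{R\in\mathcal{P}^{24}}\mathrm{SO}(3)R^TUR.$$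 Then there exist $a,n\in\mathbb{R}^{3}$ such that $\mathbf{1}+a\otimes n\in\mathrm{rint}\,K^{qc}$.
   Context: $\mathbf{1}$ is the identity matrix, $(a\otimes n)_{ij}=a_in_j$, $|\cdot|$ on matrices is the Euclidean (Frobenius) norm and $B(A,\epsilon)$ the corresponding open ball. $\mathcal{P}^{24}\subset\mathrm{SO}(3)$ is the group of the 24 rotations mapping a cube with edges parallel to the standard basis vectors $e_1,e_2,e_3$ to itself. $(\mathrm{cof}\,A)_{jj}$ is the $(jj)$-component of the cofactor matrix of $A$, and $(\mathrm{cof}\,U^2)^{1/4}_{jj}$, $(U^2)^{1/4}_{kk}$ denote the fourth roots of the numbers $(\mathrm{cof}\,U^2)_{jj}$, $(U^2)_{kk}$. For a compact set $L\subset\mathbb{R}^{3\times3}$, the quasiconvex hull $L^{qc}$ is the set of matrices $F$ for which there exists a sequence $z^{j}$ uniformly bounded in $W^{1,\infty}(\Omega,\mathbb{R}^3)$, $\Omega\subset\mathbb{R}^3$ a bounded domain (the choice of which is immaterial), with $z^{j}\stackrel{\ast}{\rightharpoonup}Fx$ in $W^{1,\infty}(\Omega,\mathbb{R}^3)$ and $Dz^{j}\to L$ in measure, meaning that for every open neighbourhood $O$ of $L$ in $\mathbb{R}^{3\times3}$, $\lim_{j\to\infty}\mathrm{meas}\{x\in\Omega:Dz^j(x)\notin O\}=0$. $\mathrm{rint}\,K^{qc}$ denotes the interior of $K^{qc}$ relative to the set $\{A\in\mathbb{R}^{3\times3}:\det A=\Delta\}$. The existence of a number $\epsilon(\kappa)$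 with the stated property for each $\kappa>0$, $\kappa\ne1$ is a known result of Dolzmann and Kirchheim (for $\kappa<3/2$ one may take $\epsilon(\kappa)=(\kappa-1)^2/62$). *)

(* Defs.v *)
From HB Require Import structures.
From mathcomp Require Import all_boot all_order all_algebra.
From mathcomp Require Import all_classical all_reals all_analysis.
From mathcomp Require Import measurable_realfun.
Set Implicit Arguments.
Unset Strict Implicit.
Unset Printing Implicit Defensive.
Import Order.TTheory GRing.Theory Num.Theory.
Import numFieldNormedType.Exports.
Local Open Scope classical_set_scope.
Local Open Scope ring_scope.

(* Points of the physical space R^3 are triples, which carry both the product
   topology and the product Lebesgue measure; [vec] is the corresponding column
   vector, on which matrices act. *)
Notation R3 R := (R * R * R)%type.

Definition vec {R : realType} (x : R3 R) : 'cV[R]_3 :=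
  \col_i [:: x.1.1; x.1.2; x.2]`_i.

Definition basis_pt {R : realType} (i : 'I_3) : R3 R :=
  ((i == 0 :> nat)%:R, (i == 1%N :> nat)%:R, (i == 2%N :> nat)%:R).

Definition leb3 (R : realType) :=
  ((@lebesgue_measure R \x @lebesgue_measure R) \x @lebesgue_measure R)%E.
Arguments leb3 : clear implicits.

Definition bounded_domain (R : realType) (Omega : set (R3 R)) : Prop :=
  [/\ open Omega, connected Omega, Omega !=set0 & bounded_set Omega].

Section Sobolev.
Context {R : realType} (Omega : set (R3 R)).

Fixpoint C_k (k : nat) (f : R3 R -> R) : Prop :=
  match k with
  | 0%N => continuous f
  | k'.+1 => forall i : 'I_3, (forall x, derivable f x (basis_pt i)) /\
               C_k k' ('D_(basis_pt i) f)
  end.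

Definition smooth (f : R3 R -> R) : Prop := forall k, C_k k f.

Definition test_function (phi : R3 R -> R) : Prop :=
  smooth phi /\ exists C : set (R3 R),
    [/\ compact C, C `<=` Omega & forall x, ~ C x -> phi x = 0].

Definition Linfty_le (M : R) (u : R3 R -> R) : Prop :=
  measurable_fun Omega u /\
  {ae leb3 R, forall x, Omega x -> `|u x| <= M}.

Definition weak_partial (i : 'I_3) (u g : R3 R -> R) : Prop :=
  forall phi, test_function phi ->
    \int[leb3 R]_(x in Omega) (u x * 'D_(basis_pt i) phi x) =
    - \int[leb3 R]_(x in Omega) (g x * phi x).

Definition weak_gradient (z : R3 R -> 'cV[R]_3) (Dz : R3 R -> 'M[R]_3)
    : Prop :=
  forall i j : 'I_3, weak_partial j (fun x => z x i 0) (fun x => Dz x i j).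

(* [z] belongs to W^{1,oo}(Omega, R^3), has weak gradient [Dz], and the
   components of [z] and [Dz] are bounded by [M] almost everywhere. *)
Definition W1infty_le (M : R) (z : R3 R -> 'cV[R]_3)
    (Dz : R3 R -> 'M[R]_3) : Prop :=
  [/\ forall i, Linfty_le M (fun x => z x i 0),
      forall i j, Linfty_le M (fun x => Dz x i j)
    & weak_gradient z Dz].

Definition weak_star_Linfty (u : nat -> R3 R -> R) (v : R3 R -> R)
    : Prop :=
  forall g : R3 R -> R, (leb3 R).-integrable Omega (EFin \o g) ->
    (fun k => \int[leb3 R]_(x in Omega) (u k x * g x)) @ \oo -->
    \int[leb3 R]_(x in Omega) (v x * g x).

Definition weak_star_W1infty
    (z : nat -> R3 R -> 'cV[R]_3) (Dz : nat -> R3 R -> 'M[R]_3)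
    (y : R3 R -> 'cV[R]_3) (Dy : R3 R -> 'M[R]_3) : Prop :=
  (forall i, weak_star_Linfty (fun k x => z k x i 0) (fun x => y x i 0)) /\
  (forall i j, weak_star_Linfty (fun k x => Dz k x i j) (fun x => Dy x i j)).

Definition cvg_in_measure_to_set (Dz : nat -> R3 R -> 'M[R]_3)
    (L : set 'M[R]_3) : Prop :=
  forall O : set 'M[R]_3, open O -> L `<=` O ->
    (fun k => leb3 R (Omega `&` [set x | ~ O (Dz k x)])) @ \oo --> 0%E.

(* Well-posed for a bounded domain [Omega], whose choice is immaterial.
   The weak gradient of the limit [x |-> F x] is the constant [F]. *)
Definition qc_hull (L : set 'M[R]_3) : set 'M[R]_3 :=
  [set F | exists (z : nat -> R3 R -> 'cV[R]_3)
                  (Dz : nat -> R3 R -> 'M[R]_3),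
    [/\ exists M : R, forall k, W1infty_le M (z k) (Dz k),
        weak_star_W1infty z Dz (fun x => F *m vec x) (fun=> F)
      & cvg_in_measure_to_set Dz L]].

End Sobolev.

Section Matrices.
Context {R : realType}.
Implicit Types (A U : 'M[R]_3) (kappa Delta : R).

Definition frobenius A : R := Num.sqrt (\sum_i \sum_j A i j ^+ 2).

Definition frob_ball A (eps : R) : set 'M[R]_3 :=
  [set B | frobenius (B - A) < eps].

Definition det_set (Delta : R) : set 'M[R]_3 := [set A | \det A = Delta].

(* Not the interior in [subspace D], whose points outside [D] are isolated. *)
Definition rint (D S : set 'M[R]_3) : set 'M[R]_3 :=
  [set A | D A /\ within D (nbhs A) S].

Definition tensor (a n : 'cV[R]_3) : 'M[R]_3 :=
  \matrix_(i, j) (a i 0 * n j 0).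

Definition SO3 : set 'M[R]_3 := [set Q | Q^T *m Q = 1%:M /\ \det Q = 1].

Definition cube : set 'cV[R]_3 := [set x | forall i, `|x i 0| <= 1].

Definition P24 : set 'M[R]_3 :=
  [set Q | SO3 Q /\ [set Q *m x | x in cube] = cube].

Definition pos_def_sym U : Prop :=
  U^T = U /\ forall v : 'cV[R]_3, v != 0 -> 0 < (v^T *m U *m v) 0 0.

Definition wells U : set 'M[R]_3 :=
  [set Q *m (P^T *m U *m P) | Q in SO3 & P in P24].

Definition ct_stretch kappa (i : 'I_3) : 'M[R]_3 :=
  diag_mx (\row_j (if j == i then kappa ^+ 2 else kappa^-1)).

Definition ct_wells kappa : set 'M[R]_3 :=
  \bigcup_(i in [set: 'I_3]) [set Q *m ct_stretch kappa i | Q in SO3].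

Definition calS U : set R :=
  let Delta := \det U in
  let c j := cofactor (U *m U) j j `^ (1 / 4) in
  let u k := (U *m U) k k `^ (1 / 4) in
  [set s | exists j k : 'I_3, j != k /\
    [\/ s = Delta `^ (1 / 3) / c j,
        s = c j / (u k * Delta `^ (1 / 6))
      | s = u k / Delta `^ (1 / 6)]].

(* [eps] is an admissible value of the number epsilon(kappa). *)
Definition hull_radius (Omega : set (R3 R)) kappa (eps : R) : Prop :=
  0 < eps < 1 /\
  forall L : set 'M[R]_3, compact L -> L `<=` det_set 1 ->
    ct_wells kappa `<=` qc_hull Omega L ->
    frob_ball 1%:M eps `&` det_set 1 `<=` qc_hull Omega L.

End Matrices.

(* Main.v *)
(** Write [d = Delta^(1/3)].  Iterated convex combinations of rank-one connected
    matrices of a set [L] (laminates) lie in the quasiconvex hull of [L]: for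
    [F = t A + (1 - t) B] with [A - B = a (x) n] one superposes on the map [F x] a
    fine sawtooth in the direction [n], together with the maps already built for
    [A] and [B], each cut off to its own layers.

    The laminates of the wells of [U] are invariant under rotations on the left
    and rotations of the cube on the right.  For a rotation [P] of the cube, the
    factorization of [U P] gives an upper triangular laminate with diagonal
    [(u^2, c^2/u^2, Delta/c^2)], where [u^4 = (U^2)_kk] and [c^4 = (cof U^2)_jj].
    Averaging with the images under half-turns about the coordinate axes removes
    the entries above the diagonal, and half-turns about face diagonals let one
    replace two diagonal entries by their geometric mean.  The three families in
    [S(U)] come from the choice of these two entries, and the outcome is
    [d diag(kappa^2, 1/kappa, 1/kappa)] up to the order of the entries.

    Hence the compact set [L] of the wells divided by [d], which lies in
    [det = 1], has the matrices of [ct_wells kappa] in its hull, and so the ball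
    of radius [eps] about the identity in [det = 1].  For [n = e_1] and
    [a = (Delta - 1) e_1] the inequality assumed says precisely that
    [(1 + a (x) n) / d] is in this ball; scaling by [d] concludes. *)
Require Import Defs.
From HB Require Import structures.
From mathcomp Require Import all_boot all_order all_algebra.
From mathcomp Require Import all_classical all_reals all_analysis.
From mathcomp Require Import measurable_realfun.
From mathcomp Require Import ring lra.
Import Order.TTheory GRing.Theory Num.Theory.
Import numFieldNormedType.Exports.
Local Open Scope classical_set_scope.
Local Open Scope ring_scope.
Set Implicit Arguments.
Unset Strict Implicit.
Unset Printing Implicit Defensive.

(** * Slices of the product Lebesgue measure *)

(** The hull asks for no boundary values, so every construction lives on all of R^3. A bounded C^1
    map [phi] with bounded gradient is dilated to [phi (m x) / m], which tends to 0 uniformly, and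
    no covering of [Omega] or cut-off at its boundary occurs. The price is that the exceptional set
    has to be small in every box and after every dilation. Since all maps are C^1, integration by
    parts and weak-* convergence of gradients reduce to the fundamental theorem of calculus on
    coordinate lines and Fubini. The gradients lie in the set exactly, off a small closed set.
    Cut-offs are steep when their transition layers are thin; the inner maps are therefore dilated
    by a factor chosen after the layers, which keeps the product terms bounded by 1. The fourth
    roots come from a Cholesky factorization: the diagonal of the triangular factor of [P^T U^2 P]
    consists of square roots of quotients of leading minors. The geometric mean appears because,
    after a turn by 45 degrees, a diagonal matrix has two columns of equal length, and reducing the
    shear shortens one of them to the square root of the determinant. *)

Section Slices.
Context {R : realType}.
Implicit Types (x y : R3 R) (s : R) (j : 'I_3).

Definition crd j x : R := [:: x.1.1; x.1.2; x.2]`_j.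

Definition upd j x s : R3 R :=
  match val j with
  | 0%N => (s, x.1.2, x.2)
  | 1%N => (x.1.1, s, x.2)
  | _ => (x.1.1, x.1.2, s)
  end.

Lemma ord3P (P : 'I_3 -> Prop) :
  P 0 -> P 1 -> P (Ordinal (isT : (2 < 3)%N)) -> forall i, P i.
Proof.
by move=> P0 P1 P2 [[|[|[|//]]] lt_i]; [move: P0|move: P1|move: P2];
  congr P; exact: val_inj.
Qed.

(** Slices are lines in direction [basis_pt j], so difference quotients along a slice are those of
    ['D_(basis_pt j)]. *)
Lemma upd_basis j x s : upd j x s = (s - crd j x) *: basis_pt j + x.
Proof.
elim/ord3P: j; case: x => -[a b] c; apply/eqP;
  rewrite /upd /crd /basis_pt !xpair_eqE /= ?scaler0 ?add0r;
  by rewrite /GRing.scale /= ?mulr1 ?mulr0 ?add0r ?subrK !eqxx.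
Qed.

Lemma crd_basis i j : crd i (basis_pt j) = (i == j)%:R :> R.
Proof. by elim/ord3P: i; elim/ord3P: j. Qed.

Lemma crdZ i s x : crd i (s *: x) = s * crd i x.
Proof. by elim/ord3P: i. Qed.

Lemma crd_upd i j x s : crd i (upd j x s) = if i == j then s else crd i x.
Proof. by elim/ord3P: i; elim/ord3P: j. Qed.

Lemma vecE x i : vec x i 0 = crd i x.
Proof. by rewrite mxE. Qed.

Lemma continuous_crd j : continuous (crd j : R3 R -> R).
Proof.
elim/ord3P: j => x /=.
- by apply: (@cvg_comp _ _ _ fst fst); exact: cvg_fst.
- by apply: (@cvg_comp _ _ _ fst snd); [exact: cvg_fst|exact: cvg_snd].
- exact: cvg_snd.
Qed.

Lemma continuous_upd j x : continuous (upd j x).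
Proof.
have hp (T U : topologicalType) (f : R -> T) (g : R -> U) :
    continuous f -> continuous g -> continuous (fun s => (f s, g s)).
  by move=> cf cg s; exact: cvg_pair (cf s) (cg s).
have hc (T : topologicalType) (a : T) : continuous (fun _ : R => a).
  by move=> s; exact: cvg_cst.
have hi : continuous (@id R) by move=> s; exact: cvg_id.
elim/ord3P: j => /=; apply: (hp _ _ _ _) => //; try exact: hc;
  by apply: (hp _ _ _ _) => //; exact: hc.
Qed.

Lemma norm_crd_le j x : `|crd j x| <= `|x|.
Proof.
case: x => -[a b] c; rewrite !prod_normE /=.
by elim/ord3P: j; rewrite !le_max lexx ?orbT.
Qed.

Definition box (N : R) : set (R3 R) :=
  (`[- N, N]%classic `*` `[- N, N]%classic) `*` `[- N, N]%classic.

Lemma boxP N x : box N x <-> forall j, crd j x \in `[- N, N].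
Proof.
split=> [[[/= h0 h1] h2] j|h]; first by elim/ord3P: j.
split; first split => /=.
- exact: (h 0).
- exact: (h 1).
- exact: (h (Ordinal (isT : (2 < 3)%N))).
Qed.

Lemma measurable_box N : measurable (box N).
Proof. by apply: measurableX => //; exact: measurableX. Qed.

Lemma leb3_box N : 0 <= N -> leb3 R (box N) = ((2 * N) ^+ 3)%:E.
Proof.
move=> N0; have hI : lebesgue_measure (`[- N, N]%classic : set R) = (2 * N)%:E.
  rewrite lebesgue_measure_itv /= lte_fin.
  case: ltP => [_|]; first by rewrite -EFinD; congr EFin; ring.
  by move=> ?; congr EFin; lra.
rewrite /leb3 product_measure1E //; last exact: measurableX.
transitivity ((2 * N)%:E * (2 * N)%:E * (2 * N)%:E)%E; last first.
  by rewrite -!EFinM; congr EFin; ring.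
rewrite -[in RHS]hI; congr (_ * _)%E.
by apply: etrans (product_measure1E lebesgue_measure lebesgue_measure
  (measurable_itv _) (measurable_itv _)) _; rewrite /= hI.
Qed.

(** The sigma-algebra on triples is a product one, so an open set has to be written as a countable
    union of rectangles: the cubes with rational centre and radius [1 / (n + 1)] that it
    contains. *)
Lemma open_measurable3 (A : set (R3 R)) : open A -> measurable A.
Proof.
move=> oA.
pose B (q : rat * rat * rat * nat) : set (R3 R) :=
  (ball (ratr q.1.1.1 : R) q.2.+1%:R^-1 `*` ball (ratr q.1.1.2 : R) q.2.+1%:R^-1)
  `*` ball (ratr q.1.2 : R) q.2.+1%:R^-1.
have -> : A = \bigcup_(q in [set q | B q `<=` A]) B q.
  apply/seteqP; split=> [x Ax|x [q Bq Bx]]; last exact: Bq.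
  have /nbhs_ballP[e /= e0 eA] : nbhs x A by apply: open_nbhs_nbhs.
  have [n _ /(_ n (leqnn _)) nP] : \forall n \near \oo, n.+1%:R^-1 < e / 2 :> R.
    by apply: near_infty_natSinv_lt (PosNum _); rewrite divr_gt0.
  have hq (a : R) : exists q, ball (ratr q : R) n.+1%:R^-1 a.
    have : a - n.+1%:R^-1 < a + n.+1%:R^-1.
      by rewrite ltrD2l -subr_gt0 opprK addr_gt0 // invr_gt0.
    move=> /rat_in_itvoo[q]; rewrite in_itv /= => /andP[h1 h2].
    by exists q; rewrite /ball /= ltr_distl h1 h2.
  have [q0 h0] := hq x.1.1; have [q1 h1] := hq x.1.2; have [q2 h2] := hq x.2.
  exists (q0, q1, q2, n) => //= y [[/= y0 y1] y2]; apply: eA.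
  have tri (q a b : R) : ball q n.+1%:R^-1 a -> ball q n.+1%:R^-1 b -> ball a e b.
    rewrite /ball /= => ha hb; rewrite (_ : a - b = (q - b) - (q - a)); last by ring.
    apply: le_lt_trans (ler_normB _ _) _; apply: lt_trans (ltrD hb ha) _.
    by rewrite [ltRHS]splitr ltrD.
  by split; first split; [exact: tri h0 y0|exact: tri h1 y1|exact: tri h2 y2].
rewrite bigcup_mkcond; apply: countable_bigcupT_measurable => // q.
case: ifP => // _.
have mb (a r : R) : measurable (ball a r).
  exact: measurable_ball.
by apply: measurableX => //; exact: measurableX.
Qed.

Lemma continuous_measurable3 (f : R3 R -> R) :
  continuous f -> measurable_fun setT f.
Proof.
move=> /continuousP cf; apply: (measurability _ (RGenOpens.measurableE R)).
move=> _ [_ [a [b ->] <-]]; rewrite setTI; apply: open_measurable3.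
exact/cf/interval_open.
Qed.

Lemma closed_measurable3 (A : set (R3 R)) : closed A -> measurable A.
Proof.
by move=> cA; rewrite -[A]setCK; apply: measurableC; apply: open_measurable3; exact: closed_openC.
Qed.

End Slices.

Section Slab.
Context {R : realType}.

(** Fubini, with the absolute value taken only after the inner integration. Cancellation in the
    inner variable is thus kept, which a bound on the size of [h] would lose. *)
Lemma slab_bound d1 d2 (T1 : measurableType d1) (T2 : measurableType d2)
    (m1 : {sigma_finite_measure set T1 -> \bar R})
    (m2 : {sigma_finite_measure set T2 -> \bar R})
    (h : T1 * T2 -> R) (S : set T1) (c : R) :
  measurable S -> (m1 \x m2)%E.-integrable setT (EFin \o h) ->
  (forall x y, ~ S x -> h (x, y) = 0) -> 0 <= c ->
  (forall x, (`|\int[m2]_y (h (x, y))%:E| <= c%:E)%E) ->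
  (`|\int[m1 \x m2]_z (h z)%:E| <= c%:E * m1 S)%E.
Proof.
move=> mS ih h0 c0 hc; rewrite -(integral12_prod_meas1 ih).
have mF := measurable_fubini_F ih.
apply: le_trans (le_abse_integral _ measurableT mF) _.
rewrite (_ : (fun x => _) = (abse \o fubini_F m2 (EFin \o h)) \_ S); last first.
  apply/funext => x; rewrite patchE; case: ifPn => //; rewrite notin_setE => nSx.
  rewrite /fubini_F integral0_eq ?abse0 // => y _ /=; by rewrite h0.
rewrite -integral_mkcond; apply: (integral_le_bound c%:E) => //.
  exact: measurable_funTS.
by apply: aeW => x _; exact: hc.
Qed.

Lemma slab_bound_swap d1 d2 (T1 : measurableType d1) (T2 : measurableType d2)
    (m1 : {sigma_finite_measure set T1 -> \bar R})
    (m2 : {sigma_finite_measure set T2 -> \bar R})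
    (h : T1 * T2 -> R) (S : set T2) (c : R) :
  measurable S -> (m1 \x m2)%E.-integrable setT (EFin \o h) ->
  (forall x y, ~ S y -> h (x, y) = 0) -> 0 <= c ->
  (forall y, (`|\int[m1]_x (h (x, y))%:E| <= c%:E)%E) ->
  (`|\int[m1 \x m2]_z (h z)%:E| <= c%:E * m2 S)%E.
Proof.
move=> mS ih h0 c0 hc; rewrite -(integral21_prod_meas1 ih).
have mF := measurable_fubini_G ih.
apply: le_trans (le_abse_integral _ measurableT mF) _.
rewrite (_ : (fun x => _) = (abse \o fubini_G m1 (EFin \o h)) \_ S); last first.
  apply/funext => x; rewrite patchE; case: ifPn => //; rewrite notin_setE => nSx.
  rewrite /fubini_G integral0_eq ?abse0 // => y _ /=; by rewrite h0.
rewrite -integral_mkcond; apply: (integral_le_bound c%:E) => //.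
  exact: measurable_funTS.
by apply: aeW => x _; exact: hc.
Qed.

Lemma bounded_supp_integrable d (T : measurableType d)
    (m : {measure set T -> \bar R}) (h : T -> R) (S : set T) (M : R) :
  measurable S -> (m S < +oo)%E -> measurable_fun setT h ->
  (forall x, `|h x| <= M) -> (forall x, ~ S x -> h x = 0) ->
  m.-integrable setT (EFin \o h).
Proof.
move=> mS Soo mh hM h0.
have -> : EFin \o h = (EFin \o h) \_ S.
  apply/funext => x; rewrite patchE; case: ifPn => //; rewrite notin_setE => nSx.
  by rewrite /= h0.
apply/(integrable_mkcond _ mS)/measurable_bounded_integrable => //.
  exact: measurable_funTS.
exists M; split; first exact: num_real.
by move=> K MK x Sx /=; apply: le_trans (hM x) (ltW MK).
Qed.

End Slab.

(* The library's sigma-finiteness instance for product measures is shadowed by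
   the one for subprobabilities, so it is redeclared for this product. *)
Definition leb2 (R : realType) :
    set (measurableTypeR R * measurableTypeR R) -> \bar R :=
  (@lebesgue_measure R \x @lebesgue_measure R)%E.
Arguments leb2 : clear implicits.

HB.instance Definition _ (R : realType) := Measure.on (leb2 R).

Lemma leb2_sigma_finite (R : realType) : sigma_finite setT (leb2 R).
Proof.
have leI n : lebesgue_measure (`[- n%:R, n%:R]%classic : set R) = (n%:R *+ 2)%:E.
  rewrite lebesgue_measure_itv /= lte_fin; case: ltP => [_|].
    by rewrite -EFinD opprK mulr2n.
  by have := ler0n R n => n0 nn; congr EFin; rewrite mulr2n; lra.
exists (fun n => `[- n%:R, n%:R] `*` `[- n%:R, n%:R]).
  apply/seteqP; split=> // -[x y] _ /=.
  have := archi_boundP (normr_ge0 x); set nx := Num.bound _ => hx.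
  have := archi_boundP (normr_ge0 y); set ny := Num.bound _ => hy.
  exists (nx + ny)%N => //; split; rewrite /= in_itv /= -ler_norml natrD.
    by rewrite (le_trans (ltW hx)) // lerDl.
  by rewrite (le_trans (ltW hy)) // lerDr.
move=> n; split; first by apply: measurableX; exact: measurable_itv.
apply: (eq_ind_r (fun z => z < +oo)%E _ (product_measure1E lebesgue_measure
  lebesgue_measure (measurable_itv _) (measurable_itv _))).
by rewrite /= leI -EFinM ltry.
Qed.

HB.instance Definition _ (R : realType) :=
  Measure_isSigmaFinite.Build _ _ _ (leb2 R) (@leb2_sigma_finite R).

(** Serves three purposes: smallness of integrals of gradients over boxes, integration by parts
    (with [c = 0]), and the measure of a union of thin layers (with an indicator as [f]). *)
Lemma slice_bound {R : realType} (j : 'I_3) (N c M : R) (f : R3 R -> R) :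
  0 <= N -> 0 <= c -> measurable_fun setT f -> (forall x, `|f x| <= M) ->
  (forall x, ~ box N x -> f x = 0) ->
  (forall x, (`|\int[lebesgue_measure]_s (f (upd j x s))%:E| <= c%:E)%E) ->
  (`|\int[leb3 R]_x (f x)%:E| <= (c * (2 * N) ^+ 2)%:E)%E.
Proof.
move=> N0 c0 mf fM f0 hc.
have leI : lebesgue_measure (`[- N, N]%classic : set R) = (2 * N)%:E.
  rewrite lebesgue_measure_itv /= lte_fin.
  case: ltP => [_|]; first by rewrite -EFinD; congr EFin; ring.
  by move=> ?; congr EFin; lra.
pose I1 : set R := `[- N, N]%classic; pose I2 : set (R * R) := I1 `*` I1.
have leI2 : leb2 R I2 = ((2 * N) ^+ 2)%:E.
  apply: etrans (product_measure1E lebesgue_measure lebesgue_measure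
    (measurable_itv _) (measurable_itv _)) _.
  by rewrite /= leI -EFinM; congr EFin; ring.
have mI1 : measurable I1 by exact: measurable_itv.
have mI2 : measurable I2 by exact: measurableX.
have if3 : (leb2 R \x @lebesgue_measure R)%E.-integrable setT (EFin \o f).
  apply: (@bounded_supp_integrable _ _ _ (leb2 R \x @lebesgue_measure R)%E f (box N) M) => //.
    exact: measurable_box.
  by apply: (eq_ind_r (fun z => z < +oo)%E (ltry _) (leb3_box N0)).
have if2 z : (leb2 R).-integrable setT
    (EFin \o (fun p : R * R => f (p, z))).
  apply: (@bounded_supp_integrable _ _ _ (leb2 R)
    (fun p : R * R => f (p, z)) I2 M) => //.
  - by apply: (eq_ind_r (fun z => z < +oo)%E (ltry _) leI2).
  - by apply: measurableT_comp mf _; exact: measurable_fun_pair.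
  - by move=> p np; apply: f0 => -[].
have N2 : 0 <= 2 * N by rewrite mulr_ge0.
(* The product is bracketed as [(R * R) * R]. For the first two directions a slab in the third
   coordinate is followed by a slab inside the square; for the third direction the square itself is
   the slab. *)
elim/ord3P: j hc => hc.
- have -> : (c * (2 * N) ^+ 2)%:E =
    ((c * (2 * N))%:E * lebesgue_measure I1)%E.
    by rewrite leI -EFinM; congr EFin; ring.
  refine (@slab_bound_swap R _ _ _ _ (leb2 R)
    (@lebesgue_measure R) f I1 (c * (2 * N)) mI1 if3 _ _ _).
  + by move=> p z nz; apply: f0 => -[].
  + by rewrite mulr_ge0.
  move=> z; rewrite EFinM -leI.
  refine (@slab_bound_swap R _ _ _ _ (@lebesgue_measure R) (@lebesgue_measure R)
    (fun p => f (p, z)) I1 c mI1 (if2 z) _ c0 _).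
    by move=> a b nb; apply: f0 => -[[]].
  by move=> b; have := hc (0, b, z).
- have -> : (c * (2 * N) ^+ 2)%:E =
    ((c * (2 * N))%:E * lebesgue_measure I1)%E.
    by rewrite leI -EFinM; congr EFin; ring.
  refine (@slab_bound_swap R _ _ _ _ (leb2 R)
    (@lebesgue_measure R) f I1 (c * (2 * N)) mI1 if3 _ _ _).
  + by move=> p z nz; apply: f0 => -[].
  + by rewrite mulr_ge0.
  move=> z; rewrite EFinM -leI.
  refine (@slab_bound R _ _ _ _ (@lebesgue_measure R) (@lebesgue_measure R)
    (fun p => f (p, z)) I1 c mI1 (if2 z) _ c0 _).
    by move=> a b nb; apply: f0 => -[[]].
  by move=> b; have := hc (b, 0, z).
- rewrite EFinM -leI2.
  refine (@slab_bound R _ _ _ _ (leb2 R) (@lebesgue_measure R) f I2 c mI2 if3 _ c0 _).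
    by move=> p z nz; apply: f0 => -[].
  by move=> [a b]; have := hc (a, b, 0).
Qed.

(** * Weak-* convergence to zero *)

Section Vanishing.
Context d (T : measurableType d) (R : realType).
Variables (mu : {measure set T -> \bar R}) (w : nat -> T -> R) (M : R).
Hypothesis mw : forall k, measurable_fun setT (w k).
Hypothesis wM : forall k x, `|w k x| <= M.

Lemma integrable_bounded_mul (D : set T) (v h : T -> R) :
  measurable D -> measurable_fun D v -> (forall x, D x -> `|v x| <= M) ->
  mu.-integrable D (EFin \o h) ->
  mu.-integrable D (EFin \o (fun x => v x * h x)).
Proof.
move=> mD mv vM ih; have mh := measurable_int _ ih.
apply: (@le_integrable _ _ _ mu D mD _ (fun x => (M * h x)%:E)).
- apply/measurable_EFinP/measurable_funM => //; exact/measurable_EFinP.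
- move=> x Dx /=; rewrite lee_fin !normrM ler_wpM2r //.
  by apply: le_trans (vM x Dx) (ler_norm _).
- exact: (integrableZl mD M ih).
Qed.

(** Integrability is included because additivity of the real-valued integral depends on it. *)
Definition vanishing (h : T -> R) : Prop :=
  mu.-integrable setT (EFin \o h) /\
  (fun k => \int[mu]_x (w k x * h x)) @ \oo --> (0 : R).

Lemma integrable_wM k h : mu.-integrable setT (EFin \o h) ->
  mu.-integrable setT (EFin \o (fun x => w k x * h x)).
Proof. by move=> ih; exact: integrable_bounded_mul. Qed.

Lemma vanishing0 : vanishing (fun=> 0).
Proof.
split; first exact: integrable0.
rewrite (_ : (fun k => _) = (fun=> 0)); first exact: cvg_cst.
apply/funext => k; rewrite (_ : (fun x => _) = (fun=> 0)) ?Rintegral0 //.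
  by rewrite /Rintegral integral0.
by apply/funext => x; rewrite mulr0.
Qed.

Lemma vanishingD h1 h2 : vanishing h1 -> vanishing h2 ->
  vanishing (fun x => h1 x + h2 x).
Proof.
move=> [i1 c1] [i2 c2]; split.
  by rewrite (_ : _ \o _ = (fun x => (h1 x)%:E + (h2 x)%:E)%E) //; exact: integrableD.
rewrite (_ : (fun k => _) =
  (fun k => \int[mu]_x (w k x * h1 x) + \int[mu]_x (w k x * h2 x))).
  by rewrite -[X in _ --> X](addr0 (0 : R)); exact: cvgD c1 c2.
apply/funext => k; rewrite -RintegralD //; try exact: integrable_wM.
by apply: eq_Rintegral => x _; rewrite mulrDr.
Qed.

Lemma vanishingZ a h : vanishing h -> vanishing (fun x => a * h x).
Proof.
move=> [i1 c1]; split; first exact: (integrableZl measurableT a i1).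
rewrite (_ : (fun k => _) = (fun k => a * \int[mu]_x (w k x * h x))).
  by rewrite -[X in _ --> X](mulr0 a); apply: cvgM => //; exact: cvg_cst.
apply/funext => k; rewrite -RintegralZl //; last exact: integrable_wM.
by apply: eq_Rintegral => x _; rewrite mulrCA.
Qed.

Lemma vanishing_sum n (h : 'I_n -> T -> R) : (forall i, vanishing (h i)) ->
  vanishing (fun x => \sum_(i < n) h i x).
Proof.
elim: n h => [h _|n IH h hv].
  rewrite (_ : (fun x => _) = (fun=> 0)); first exact: vanishing0.
  by apply/funext => x; rewrite big_ord0.
rewrite (_ : (fun x => _) =
  (fun x => \sum_(i < n) h (widen_ord (leqnSn n) i) x + h ord_max x)).
  by apply: vanishingD => //; apply: IH => i.
by apply/funext => x; rewrite big_ord_recr.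
Qed.

(** The [w k] are bounded by [M] uniformly in [k], so replacing [h] by an L^1-close [h'] changes all
    the integrals by a small amount at once. *)
Lemma vanishing_closed h : mu.-integrable setT (EFin \o h) ->
  (forall e, 0 < e -> exists2 h', vanishing h' &
     (\int[mu]_x `|h x - h' x|%:E <= e%:E)%E) ->
  vanishing h.
Proof.
move=> ih happ; split=> //; apply/cvgrPdist_le => e e0.
have M0 : 0 < `|M| + 1 by rewrite ltr_wpDl.
have d0 : 0 < e / 2 / (`|M| + 1) by rewrite !divr_gt0.
have [h' [ih' /cvgrPdist_le c'] hh'] := happ _ d0.
have e20 : 0 < e / 2 by rewrite divr_gt0.
have := c' _ e20; apply: filterS => k; rewrite !sub0r !normrN => hk.
have idiff : mu.-integrable setT (EFin \o (fun x => h x - h' x)).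
  by rewrite (_ : _ \o _ = (fun x => (h x)%:E - (h' x)%:E)%E) //; exact: integrableB.
have -> : \int[mu]_x (w k x * h x) =
  \int[mu]_x (w k x * h' x) + \int[mu]_x (w k x * (h x - h' x)).
  rewrite -RintegralD //; try exact: integrable_wM.
  by apply: eq_Rintegral => x _; ring.
rewrite (le_trans (ler_normD _ _)) // [leRHS]splitr lerD //.
have idw := integrable_wM k idiff.
rewrite -lee_fin EFin_normr_Rintegral //.
apply: le_trans (le_abse_integral _ measurableT (measurable_int _ idw)) _.
have mabs : measurable_fun setT (fun x => `|h x - h' x|%:E).
  apply/measurable_EFinP; apply: measurableT_comp => //.
  by apply/measurable_EFinP; exact: measurable_int idiff.
apply: (@le_trans _ _ (\int[mu]_x ((`|M| + 1)%:E * `|h x - h' x|%:E))%E).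
  apply: ge0_le_integral => //.
  - by apply: measurableT_comp => //; exact: measurable_int idw.
  - apply/measurable_EFinP; apply: measurable_funM => //.
    apply: measurableT_comp => //.
    by apply/measurable_EFinP; exact: measurable_int idiff.
  - move=> x _ /=; rewrite -EFinM lee_fin normrM ler_wpM2r //.
    by rewrite (le_trans (wM _ _)) // (le_trans (ler_norm _)) // lerDl.
rewrite ge0_integralZl ?lee_fin //.
apply: (@le_trans _ _ ((`|M| + 1)%:E * (e / 2 / (`|M| + 1))%:E)%E).
  by rewrite lee_wpmul2l // lee_fin ltW.
by rewrite -EFinM lee_fin mulrCA divff ?mulr1 // gt_eqF.
Qed.

(* Dynkin's argument: the sets [S] with [vanishing \1_(S `&` B)] form a
   lambda-system. *)
Lemma vanishing_pi_system (G : set (set T)) (B : set T) :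
  @measurable d T = <<s G>> -> setI_closed G -> measurable B ->
  (mu B < +oo)%E -> vanishing \1_B ->
  (forall S, G S -> vanishing \1_(S `&` B)) ->
  forall S, measurable S -> vanishing \1_(S `&` B).
Proof.
move=> GE GI mB Boo vB vG S; rewrite GE.
have ifin A : measurable A -> mu.-integrable setT (EFin \o \1_(A `&` B)).
  move=> mA; apply: (bounded_supp_integrable (S := B) (M := 1)) => //.
  - exact/measurable_indic/measurableI.
  - by move=> x; rewrite indicE; case: (_ \in _); rewrite ?normr1 ?normr0.
  - by move=> x nBx; rewrite indicE memNset // => -[].
apply: (dynkin_induction (P := fun S => vanishing \1_(S `&` B))) => //.
- by rewrite setTI.
- move=> A mA vA.
  rewrite (_ : \1_(~` A `&` B) = (fun x => \1_B x + (-1) * \1_(A `&` B) x)).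
    by apply: vanishingD => //; exact: vanishingZ.
  apply/funext => x; rewrite !indicE !in_setI in_setC.
  by case: (x \in A); case: (x \in B) => /=; ring.
(* The finite unions [E m] increase to the whole union. Since [B] has finite measure, their
   indicators converge in L^1, and each is a finite sum by disjointness. *)
- move=> F mF tF vF; apply: vanishing_closed.
    exact/ifin/bigcup_measurable.
  pose E m := \big[setU/set0]_(i < m) F i.
  have mE m : measurable (E m) by exact: bigsetU_measurable.
  have vE m : vanishing \1_(E m `&` B).
    rewrite (_ : \1_(E m `&` B) = (fun x => \sum_(i < m) \1_(F i `&` B) x)).
      by apply: vanishing_sum.
    rewrite /E; elim: m => [|m IH].
      by apply/funext => x; rewrite !big_ord0 set0I indic0.
    apply/funext => x; rewrite !big_ord_recr /= -(congr1 (@^~ x) IH) /= !indicE setIUl in_setU.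
    have : ~~ ((x \in \big[setU/set0]_(i < m) F i `&` B) && (x \in F m `&` B)).
      apply/negP => /andP[]; rewrite !in_setE -bigcup_mkord => -[[i /= im Fi] _] [Fm _].
      have := tF i m I I; move/(_ (ex_intro _ x (conj Fi Fm))) => ei.
      by rewrite ei ltnn in im.
    by case: (x \in _); case: (x \in _) => //=; rewrite ?addr0 ?add0r.
  move=> e e0.
  have cE : mu (E m `&` B) @[m --> \oo] --> mu (\bigcup_i F i `&` B).
    rewrite (_ : \bigcup_i F i `&` B = \bigcup_i (E i `&` B)).
      apply: nondecreasing_cvg_mu.
      - by move=> m; exact: measurableI.
      - by apply: bigcup_measurable => m _; exact: measurableI.
      - move=> m n mn; apply/subsetPset; apply: setSI.
        by rewrite /E -!bigcup_mkord; apply: bigcup_sub => i /= im x Fx; exists i => //=; exact: leq_trans im mn.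
    rewrite -setI_bigcupl; congr (_ `&` _); apply/seteqP; split=> [x [i _ Fx]|x [i _]].
      by exists i.+1 => //; rewrite /E -bigcup_mkord; exists i => /=.
    by rewrite /E -bigcup_mkord => -[j _ Fx]; exists j.
  have Ufin : mu (\bigcup_i F i `&` B) \is a fin_num.
    rewrite ge0_fin_numE //; apply: le_lt_trans Boo; apply: le_measure;
      [apply/mem_set/measurableI => //; exact: bigcup_measurable|exact: mem_set|].
    exact: subIsetr.
  have Efin m : mu (E m `&` B) \is a fin_num.
    rewrite ge0_fin_numE //; apply: le_lt_trans Boo; apply: le_measure;
      [exact/mem_set/measurableI|exact: mem_set|exact: subIsetr].
  have /fine_cvgP[_ /cvgrPdist_le /(_ e e0)[m _ /(_ m (leqnn _)) hm]] :
    mu (E m `&` B) @[m --> \oo] --> (fine (mu (\bigcup_i F i `&` B)))%:E.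
    by rewrite fineK.
  exists \1_(E m `&` B) => //.
  have sub : E m `&` B `<=` \bigcup_i F i `&` B.
    by apply: setSI; exact: bigsetU_bigcup.
  have mU : measurable (\bigcup_i F i `&` B).
    by apply: measurableI => //; exact: bigcup_measurable.
  rewrite (_ : (fun x => _) = (fun x => (\1_((\bigcup_i F i `&` B) `\` (E m `&` B)) x)%:E)); last first.
    apply/funext => x; congr EFin; rewrite !indicE in_setD.
    case: (boolP (x \in E m `&` B)) => h /=.
      have -> : x \in \bigcup_i F i `&` B by move: h; rewrite !in_setE; exact: sub.
      by rewrite subrr normr0.
    by rewrite subr0 andbT ger0_norm.
  rewrite integral_indic //; last by apply: measurableD => //; exact: measurableI.
  rewrite setIT measureD //; last 2 first.
    exact: measurableI.
    by rewrite -ge0_fin_numE.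
  rewrite (setIidr sub).
  apply: (@le_trans _ _ (fine (mu (\bigcup_i F i `&` B)) - fine (mu (E m `&` B)))%:E).
    by rewrite EFinB !fineK.
  by rewrite lee_fin; exact: le_trans (ler_norm _) hm.
Qed.

Import HBSimple.

(** Simple functions are dense in L^1, and a simple function supported in [D] is a finite
    combination of indicators of measurable subsets of [B]. *)
Lemma vanishing_integrable (G : set (set T)) (B D : set T) (g : T -> R) :
  @measurable d T = <<s G>> -> setI_closed G -> measurable B ->
  (mu B < +oo)%E -> vanishing \1_B ->
  (forall S, G S -> vanishing \1_(S `&` B)) ->
  measurable D -> D `<=` B -> mu.-integrable D (EFin \o g) ->
  (fun k => \int[mu]_(x in D) (w k x * g x)) @ \oo --> (0 : R).
Proof.
move=> GE GI mB Boo vB vG mD DB ig.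
have igD : mu.-integrable setT (EFin \o (g \_ D)).
  by rewrite -restrict_EFin; apply/(integrable_mkcond _ mD).
suff [_] : vanishing (g \_ D).
  rewrite (_ : (fun k => \int[mu]_x _) = (fun k => \int[mu]_(x in D) (w k x * g x))) //.
  apply/funext => k; rewrite [RHS]Rintegral_mkcond; apply: eq_Rintegral => x _.
  by rewrite !patchE; case: ifP => //; rewrite mulr0.
apply: vanishing_closed igD _ => e e0.
have [s' [si' sc]] : exists s' : {sfun T >-> R}, mu.-integrable D (EFin \o s') /\
  (\int[mu]_(z in D) `|(g z)%:E - (s' z)%:E| <= e%:E)%E.
  have [s'' [si'' _ sc]] := approximation_sfun_integrable mD ig.
  move: sc => /fine_cvgP[[n1 _ hn1] /cvgrPdist_le /(_ e e0)[n2 _ hn2]].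
  exists (s'' (maxn n1 n2)); split=> //.
  rewrite -(fineK (hn1 _ (leq_maxl _ _))) lee_fin.
  have := hn2 _ (leq_maxr n1 n2); rewrite sub0r normrN; exact: le_trans (ler_norm _).
exists (s' \_ D).
  pose ss := finmap.enum_fset (fset_set (range s')).
  rewrite (_ : s' \_ D =
    (fun x => \sum_(i < size ss) (ss`_i * \1_((s' @^-1` [set ss`_i] `&` D) `&` B) x))).
    apply: vanishing_sum => i; apply: vanishingZ.
    by apply: (vanishing_pi_system GE) => //; apply: measurableI.
  apply/funext => x; rewrite patchE; case: ifPn => [xD|xND].
    rewrite fimfunEord; apply: eq_bigr => i _; congr (_ * _).
    rewrite !indicE !in_setI xD andbT (_ : x \in B) ?andbT //.
    by move: xD; rewrite !in_setE; exact: DB.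
  by rewrite big1 // => i _; rewrite indicE !in_setI (negbTE xND) andbF mulr0.
apply: le_trans sc; rewrite [leRHS]integral_mkcond le_eqVlt; apply/orP; left; apply/eqP.
by apply: eq_integral => x _; rewrite !patchE; case: ifP => // _; rewrite subr0 normr0.
Qed.

End Vanishing.

Lemma integral_is_derive (R : realType) (F f : R -> R) (a b : R) : a < b ->
  continuous f -> (forall s, is_derive s (1 : R) F (f s)) ->
  (\int[lebesgue_measure]_(x in `[a, b]) (f x)%:E = (F b - F a)%:E)%E.
Proof.
move=> ab cf dF; rewrite EFinB; apply: continuous_FTC2 => //.
- exact: continuous_subspaceT.
- have cF : continuous F.
    by move=> s; apply: differentiable_continuous; apply/derivable1_diffP; have [] := dF s.
  split.
  + by move=> x _; have [] := dF x.
  + by apply: cvg_at_right_filter; exact: cF.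
  + by apply: cvg_at_left_filter; exact: cF.
- by move=> x _; rewrite derive1E; have [_ ->] := dF x.
Qed.

(** * Closed boxes as a generating pi-system of the Borel sets *)

Section ClosedBoxes.
Context {R : realType}.
Implicit Types (a b : 'I_3 -> R) (x : R3 R).

Definition cbox a b : set (R3 R) := [set x | forall i, crd i x \in `[a i, b i]].

Lemma boxE N : box N = cbox (fun=> - N) (fun=> N).
Proof. by apply/seteqP; split=> x /boxP. Qed.

Lemma cboxI a b c d :
  cbox a b `&` cbox c d =
  cbox (fun i => Num.max (a i) (c i)) (fun i => Num.min (b i) (d i)).
Proof.
apply/seteqP; split=> x /=.
  move=> [h1 h2] i; move: (h1 i) (h2 i); rewrite !in_itv /= ge_max le_min.
  by move=> /andP[-> ->] /andP[-> ->].
move=> h; split=> i; move: (h i); rewrite !in_itv /= ge_max le_min;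
  by case/andP=> /andP[h1 h2] /andP[h3 h4]; apply/andP.
Qed.

Lemma measurable_cbox a b : measurable (cbox a b).
Proof.
apply: closed_measurable3.
rewrite (_ : cbox a b = \bigcap_(i in setT) (crd i @^-1` `[a i, b i]%classic)).
  by apply: closed_bigI => i _; apply: closed_comp; [move=> x _; exact: continuous_crd|exact: itv_closed].
by apply/seteqP; split=> x h i; [move=> _; exact: h|exact: (h i I)].
Qed.

(** The bounds are unordered, so empty boxes belong to the family; this is what makes it stable
    under intersection. *)
Definition cboxes : set (set (R3 R)) := [set S | exists a b, S = cbox a b].

Lemma cboxes_setI : setI_closed cboxes.
Proof. by move=> _ _ [a [b ->]] [c [d ->]]; rewrite cboxI; do 2 eexists. Qed.

(** Each half-space [c <= crd i x] is a countable union of growing boxes, so the coordinates, and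
    with them the identity map, are measurable for the sigma-algebra generated by boxes. *)
Lemma measurable_cboxesE : @measurable _ (R3 R) = <<s cboxes>>.
Proof.
apply/seteqP; split=> [A mA|]; last first.
  apply: smallest_sub; first exact: sigma_algebra_measurable.
  by move=> _ [a [b ->]]; exact: measurable_cbox.
pose T := g_sigma_algebraType cboxes.
have mc i : measurable_fun (setT : set T) (crd i : T -> R).
  apply: (measurability _ (RGenCInfty.measurableE R)) => _ [_ [c ->] <-].
  rewrite setTI.
  rewrite (_ : _ @^-1` _ = \bigcup_n
      cbox (fun l => if l == i then c else - n%:R) (fun=> n%:R)).
    by apply: bigcup_measurable => n _; apply: sub_sigma_algebra; do 2 eexists.
  apply/seteqP; split=> [x|x [n _ /(_ i)]]; last first.
    by rewrite eqxx /= !in_itv /= => /andP[-> _].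
  rewrite /= in_itv /= andbT => cx.
  exists (Num.bound `|x|) => // l; rewrite in_itv /=.
  have /andP[h1 h2] : - (Num.bound `|x|)%:R <= crd l x <= (Num.bound `|x|)%:R.
    rewrite -ler_norml; apply: le_trans (norm_crd_le l x) _.
    by apply/ltW/archi_boundP.
  by rewrite h2 andbT; case: eqP => // ->.
have mid : measurable_fun (setT : set T) (id : T -> R3 R).
  rewrite (_ : id = (fun x : T => ((crd 0 x, crd 1 x), crd (Ordinal (isT : (2 < 3)%N)) x))).
    by apply: measurable_fun_pair; [apply: measurable_fun_pair|]; exact: mc.
  by apply/funext => -[[]].
by have := mid measurableT _ mA; rewrite setTI.
Qed.

End ClosedBoxes.

(** * Derivatives along coordinate lines and weak derivatives *)

Section Partials.
Context {R : realType}.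
Implicit Types (x : R3 R) (u g v w : R3 R -> R) (j : 'I_3).

(** Stated through functions of one real variable, so that the one-dimensional chain rule and
    fundamental theorem of calculus apply directly. *)
Definition partial_of j u g : Prop :=
  [/\ continuous u, continuous g &
      forall x s, is_derive s (1 : R) (fun t => u (upd j x t)) (g (upd j x s))].

Lemma continuous_slice j g x : continuous g -> continuous (fun s => g (upd j x s)).
Proof.
move=> cg s; apply: continuous_comp; first exact: continuous_upd.
exact: cg.
Qed.

(** A slice meets the box in the segment from [a j] to [b j] or not at all. In the first case the
    integral of [w] is a difference of two values of [v], whence the factor 2. *)
Lemma integral_slice_cbox j v w (e : R) a b x :
  partial_of j v w -> (forall y, `|v y| <= e) ->
  (`|\int[lebesgue_measure]_s (w (upd j x s) * \1_(cbox a b) (upd j x s))%:E|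
     <= (e *+ 2)%:E)%E.
Proof.
move=> [cv cw dv] ve.
have e0 : 0 <= e by apply: le_trans (ve x).
have e2 : 0 <= e *+ 2 by rewrite mulrn_wge0.
have [ho|nho] := pselect (forall i, i != j -> crd i x \in `[a i, b i]); last first.
  rewrite integral0_eq ?abse0 ?lee_fin // => s _.
  rewrite indicE memNset ?mulr0 // => h; apply: nho => i ij.
  by have := h i; rewrite crd_upd (negbTE ij).
rewrite (_ : (fun s => _) =
    (fun s => (w (upd j x s))%:E) \_ `[a j, b j]); last first.
  apply/funext => s; rewrite patchE; case: ifPn.
    move=> hs; rewrite indicE mem_set ?mulr1 // => i; rewrite crd_upd.
    by case: (eqVneq i j) => [->|/ho//]; move: hs; rewrite inE.
  move=> hs; rewrite indicE memNset ?mulr0 // => /(_ j); rewrite crd_upd eqxx => h.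
  by move/negP: hs; apply; rewrite inE.
rewrite -integral_mkcond; have [ab|ba|<-] := ltgtP (a j) (b j).
- rewrite (integral_is_derive ab (@continuous_slice j w x cw) (dv x)) /= lee_fin mulr2n.
  by rewrite (le_trans (ler_normB _ _)) // lerD.
- by rewrite set_itv_ge ?integral_set0 ?abse0 ?lee_fin // bnd_simp -ltNge.
- by rewrite set_itv1 integral_set1 abse0 lee_fin.
Qed.

(* The integral of [w k] over a box is a boundary term, hence at most of the
   order of [sup |v k|]; boxes generate the Borel sets. *)
Lemma weak_star_partial j (v w : nat -> R3 R -> R) (M N : R) (e : nat -> R)
    (D : set (R3 R)) (h : R3 R -> R) :
  (forall k, partial_of j (v k) (w k)) -> (forall k x, `|w k x| <= M) ->
  (forall k x, `|v k x| <= e k) -> e @ \oo --> (0 : R) ->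
  measurable D -> D `<=` box N -> (leb3 R).-integrable D (EFin \o h) ->
  (fun k => \int[leb3 R]_(x in D) (w k x * h x)) @ \oo --> (0 : R).
Proof.
move=> hp wM ve e0 mD DB ih.
wlog N0 : N DB / 0 <= N.
  apply; last exact: (normr_ge0 N).
  move=> x /DB; rewrite !boxE => hx i; move: (hx i); rewrite !in_itv /= -!ler_norml.
  by move=> /le_trans; apply; exact: ler_norm.
have mw k : measurable_fun setT (w k).
  by apply: continuous_measurable3; have [] := hp k.
have Boo : (leb3 R (box N) < +oo)%E.
  by apply: (eq_ind_r (fun z => z < +oo)%E (ltry _) (leb3_box N0)).
have vc a b : vanishing (leb3 R) w \1_(cbox a b `&` box N).
  rewrite boxE cboxI; set a' := fun i => _; set b' := fun i => _.
  have sub : cbox a' b' `<=` box N by rewrite /a' /b' -cboxI -boxE; exact: subIsetr.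
  split.
    apply: (@bounded_supp_integrable _ _ _ (leb3 R) _ (box N) 1) => //.
    - exact: measurable_box.
    - by apply: measurable_indic; exact: measurable_cbox.
    - by move=> x; rewrite indicE; case: (_ \in _); rewrite ?normr1 ?normr0.
    - by move=> x nx; rewrite indicE memNset // => /sub.
  apply/cvgrPdist_le => d d0.
  have c0 : 0 < (2 * N) ^+ 2 * 2 + 1 by rewrite ltr_wpDl // mulr_ge0 // exprn_ge0 // mulr_ge0.
  move/cvgrPdist_le : e0 => /(_ (d / ((2 * N) ^+ 2 * 2 + 1))).
  rewrite divr_gt0 // => /(_ isT); apply: filterS => k.
  rewrite !sub0r !normrN => ek.
  have eb : e k * ((2 * N) ^+ 2 * 2 + 1) <= d.
    by rewrite -ler_pdivlMr // (le_trans (ler_norm _)).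
  have ek0 : 0 <= e k by apply: le_trans (ve k (0, 0, 0)).
  have := @slice_bound R j N (e k *+ 2) M (fun x => w k x * \1_(cbox a' b') x) N0.
  rewrite mulrn_wge0 // => /(_ isT).
  have mf : measurable_fun setT (fun x => w k x * \1_(cbox a' b') x).
    by apply: measurable_funM => //; apply: measurable_indic; exact: measurable_cbox.
  move=> /(_ mf).
  have bf x : `|w k x * \1_(cbox a' b') x| <= M.
    rewrite indicE; case: (_ \in _); rewrite ?mulr1 ?mulr0 ?normr0 //.
    exact: le_trans (wM k x).
  move=> /(_ bf).
  have zf x : ~ box N x -> w k x * \1_(cbox a' b') x = 0.
    by move=> nx; rewrite indicE memNset ?mulr0 // => /sub.
  move=> /(_ zf).
  move=> /(_ (fun x => @integral_slice_cbox j (v k) (w k) (e k) a' b' x (hp k) (ve k))).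
  move=> hb; rewrite -lee_fin EFin_normr_Rintegral //.
    apply: le_trans hb _; rewrite lee_fin; apply: le_trans eb.
    rewrite (_ : e k *+ 2 * (2 * N) ^+ 2 = e k * ((2 * N) ^+ 2 * 2)).
      by rewrite ler_wpM2l // lerDl.
    by rewrite -mulr_natr; ring.
  by apply: (@bounded_supp_integrable _ _ _ (leb3 R) _ (box N) M) => //; exact: measurable_box.
apply: (@vanishing_integrable _ _ R (leb3 R) w M mw wM cboxes (box N) D h) => //.
- exact: measurable_cboxesE.
- exact: cboxes_setI.
- exact: measurable_box.
- by have := vc (fun=> - N) (fun=> N); rewrite -boxE setIid.
- by move=> _ [a [b ->]].
Qed.

Lemma compact_supp_bounded (f : R3 R -> R) (C : set (R3 R)) : continuous f ->
  compact C -> (forall x, ~ C x -> f x = 0) -> exists M, forall x, `|f x| <= M.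
Proof.
move=> cf cC f0.
have /compact_bounded[K [_ hK]] : compact (f @` C).
  by apply: continuous_compact => //; exact: continuous_subspaceT.
exists (`|K| + 1) => x; have [Cx|/f0 ->] := pselect (C x).
  apply: hK; last by exists x.
  by rewrite (le_lt_trans (ler_norm K)) // ltrDl.
by rewrite normr0 addr_ge0.
Qed.

Lemma compact_sub_box (C : set (R3 R)) : compact C -> exists2 N, 0 <= N & C `<=` box N.
Proof.
move=> /compact_bounded[K [_ hK]]; exists (`|K| + 1); first by rewrite addr_ge0.
move=> x Cx; rewrite boxE => i; rewrite in_itv /= -ler_norml.
apply: le_trans (norm_crd_le i x) _; apply: hK => //.
by rewrite (le_lt_trans (ler_norm K)) // ltrDl.
Qed.

Lemma integrable_compact_supp (f : R3 R -> R) (C : set (R3 R)) : continuous f ->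
  compact C -> (forall x, ~ C x -> f x = 0) ->
  (leb3 R).-integrable setT (EFin \o f).
Proof.
move=> cf cC f0; have [M fM] := compact_supp_bounded cf cC f0.
have [N N0 CN] := compact_sub_box cC.
apply: (@bounded_supp_integrable _ _ _ (leb3 R) _ (box N) M) => //.
- exact: measurable_box.
- by apply: (eq_ind_r (fun z => z < +oo)%E (ltry _) (leb3_box N0)).
- exact: continuous_measurable3.
- by move=> x nx; apply: f0 => /CN.
Qed.

Lemma test_function_partial (Omega : set (R3 R)) (phi : R3 R -> R) j :
  test_function Omega phi -> partial_of j phi ('D_(basis_pt j) phi).
Proof.
move=> [sphi _]; have [dphi cD] := sphi 1%N j; split=> //; first exact: (sphi 0%N).
move=> x s.
have E : (fun h : R => h^-1 *: (((fun t => phi (upd j x t)) \o shift s) (h *: (1 : R))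
      - phi (upd j x s))) =
    (fun h => h^-1 *: ((phi \o shift (upd j x s)) (h *: basis_pt j) - phi (upd j x s))).
  apply/funext => h /=; congr (_ *: (phi _ - _)).
  rewrite !upd_basis addrA -scalerDl; congr (_ *: _ + _).
  by rewrite [h%:A]mulr1 addrA.
split.
- by rewrite /derivable E; exact: dphi.
- by rewrite /derive E.
Qed.

Lemma derive_supp (phi : R3 R -> R) (C : set (R3 R)) j : compact C ->
  (forall x, ~ C x -> phi x = 0) ->
  forall x, ~ C x -> 'D_(basis_pt j) phi x = 0.
Proof.
move=> cC phi0 x nCx.
have v0 : basis_pt j != 0 :> R3 R.
  apply/eqP => /(congr1 (crd j)); rewrite crd_basis eqxx => /eqP.
  by rewrite (_ : crd j 0 = 0) ?oner_eq0 //; elim/ord3P: (j).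
rewrite (near_eq_derive (g := cst 0)) ?derive_cst //.
have : open (~` C).
  by apply: closed_openC; apply: compact_closed => //; exact: norm_hausdorff.
by move=> oC; near do rewrite phi0 //; exact: open_nbhs_nbhs.
Unshelve. all: by end_near.
Qed.

(** The fundamental theorem of calculus on [[- (N + 1), N + 1]]; the extra 1 puts both endpoints
    outside the box, where [F] vanishes. *)
Lemma integral_slice_supp j (F f : R3 R -> R) (N : R) x : 0 <= N ->
  partial_of j F f -> (forall y, ~ box N y -> F y = 0 /\ f y = 0) ->
  (\int[lebesgue_measure]_s (f (upd j x s))%:E = 0)%E.
Proof.
move=> N0 [cF cf dF] F0.
have out s : N < `|s| -> ~ box N (upd j x s).
  move=> Ns; rewrite boxE => /(_ j); rewrite crd_upd eqxx in_itv /= -ler_norml.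
  by rewrite leNgt Ns.
have NN : - (N + 1) < N + 1 by lra.
rewrite (_ : (fun s => _) =
    (fun s => (f (upd j x s))%:E) \_ `[- (N + 1), N + 1]); last first.
  apply/funext => s; rewrite patchE; case: ifPn => // hs.
  suff Ns : N < `|s| by have [_ ->] := F0 _ (out s Ns).
  rewrite ltNge; apply/negP => sN; move/negP: hs; apply; rewrite inE /= in_itv /=.
  by rewrite -ler_norml; apply: le_trans sN _; rewrite lerDl.
rewrite -integral_mkcond (integral_is_derive NN (@continuous_slice j f x cf) (dF x)).
have N1 : N < `|N + 1| by rewrite ger0_norm; lra.
have N2 : N < `|- (N + 1)| by rewrite normrN.
have [-> _] := F0 _ (out _ N1); have [-> _] := F0 _ (out _ N2).
by rewrite subrr.
Qed.

Lemma partial_ofM j u g v w : partial_of j u g -> partial_of j v w ->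
  partial_of j (fun x => u x * v x) (fun x => u x * w x + g x * v x).
Proof.
move=> [cu cg du] [cv cw dv]; split.
- by move=> x; apply: cvgM; [exact: cu|exact: cv].
- move=> x; apply: cvgD; apply: cvgM.
  + exact: cu. + exact: cw. + exact: cg. + exact: cv.
- move=> x s; have h := is_deriveM (du x s) (dv x s).
  by apply: (is_derive_eq h); rewrite /GRing.scale /= [X in _ + X]mulrC.
Qed.

(** By the product rule the sum of the two integrands is the partial derivative of [u * phi]. It has
    compact support, so its integral over each line in direction [j] is 0. *)
Lemma weak_partial_of (Omega : set (R3 R)) j u g :
  partial_of j u g -> weak_partial Omega j u g.
Proof.
move=> ug phi tphi; have pphi := test_function_partial j tphi.
have [_ [C [cC CO phi0]]] := tphi.
have dphi0 := @derive_supp phi C j cC phi0.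
have [cphi cdphi _] := pphi; have [cu cg _] := ug.
have [N N0 CN] := compact_sub_box cC.
have i1 : (leb3 R).-integrable setT (EFin \o (fun x => u x * 'D_(basis_pt j) phi x)).
  apply: integrable_compact_supp cC _; last by move=> x /dphi0 ->; rewrite mulr0.
  by move=> x; apply: cvgM; [exact: cu|exact: cdphi].
have i2 : (leb3 R).-integrable setT (EFin \o (fun x => g x * phi x)).
  apply: integrable_compact_supp cC _; last by move=> x /phi0 ->; rewrite mulr0.
  by move=> x; apply: cvgM; [exact: cg|exact: cphi].
have E (f : R3 R -> R) : (forall x, ~ C x -> f x = 0) ->
    \int[leb3 R]_(x in Omega) f x = \int[leb3 R]_x f x.
  move=> f0; rewrite Rintegral_mkcond; apply: eq_Rintegral => x _.
  rewrite patchE; case: ifPn => //; rewrite notin_setE => nO.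
  by rewrite f0 // => /CO.
rewrite !E; [|by move=> x /phi0 ->; rewrite mulr0|by move=> x /dphi0 ->; rewrite mulr0].
apply/eqP; rewrite -addr_eq0 -RintegralD //.
have pM := partial_ofM ug pphi.
have out y : ~ box N y -> u y * phi y = 0 /\
    u y * 'D_(basis_pt j) phi y + g y * phi y = 0.
  move=> nB; have nC : ~ C y by move=> /CN.
  by rewrite phi0 // dphi0 // !mulr0 addr0.
have [_ cP _] := pM.
have [M PM] : exists M, forall x, `|u x * 'D_(basis_pt j) phi x + g x * phi x| <= M.
  apply: compact_supp_bounded cP cC _ => x nC.
  by rewrite phi0 // dphi0 // !mulr0 addr0.
have slice0 x : (`|\int[lebesgue_measure]_s (u (upd j x s) * 'D_(basis_pt j) phi (upd j x s)
    + g (upd j x s) * phi (upd j x s))%:E| <= 0%:E)%E.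
  by rewrite (integral_slice_supp x N0 pM out) abse0.
have := @slice_bound R j N 0 M _ N0 (lexx 0) (continuous_measurable3 cP) PM
  (fun y nB => (out y nB).2) slice0.
rewrite mul0r.
move=> h; rewrite /Rintegral [X in fine X](_ : _ = 0%E) //.
by apply/eqP; rewrite -abse_eq0 eq_le h abse_ge0.
Qed.

End Partials.

(** * Rules of calculus for [partial_of] *)

Section PartialCalculus.
Context {R : realType}.
Implicit Types (x : R3 R) (u g v w : R3 R -> R) (j : 'I_3).

Lemma partial_ofD j u g v w : partial_of j u g -> partial_of j v w ->
  partial_of j (fun x => u x + v x) (fun x => g x + w x).
Proof.
move=> [cu cg du] [cv cw dv]; split.
- by move=> x; apply: cvgD; [exact: cu|exact: cv].
- by move=> x; apply: cvgD; [exact: cg|exact: cw].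
- by move=> x s; exact: is_deriveD (du x s) (dv x s).
Qed.

Lemma partial_of_cst j (a : R) : partial_of j (fun=> a) (fun=> 0).
Proof.
split; try by move=> x; exact: cvg_cst.
by move=> x s; exact: is_derive_cst.
Qed.

Lemma partial_ofZ j a u g : partial_of j u g ->
  partial_of j (fun x => a * u x) (fun x => a * g x).
Proof.
move=> pu; have := partial_ofM (partial_of_cst j a) pu.
by rewrite (_ : (fun x => _ + _) = (fun x => a * g x)) //;
  apply/funext => x; rewrite mul0r addr0.
Qed.

Lemma partial_of_sum j (I : Type) (r : seq I) (u g : I -> R3 R -> R) :
  (forall i, partial_of j (u i) (g i)) ->
  partial_of j (fun x => \sum_(i <- r) u i x) (fun x => \sum_(i <- r) g i x).
Proof.
move=> ug; elim: r => [|i r IH].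
  rewrite (_ : (fun x => _) = fun=> 0); last by apply/funext => x; rewrite big_nil.
  rewrite (_ : (fun x => \sum_(i <- [::]) g i x) = fun=> 0); first exact: partial_of_cst.
  by apply/funext => x; rewrite big_nil.
have E (h : I -> R3 R -> R) : (fun x => \sum_(l <- i :: r) h l x) =
    (fun x => h i x + \sum_(l <- r) h l x).
  by apply/funext => x; rewrite big_cons.
by rewrite !E; exact: partial_ofD.
Qed.

Lemma partial_of_crd j i : partial_of j (crd i : R3 R -> R) (fun=> (i == j)%:R).
Proof.
split; [exact: continuous_crd|by move=> x; exact: cvg_cst|move=> x s].
case: (eqVneq i j) => [->|ij].
  rewrite (_ : (fun t => _) = id); first exact: is_derive_id.
  by apply/funext => t; rewrite crd_upd eqxx.
rewrite (_ : (fun t => _) = cst (crd i x)); first exact: is_derive_cst.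
by apply/funext => t; rewrite crd_upd (negbTE ij).
Qed.

Lemma continuous_dilate (m : R) : continuous (fun x => m *: x : R3 R).
Proof. exact: scaler_continuous. Qed.

Lemma dilate_upd m j x s : m *: upd j x s = upd j (m *: x) (m * s).
Proof. by elim/ord3P: j. Qed.

Lemma partial_of_comp j u g (f f' : R -> R) : continuous f' ->
  (forall s, is_derive s (1 : R) f (f' s)) -> partial_of j u g ->
  partial_of j (fun x => f (u x)) (fun x => g x * f' (u x)).
Proof.
move=> cf' df [cu cg du].
have cf : continuous f.
  by move=> s; apply: differentiable_continuous; apply/derivable1_diffP; have [] := df s.
split.
- by move=> x; apply: continuous_comp; [exact: cu|exact: cf].
- move=> x; apply: cvgM; first exact: cg.
  by apply: continuous_comp; [exact: cu|exact: cf'].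
- move=> x s; have h := is_derive1_comp (df (u (upd j x s))) (du x s).
  by apply: (is_derive_eq h); rewrite mulrC.
Qed.

Lemma partial_of_dilate j m u g : partial_of j u g ->
  partial_of j (fun x => u (m *: x)) (fun x => m * g (m *: x)).
Proof.
move=> [cu cg du]; split.
- by move=> x; apply: continuous_comp; [exact: continuous_dilate|exact: cu].
- move=> x; apply: cvgM; first exact: cvg_cst.
  by apply: continuous_comp; [exact: continuous_dilate|exact: cg].
- move=> x s.
  rewrite (_ : (fun t => _) = (fun t => u (upd j (m *: x) t)) \o (fun t => m * t)); last first.
    by apply/funext => t /=; rewrite dilate_upd.
  have dm : is_derive s (1 : R) (fun t => m * t) m.
    have h := is_deriveZ m (is_derive_id s (1 : R)).
    by apply: (is_derive_eq h); rewrite /GRing.scale /= mulr1.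
  have h := is_derive1_comp (du (m *: x) (m * s)) dm.
  by apply: (is_derive_eq h); rewrite dilate_upd mulrC.
Qed.

End PartialCalculus.

Lemma continuous_matrix (R : realType) (T : topologicalType) (G : T -> 'M[R]_3) :
  (forall i j, continuous (fun x => G x i j)) -> continuous G.
Proof.
move=> cG x; apply/cvg_ballP => e e0.
have h : \forall y \near x, forall i j, ball (G x i j) e (G y i j).
  apply: filter_forall => i; apply: filter_forall => j.
  by have /cvg_ballP := cG i j x; exact.
by apply: filterS h => y hy; split=> // i j; exact: hy.
Qed.

(** * Laminates and the quasiconvex hull *)

Section Attainable.
Context {R : realType}.
Implicit Types (L : set 'M[R]_3) (F : 'M[R]_3) (B : set (R3 R)).

(* The rescalings of [B] have measure at most [c N * delta] in the box of
   half-width [N], uniformly in the scale [k]. *)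
Definition sparse (c : nat -> R) (delta : R) B : Prop := closed B /\
  forall N k : nat, (0 < k)%N ->
    (leb3 R (box N%:R `&` [set x | B (k%:R *: x)]) <= (c N * delta)%:E)%E.

(** The map [x |-> F x + phi x] has gradient in [L] off [B]. The perturbation is only required to be
    bounded, which suffices because dilation makes it uniformly small. *)
Definition perturbation L F (M : R) (c : nat -> R) (delta : R)
    (phi : R3 R -> 'cV[R]_3) (G : R3 R -> 'M[R]_3) B : Prop :=
  [/\ forall i j, partial_of j (fun x => phi x i 0) (fun x => G x i j),
      forall x i, `|phi x i 0| <= M, forall x i j, `|G x i j| <= M,
      forall x, ~ B x -> L (F + G x) & sparse c delta B].

(* [M] and [c] do not depend on [delta], which makes the notion stable under
   further lamination and lets [delta] tend to 0 in [attainable_qc_hull]. *)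
Definition attainable L F : Prop := exists M c, forall delta, 0 < delta ->
  exists phi G B, perturbation L F M c delta phi G B.

Lemma bounded_sub_box (Omega : set (R3 R)) : bounded_set Omega ->
  exists N : nat, Omega `<=` box N%:R.
Proof.
move=> [K [_ hK]]; exists (Num.bound `|K + 1|) => x Ox.
rewrite boxE => i; rewrite in_itv /= -ler_norml.
apply: le_trans (norm_crd_le i x) _.
apply: le_trans (ltW (archi_boundP (normr_ge0 _))).
by apply: hK => //; rewrite (lt_le_trans _ (ler_norm _)) // ltrDl.
Qed.

(** One index governs two limits: [delta = 1 / m] makes the exceptional set small, and dilation by
    the same [m] makes the perturbation small while its gradient stays bounded. *)
Lemma attainable_qc_hull (Omega : set (R3 R)) L F :
  bounded_domain Omega -> attainable L F -> qc_hull Omega L F.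
Proof.
move=> [oO _ _ bO] [M [c hM]].
have [N ON] := bounded_sub_box bO.
have mO : measurable Omega by exact: open_measurable3.
pose m (k : nat) : R := k.+1%:R.
have m0 k : 0 < m k by rewrite ltr0n.
have /choice[q hq] : forall k, exists q : (R3 R -> 'cV[R]_3) * (R3 R -> 'M[R]_3) * set (R3 R),
    perturbation L F M c (m k)^-1 q.1.1 q.1.2 q.2.
  move=> k; have [|phi [G [B h]]] := hM (m k)^-1; first by rewrite invr_gt0.
  by exists (phi, G, B).
pose v k (i : 'I_3) x := (m k)^-1 * (q k).1.1 (m k *: x) i 0.
pose w k (i j : 'I_3) x := (q k).1.2 (m k *: x) i j.
have pw k i j : partial_of j (v k i) (w k i j).
  have [h _ _ _ _] := hq k; have := partial_ofZ (m k)^-1 (partial_of_dilate (m k) (h i j)).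
  congr partial_of; apply/funext => x; rewrite mulrA mulVf ?mul1r //.
  by rewrite gt_eqF.
have vM k i x : `|v k i x| <= M / m k.
  have [_ h _ _ _] := hq k; have mi0 : 0 <= (m k)^-1 by rewrite invr_ge0 ltW.
  by rewrite normrM ger0_norm // mulrC ler_wpM2r.
have wM k i j x : `|w k i j x| <= M by have [_ _ h _ _] := hq k; exact: h.
have M0 : 0 <= M by exact: le_trans (wM 0%N 0 0 (0, 0, 0)).
have vM' k i x : `|v k i x| <= M.
  apply: le_trans (vM k i x) _; rewrite ler_pdivrMr // ler_peMr //.
  by rewrite ler1n.
have cm : (fun k => M / m k) @ \oo --> (0 : R).
  rewrite -[X in _ --> X](mulr0 M); apply: cvgM; first exact: cvg_cst.
  exact: cvg_harmonic.
pose a (i : 'I_3) x := \sum_(l < 3) F i l * crd l x.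
have aE i x : (F *m vec x) i 0 = a i x.
  by rewrite mxE; apply: eq_bigr => l _; rewrite vecE.
have pa i j : partial_of j (a i) (fun=> F i j).
  have := @partial_of_sum R j _ (index_enum 'I_3) (fun l x => F i l * crd l x)
    (fun l _ => F i l * (l == j)%:R) (fun l => partial_ofZ (F i l) (partial_of_crd j l)).
  congr partial_of; apply/funext => x; rewrite (bigD1 j) //= eqxx mulr1.
  by rewrite big1 ?addr0 // => l /negbTE ->; rewrite mulr0.
pose z k x : 'cV[R]_3 := \col_i (a i x + v k i x).
pose Dz k x : 'M[R]_3 := \matrix_(i, j) (F i j + w k i j x).
pose K := \sum_i \sum_j `|F i j|.
have FK i j : `|F i j| <= K.
  rewrite /K (bigD1 i) //= (bigD1 j) //= -addrA lerDl addr_ge0 // sumr_ge0 // => *.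
  by rewrite sumr_ge0.
have aK i x : Omega x -> `|a i x| <= K * N%:R.
  move=> /ON; rewrite boxE => hx; rewrite /a.
  apply: le_trans (ler_norm_sum _ _ _) _.
  apply: (@le_trans _ _ ((\sum_l `|F i l|) * N%:R)).
    rewrite mulr_suml ler_sum // => l _; rewrite normrM ler_wpM2l // ler_norml.
    by move: (hx l); rewrite in_itv.
  rewrite ler_wpM2r // /K [leRHS](bigD1 i) //= lerDl sumr_ge0 // => l _.
  by rewrite sumr_ge0.
exists z, Dz; split.
- exists (K * N%:R + K + M) => k.
  have K0 : 0 <= K by exact: le_trans (FK 0 0).
  split.
  + move=> i; split.
      apply: measurable_funTS; apply: continuous_measurable3.
      rewrite (_ : (fun x => _) = (fun x => a i x + v k i x)); last first.
        by apply/funext => x; rewrite mxE.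
      by have [] := partial_ofD (pa i 0) (pw k i 0).
    apply: aeW => x Ox; rewrite mxE; apply: le_trans (ler_normD _ _) _.
    by rewrite lerD // (le_trans (aK i x Ox)) // lerDl.
  + move=> i j; split.
      apply: measurable_funTS; apply: continuous_measurable3.
      rewrite (_ : (fun x => _) = (fun x => F i j + w k i j x)); last first.
        by apply/funext => x; rewrite mxE.
      by have [] := partial_ofD (pa i j) (pw k i j).
    apply: aeW => x Ox; rewrite mxE; apply: le_trans (ler_normD _ _) _.
    by rewrite lerD // (le_trans (FK i j)) // lerDr mulr_ge0.
  + move=> i j; apply: weak_partial_of; have := partial_ofD (pa i j) (pw k i j).
    by congr partial_of; apply/funext => x; rewrite mxE.
(* Both weak-* limits have the same shape: a fixed bounded function plus terms that tend weakly-* to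
   0. *)
- have lim0 (f : R3 R -> R) (K' : R) (b : nat -> R3 R -> R) (h f' : R3 R -> R)
      (b' : nat -> R3 R -> R) :
      (forall x, f' x = f x) -> (forall k x, b' k x = f x + b k x) ->
      measurable_fun setT f -> (forall x, Omega x -> `|f x| <= K') ->
      (forall k, measurable_fun setT (b k)) -> (forall k x, `|b k x| <= M) ->
      (leb3 R).-integrable Omega (EFin \o h) ->
      (fun k => \int[leb3 R]_(x in Omega) (b k x * h x)) @ \oo --> (0 : R) ->
      (fun k => \int[leb3 R]_(x in Omega) (b' k x * h x)) @ \oo -->
        \int[leb3 R]_(x in Omega) (f' x * h x).
    move=> fE bE mf fK' mb bM ih h0.
    have -> : f' = f by apply/funext.
    rewrite (_ : (fun k => _) = (fun k => \int[leb3 R]_(x in Omega) (f x * h x) +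
        \int[leb3 R]_(x in Omega) (b k x * h x))).
      by rewrite -[X in _ --> X]addr0; apply: cvgD h0; exact: cvg_cst.
    apply/funext => k; rewrite -RintegralD //.
    + by apply: eq_Rintegral => x _; rewrite bE mulrDl.
    + by apply: (@integrable_bounded_mul _ _ _ (leb3 R) K') => //; exact: measurable_funTS.
    + by apply: (@integrable_bounded_mul _ _ _ (leb3 R) M) => //; exact: (measurable_funTS (mb k)).
  have mv k i : measurable_fun setT (v k i).
    by apply: continuous_measurable3; have [] := pw k i 0.
  have mw k i j : measurable_fun setT (w k i j).
    by apply: continuous_measurable3; have [] := pw k i j.
  split=> [i h ih|i j h ih].
  + have ma : measurable_fun setT (a i).
      by apply: continuous_measurable3; have [] := pa i 0.
    apply: (lim0 (a i) (K * N%:R) (fun k => v k i)) => //.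
    * by move=> k x; rewrite mxE.
    * exact: aK.
    (* For the maps themselves the convergence is uniform, of order [M / m k]; only the gradients
       need the oscillation argument. *)
    * have ihn : (leb3 R).-integrable Omega (EFin \o (fun x => `|h x|)) by exact: integrable_norm.
      apply/norm_cvg0P/(@squeeze_cvgr _ _ _ _ (fun=> 0)
        (fun k => (M / m k) * \int[leb3 R]_(x in Omega) `|h x|)).
      - apply: nearW => k; rewrite normr_ge0 /=.
        have iv : (leb3 R).-integrable Omega (EFin \o (fun x => v k i x * h x)).
          by apply: (@integrable_bounded_mul _ _ _ (leb3 R) M) => //; exact: (measurable_funTS (mv k i)).
        apply: le_trans (le_normr_Rintegral _ iv) _ => //.
        rewrite -RintegralZl //; apply: le_Rintegral => //.
        -- exact: integrable_norm.
        -- by apply: (@integrable_bounded_mul _ _ _ (leb3 R) `|M / m k| Omega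
             (fun=> M / m k) (fun x => `|h x|)).
        -- by move=> x _; rewrite normrM ler_wpM2r.
      - exact: cvg_cst.
      - rewrite -[X in _ --> X](mul0r (\int[leb3 R]_(x in Omega) `|h x|)).
        by apply: cvgM cm _; exact: cvg_cst.
  + apply: (lim0 (fun=> F i j) K (fun k => w k i j)) => //.
    * by move=> k x; rewrite mxE.
    * exact (@weak_star_partial R j (fun k => v k i) (fun k => w k i j) M N%:R _ Omega h
      (fun k => pw k i j) (fun k => wM k i j) (fun k => vM k i) cm mO ON ih).
- move=> O oO' LO.
  have cDz k : continuous (Dz k).
    apply: continuous_matrix => i j.
    rewrite (_ : (fun x => _) = (fun x => F i j + w k i j x)); last first.
      by apply/funext => x; rewrite mxE.
    by have [] := partial_ofD (pa i j) (pw k i j).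
  have bound k : (leb3 R (Omega `&` [set x | ~ O (Dz k x)]) <= (c N / m k)%:E)%E.
    have [_ _ _ hL [cB hB]] := hq k.
    apply: le_trans (hB N k.+1 isT).
    apply: le_measure.
    + rewrite inE; apply: measurableI => //; apply: closed_measurable3.
      apply: (closed_comp (f := Dz k) (D := ~` O)); first by move=> x _; exact: cDz.
      exact: open_closedC.
    + rewrite inE; apply: measurableI; first exact: measurable_box.
      apply: closed_measurable3; apply: (closed_comp (D := (q k).2)) => //.
      by move=> x _; exact: continuous_dilate.
    + move=> x [Ox nO]; split; first exact: ON.
      rewrite /=; apply: contra_notP nO => nB; apply: LO.
      rewrite (_ : Dz k x = F + (q k).1.2 (m k *: x)); first exact: hL.
      by apply/matrixP => i j; rewrite !mxE.
  apply: (@squeeze_cvge _ _ _ _ (fun=> 0%E) _ (fun k => (c N / m k)%:E)).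
  + by apply: nearW => k; rewrite measure_ge0 bound.
  + exact: cvg_cst.
  + apply: cvg_EFin; first by apply: nearW.
    rewrite -[X in _ --> X](mulr0 (c N)); apply: cvgM; first exact: cvg_cst.
    exact: cvg_harmonic.
Qed.

End Attainable.

(** * Piecewise quadratic C^1 profiles on the line *)

Section Profiles.
Context {R : realType}.
Implicit Types (r s t d : R).

Lemma is_derive_mul_norm r : is_derive r (1 : R) (fun x : R => x * `|x|) (2 * `|r|).
Proof.
(* For [r] different from 0, [e] is the sign of [r], and near [r] the function equals [e * x ^+ 2].
   At 0 the difference quotient is [|h|]. *)
have sq (e : R) : (e == 1) || (e == -1) -> 0 < e * r ->
    is_derive r (1 : R) (fun x : R => x * `|x|) (2 * `|r|).
  move=> e1 er; have ee : e * e = 1 by case/orP: e1 => /eqP ->; ring.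
  have nE x : 0 < e * x -> `|x| = e * x.
    move=> ex; rewrite -[in RHS](gtr0_norm ex) normrM.
    suff -> : `|e| = 1 by rewrite mul1r.
    by case/orP: e1 => /eqP ->; rewrite ?normrN normr1.
  have h : is_derive r (1 : R) (e \*: ((@id R) * (@id R))) (2 * `|r|).
    have h0 := is_deriveZ e (is_deriveM (is_derive_id r (1 : R)) (is_derive_id r (1 : R))).
    by apply: (is_derive_eq h0); rewrite (nE r er) /GRing.scale /=; ring.
  apply: near_eq_is_derive h.
  have cont : (fun x : R => e * x) x @[x --> r] --> e * r.
    by apply: cvgM; [exact: cvg_cst|exact: cvg_id].
  have h2 := cvgr_gt (e * r) cont 0 er; near=> x.
  have ex : 0 < e * x by near: x; exact: h2.
  by rewrite (nE x ex); change (e * (x * x) = x * (e * x)); ring.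
case: (ltgtP r 0) => [r0|r0|->].
- by apply: (sq (-1)); rewrite ?eqxx ?orbT // mulN1r oppr_gt0.
- by apply: (sq 1); rewrite ?eqxx // mul1r.
have lim : (fun h : R => h^-1 *: (((fun x : R => x * `|x|) \o shift 0) (h *: (1 : R))
    - 0 * `|0 : R|)) @ 0^' --> (0 : R).
  have c0 : (fun h : R => `|h|) @ 0^' --> (0 : R).
    have c0 : (fun h : R => `|h|) @ (0 : R) --> (0 : R).
      by rewrite -[X in _ --> X](normr0 R); apply: cvg_norm; exact: cvg_id.
    exact: cvg_within_filter c0.
  apply: cvg_trans c0; apply: near_eq_cvg; near=> h.
  have h0 : h != 0 by near: h; exact: nbhs_dnbhs_neq.
  by rewrite /= addr0 /GRing.scale /= mulr1 mul0r subr0 mulrA mulVf // mul1r.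
split; first by apply/cvg_ex; exists 0.
by rewrite /derive (cvg_lim _ lim) // normr0 mulr0.
Unshelve. all: by end_near.
Qed.

(* A C^1 piecewise quadratic transition from 0 to 1 over [0, 1]; writing it with
   absolute values avoids case distinctions in the derivatives. *)
Definition step r : R :=
  2^-1 + (r * `|r| - 2 * ((r - 2^-1) * `|r - 2^-1|) + (r - 1) * `|r - 1|).
Definition dstep r : R := 2 * `|r| - 4 * `|r - 2^-1| + 2 * `|r - 1|.
(** The primitive of [step]; the constant [- 4^-1] makes it vanish on the negative half-line. *)
Definition istep r : R :=
  r / 2 - 4^-1 + 3^-1 * (r * (r * `|r|) - 2 * ((r - 2^-1) * ((r - 2^-1) * `|r - 2^-1|))
    + (r - 1) * ((r - 1) * `|r - 1|)).

Lemma is_derive_affine (f f' : R -> R) a b r : is_derive (a * r + b) (1 : R) f (f' (a * r + b)) ->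
  is_derive r (1 : R) (fun x => f (a * x + b)) (a * f' (a * r + b)).
Proof.
move=> df; have da : is_derive r (1 : R) (fun x : R => a * x + b) a.
  have h := is_deriveD (is_deriveZ a (is_derive_id r (1 : R))) (is_derive_cst b r (1 : R)).
  by apply: (is_derive_eq h); rewrite /GRing.scale /= mulr1 addr0.
have h := @is_derive1_comp R f (fun x => a * x + b) r _ _ df da.
by apply: (is_derive_eq h); rewrite mulrC.
Qed.

Lemma is_derive_shift (f f' : R -> R) b r : (forall s, is_derive s (1 : R) f (f' s)) ->
  is_derive r (1 : R) (fun x => f (x - b)) (f' (r - b)).
Proof.
move=> df; have h := @is_derive_affine f f' 1 (- b) r (df _).
rewrite (_ : (fun x => f (x - b)) = (fun x => f (1 * x - b))).
  by apply: (is_derive_eq h); rewrite !mul1r.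
by apply/funext => x; rewrite mul1r.
Qed.

Lemma is_derive_step r : is_derive r (1 : R) step (dstep r).
Proof.
have d0 := is_derive_mul_norm r.
have d1 := @is_derive_shift _ (fun r => 2 * `|r|) 2^-1 r is_derive_mul_norm.
have d2 := @is_derive_shift _ (fun r => 2 * `|r|) 1 r is_derive_mul_norm.
have h := is_deriveD (is_derive_cst (2^-1 : R) r (1 : R))
  (is_deriveD (is_deriveB d0 (is_deriveZ 2 d1)) d2).
by apply: (is_derive_eq h); rewrite /dstep /GRing.scale /=; ring.
Qed.

Lemma is_derive_istep r : is_derive r (1 : R) istep (step r).
Proof.
have d3 s : is_derive s (1 : R) (fun x : R => x * (x * `|x|)) (3 * (s * `|s|)).
  have h := is_deriveM (is_derive_id s (1 : R)) (is_derive_mul_norm s).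
  by apply: (is_derive_eq h); rewrite /GRing.scale /=; ring.
have d0 := d3 r.
have d1 := @is_derive_shift _ (fun s => 3 * (s * `|s|)) 2^-1 r d3.
have d2 := @is_derive_shift _ (fun s => 3 * (s * `|s|)) 1 r d3.
have h := is_deriveD (@is_derive_affine id (fun=> 1) 2^-1 (- 4^-1) r (is_derive_id _ (1 : R)))
  (is_deriveZ 3^-1 (is_deriveD (is_deriveB d0 (is_deriveZ 2 d1)) d2)).
rewrite (_ : istep = (fun x : R => id (2^-1 * x - 4^-1)) + (3^-1 \*:
   ((fun x : R => x * (x * `|x|)) - (2 \*: (fun x : R => (x - 2^-1) * ((x - 2^-1) * `|x - 2^-1|)))
   + (fun x : R => (x - 1) * ((x - 1) * `|x - 1|))))).
  by apply: (is_derive_eq h); rewrite /step /GRing.scale /=; field.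
by apply/funext => x; rewrite /istep [x / 2]mulrC.
Qed.

Lemma normr_cases r : (0 <= r /\ `|r| = r) \/ (r <= 0 /\ `|r| = - r).
Proof.
by case: (lerP 0 r) => r0; [left; rewrite ger0_norm|right; rewrite ltr0_norm // ltW].
Qed.

Lemma step_le0 r : r <= 0 -> [/\ step r = 0, dstep r = 0 & istep r = 0].
Proof.
move=> r0; rewrite /step /dstep /istep.
rewrite (ler0_norm r0) (@ler0_norm _ (r - 2^-1)); last by lra.
by rewrite (@ler0_norm _ (r - 1)); [split; field|lra].
Qed.

Lemma step_ge1 r : 1 <= r -> [/\ step r = 1, dstep r = 0 & istep r = r - 2^-1].
Proof.
move=> r1; rewrite /step /dstep /istep.
rewrite (@ger0_norm _ r); last by lra.
rewrite (@ger0_norm _ (r - 2^-1)); last by lra.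
by rewrite (@ger0_norm _ (r - 1)); [split; field|lra].
Qed.

Lemma step_itv r : 0 <= step r <= 1.
Proof.
case: (lerP r 0) => [/step_le0[-> _ _]|r0]; first by rewrite lexx ler01.
case: (lerP 1 r) => [/step_ge1[-> _ _]|r1]; first by rewrite lexx ler01.
rewrite /step (gtr0_norm r0) (@ler0_norm _ (r - 1)); last by lra.
by case: (normr_cases (r - 2^-1)) => -[h ->]; apply/andP; split; nra.
Qed.

Lemma dstep_bound r : `|dstep r| <= 2.
Proof.
case: (lerP r 0) => [/step_le0[_ -> _]|r0]; first by rewrite normr0.
case: (lerP 1 r) => [/step_ge1[_ -> _]|r1]; first by rewrite normr0.
rewrite /dstep (gtr0_norm r0) (@ler0_norm _ (r - 1)); last by lra.
by case: (normr_cases (r - 2^-1)) => -[h ->]; rewrite ler_norml; apply/andP; split; lra.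
Qed.

Lemma istep_bound r : 0 <= istep r <= `|r|.
Proof.
case: (lerP r 0) => [/step_le0[_ _ ->]|r0]; first by rewrite lexx normr_ge0.
rewrite (gtr0_norm r0).
case: (lerP 1 r) => [r1|r1]; first by have [_ _ ->] := step_ge1 r1; apply/andP; split; lra.
rewrite /istep (gtr0_norm r0) (@ler0_norm _ (r - 1)); last by lra.
case: (normr_cases (r - 2^-1)) => -[h ->].
  have -> : r / 2 - 4^-1 + 3^-1 * (r * (r * r) - 2 * ((r - 2^-1) * ((r - 2^-1) * (r - 2^-1)))
     + (r - 1) * ((r - 1) * - (r - 1))) = r - 2^-1 + 2 / 3 * ((1 - r) * (1 - r) * (1 - r)) by field.
  have h1 : 0 <= (1 - r) * (1 - r) * (1 - r) by rewrite !mulr_ge0 // subr_ge0 ltW.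
  have h2 : (1 - r) * (1 - r) * (1 - r) <= 2^-1 * 2^-1 * 2^-1.
    by rewrite !ler_pM ?mulr_ge0 ?subr_ge0 //; lra.
  by apply/andP; split; lra.
have -> : r / 2 - 4^-1 + 3^-1 * (r * (r * r) - 2 * ((r - 2^-1) * ((r - 2^-1) * - (r - 2^-1)))
     + (r - 1) * ((r - 1) * - (r - 1))) = 2 / 3 * (r * r * r) by field.
have h1 : 0 <= r * r * r by rewrite !mulr_ge0 // ltW.
have h2 : r * r * r <= 1 * 1 * r by rewrite !ler_pM ?mulr_ge0 //; lra.
by apply/andP; split; lra.
Qed.

Lemma continuous_dstep : continuous dstep.
Proof.
have cn (b : R) : continuous (fun r : R => `|r - b|).
  move=> r; apply: cvg_norm.
  by apply: cvgB; [exact: cvg_id|exact: cvg_cst].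
move=> r; apply: cvgD; first apply: cvgB.
- by apply: cvgM; [exact: cvg_cst|exact: (@norm_continuous R R)].
- by apply: cvgM; [exact: cvg_cst|exact: cn].
- by apply: cvgM; [exact: cvg_cst|exact: cn].
Qed.

(* Equal to 1 on [2d, 1 - 2d] and to 0 outside [d, 1 - d], with derivative
   [dbump] and primitive [ibump]. *)
Definition bump d s : R := step (d^-1 * s - 1) - step (d^-1 * s - (d^-1 - 2)).
Definition dbump d s : R :=
  d^-1 * dstep (d^-1 * s - 1) - d^-1 * dstep (d^-1 * s - (d^-1 - 2)).
Definition ibump d s : R :=
  d * istep (d^-1 * s - 1) - d * istep (d^-1 * s - (d^-1 - 2)).

Lemma is_derive_bump d s : is_derive s (1 : R) (bump d) (dbump d s).
Proof. exact: is_deriveB (is_derive_affine (is_derive_step _)) (is_derive_affine (is_derive_step _)). Qed.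

Lemma is_derive_ibump d s : 0 < d -> is_derive s (1 : R) (ibump d) (bump d s).
Proof.
move=> d0; have h := is_deriveB
  (is_deriveZ d (@is_derive_affine istep step d^-1 (- 1) s (is_derive_istep _)))
  (is_deriveZ d (@is_derive_affine istep step d^-1 (- (d^-1 - 2)) s (is_derive_istep _))).
apply: (is_derive_eq h); rewrite /bump /GRing.scale /= !mulrA divff ?gt_eqF //.
by rewrite !mul1r.
Qed.

Lemma bump_out d s : 0 < d -> d < 4^-1 -> s <= d \/ 1 - d <= s -> bump d s = 0 /\ dbump d s = 0.
Proof.
move=> d0 d4 sd; rewrite /bump /dbump.
have di : d^-1 * d = 1 by rewrite mulVf // gt_eqF.
have id0 : 0 < d^-1 by rewrite invr_gt0.
case: sd => sd.
  have h1 : d^-1 * s - 1 <= 0 by nra.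
  have h2 : d^-1 * s - (d^-1 - 2) <= 0 by nra.
  have [-> -> _] := step_le0 h1; have [-> -> _] := step_le0 h2.
  by rewrite !mulr0 !subr0.
have h1 : 1 <= d^-1 * s - 1 by nra.
have h2 : 1 <= d^-1 * s - (d^-1 - 2) by nra.
have [-> -> _] := step_ge1 h1; have [-> -> _] := step_ge1 h2.
by rewrite !mulr0 !subrr.
Qed.

Lemma bump_in d s : 0 < d -> d < 4^-1 -> 2 * d <= s -> s <= 1 - 2 * d ->
  bump d s = 1 /\ dbump d s = 0.
Proof.
move=> d0 d4 s1 s2; rewrite /bump /dbump.
have di : d^-1 * d = 1 by rewrite mulVf // gt_eqF.
have id0 : 0 < d^-1 by rewrite invr_gt0.
have h1 : 1 <= d^-1 * s - 1 by nra.
have h2 : d^-1 * s - (d^-1 - 2) <= 0 by nra.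
have [-> -> _] := step_ge1 h1; have [-> -> _] := step_le0 h2.
by rewrite !mulr0 !subr0.
Qed.

Lemma ibump_le d s : 0 < d -> d < 4^-1 -> s <= d -> ibump d s = 0.
Proof.
move=> d0 d4 sd; rewrite /ibump.
have di : d^-1 * d = 1 by rewrite mulVf // gt_eqF.
have id0 : 0 < d^-1 by rewrite invr_gt0.
have h1 : d^-1 * s - 1 <= 0 by nra.
have h2 : d^-1 * s - (d^-1 - 2) <= 0 by nra.
have [_ _ ->] := step_le0 h1; have [_ _ ->] := step_le0 h2.
by rewrite !mulr0 !subr0.
Qed.

(** The integral of the bump depends on [d] alone. This lets the contributions of two bumps,
    rescaled to phases of different lengths, cancel over a period in [profile_exists]. *)
Lemma ibump_ge d s : 0 < d -> d < 4^-1 -> 1 - d <= s -> ibump d s = 1 - 3 * d.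
Proof.
move=> d0 d4 sd; rewrite /ibump.
have di : d^-1 * d = 1 by rewrite mulVf // gt_eqF.
have id0 : 0 < d^-1 by rewrite invr_gt0.
have h1 : 1 <= d^-1 * s - 1 by nra.
have h2 : 1 <= d^-1 * s - (d^-1 - 2) by nra.
have [_ _ ->] := step_ge1 h1; have [_ _ ->] := step_ge1 h2.
by field; rewrite gt_eqF.
Qed.

Lemma bump_bound d s : `|bump d s| <= 1.
Proof.
have /andP[h1 h2] := step_itv (d^-1 * s - 1).
have /andP[h3 h4] := step_itv (d^-1 * s - (d^-1 - 2)).
by rewrite ler_norml /bump; apply/andP; split; lra.
Qed.

Lemma dbump_bound d s : 0 < d -> `|dbump d s| <= 4 / d.
Proof.
move=> d0; rewrite /dbump -mulrBr normrM [`|d^-1|]gtr0_norm ?invr_gt0 // [leLHS]mulrC.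
rewrite ler_wpM2r ?invr_ge0 ?(ltW d0) //.
apply: le_trans (ler_normB _ _) _.
by have h1 := dstep_bound (d^-1 * s - 1); have h2 := dstep_bound (d^-1 * s - (d^-1 - 2)); lra.
Qed.

Lemma ibump_bound d s : 0 < d -> d < 4^-1 -> `|ibump d s| <= 2.
Proof.
move=> d0 d4; case: (lerP s d) => [sd|sd]; first by rewrite ibump_le // normr0.
case: (lerP (1 - d) s) => [sd1|sd1].
  by rewrite ibump_ge // ler_norml; apply/andP; split; lra.
rewrite /ibump -mulrBr normrM gtr0_norm //.
have di : d^-1 * d = 1 by rewrite mulVf // gt_eqF.
have h s' : d * `|d^-1 * s - s'| = `|s - d * s'|.
  rewrite -{1}(gtr0_norm d0) -normrM; congr `|_|.
  by rewrite mulrBr mulrA [d * d^-1]mulrC di mul1r.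
apply: (@le_trans _ _ (d * (`|d^-1 * s - 1| + `|d^-1 * s - (d^-1 - 2)|))).
  rewrite ler_wpM2l ?(ltW d0) // (le_trans (ler_normB _ _)) // lerD //.
    by have /andP[h1 h2] := istep_bound (d^-1 * s - 1); rewrite ger0_norm.
  by have /andP[h1 h2] := istep_bound (d^-1 * s - (d^-1 - 2)); rewrite ger0_norm.
rewrite mulrDr !h mulrBr divff ?gt_eqF //.
have h1 : `|s - d * 1| <= 1 by rewrite ler_norml; apply/andP; split; lra.
have h2 : `|s - (1 - d * 2)| <= 1 by rewrite ler_norml; apply/andP; split; lra.
lra.
Qed.

Lemma continuous_dbump d : continuous (dbump d).
Proof.
have ca a b : continuous (fun s : R => a * s - b).
  move=> s; apply: cvgB; last exact: cvg_cst.
  by apply: cvgM; [exact: cvg_cst|exact: cvg_id].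
have cd a b : continuous (fun s => dstep (a * s - b)).
  move=> s; apply: (@continuous_comp _ _ _ (fun s => a * s - b) dstep).
    exact: ca.
  exact: continuous_dstep.
by move=> s; apply: cvgB; apply: cvgM; try exact: cvg_cst; exact: cd.
Qed.

Definition periodize (f : R -> R) s : R := f (s - (Num.floor s)%:~R).

(** A point [y] near [s] has integer part [m] or lies in []m - e, m[]. In the latter case both sides
    vanish, since [f] is 0 below [e] and above [1 - e]. Hence a single translate of [f] describes
    the extension near [s], integers included. *)
Lemma periodize_near (f : R -> R) e s : 0 < e -> e < 1 ->
  (forall r, r <= e \/ 1 - e <= r -> f r = 0) ->
  \forall y \near s, periodize f y = f (y - (Num.floor (s + e / 2))%:~R).
Proof.
move=> e0 e1 f0; set m := Num.floor _.
have /andP[m1 m2] : m%:~R <= s + e / 2 < (m + 1)%:~R by rewrite floor_le_tmp floorD1_gt.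
have e20 : 0 < e / 2 by rewrite divr_gt0.
near=> y.
have : `|s - y| < e / 2 by near: y; apply: (@cvgr_dist_lt _ _ _ _ _ id) => //; exact: cvg_id.
rewrite ltr_norml intrD1 in m2 * => /andP[y1 y2].
rewrite /periodize; case: (lerP m%:~R y) => my.
  rewrite (_ : Num.floor y = m) //; apply/floor_def; rewrite my intrD1 /=; lra.
have -> : Num.floor y = m - 1.
  by apply/floor_def; rewrite subrK my andbT intrD /=; lra.
rewrite intrD /= !f0 //; [left|right]; lra.
Unshelve. all: by end_near.
Qed.

Lemma periodize_continuous (f : R -> R) e : 0 < e -> e < 1 ->
  (forall r, r <= e \/ 1 - e <= r -> f r = 0) -> continuous f ->
  continuous (periodize f).
Proof.
move=> e0 e1 f0 cf s.
have h := periodize_near s e0 e1 f0; set m : R := _%:~R in h.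
have hs : periodize f s = f (s - m) by exact: nbhs_singleton h.
have c : (fun y => f (y - m)) y @[y --> s] --> f (s - m).
  apply: (@continuous_comp _ _ _ (fun y : R => y - m) f); last exact: cf.
  by apply: cvgB; [exact: cvg_id|exact: cvg_cst].
rewrite /continuous_at hs; apply: cvg_trans c; apply: near_eq_cvg.
by apply: filterS h => y ->.
Qed.

Lemma periodize_is_derive (f f' : R -> R) e s : 0 < e -> e < 1 ->
  (forall r, r <= e \/ 1 - e <= r -> f r = 0 /\ f' r = 0) ->
  (forall r, is_derive r (1 : R) f (f' r)) ->
  is_derive s (1 : R) (periodize f) (periodize f' s).
Proof.
move=> e0 e1 f0 df.
have h := periodize_near s e0 e1 (fun r hr => (f0 r hr).1).
have h' := periodize_near s e0 e1 (fun r hr => (f0 r hr).2).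
rewrite (nbhs_singleton h'); set m : R := _%:~R in h *.
apply: (near_eq_is_derive _ (is_derive_shift m s df)).
by apply: filterS h => y ->.
Qed.

End Profiles.

(** * The periodic two-phase profile and its interface *)

Section TwoPhase.
Context {R : realType}.
Implicit Types (s t d : R).

(** The two phases are the images of the plateau []2 * d, 1 - 2 * d[] of [bump d] under the affine
    maps of the unit interval onto [[0, t]] and [[t, 1]]. *)
Definition phaseA t d : set R := `]2 * d * t, t - 2 * d * t[%classic.
Definition phaseB t d : set R := `]t + 2 * d * (1 - t), 1 - 2 * d * (1 - t)[%classic.

Definition interface t d : set R :=
  [set s | forall m : int, ~ phaseA t d (s - m%:~R) /\ ~ phaseB t d (s - m%:~R)].

Lemma closed_interface t d : closed (interface t d).
Proof.
rewrite (_ : interface t d = \bigcap_(m in setT)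
    ((fun s => s - m%:~R) @^-1` (~` (phaseA t d `|` phaseB t d)))).
  apply: closed_bigI => m _; apply: closed_comp.
    by move=> s _; apply: cvgB; [exact: cvg_id|exact: cvg_cst].
  by apply: open_closedC; apply: openU; exact: interval_open.
apply/seteqP; split=> s h m.
  by move=> _ /= -[]; [exact: (h m).1|exact: (h m).2].
by split=> hm; apply: (h m I); [left|right].
Qed.

Definition interface_slice t d (N k : nat) (c : R) : set R :=
  `[- N%:R, N%:R]%classic `&` [set s | interface t d (k%:R * s + c)].

(** Modulo 1 the interface consists of an interval around 0 and one around [t], each of length
    [2 * d], or [l = 2 * d / k] in the variable [s]. At most [2 * N * k + 2] translates of this pair
    are met, of total length at most [8 * N * d + 8 * d / k]. *)
Lemma interface_measure t d (N k : nat) (c : R) : 0 < t < 1 -> 0 < d -> (0 < k)%N ->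
  (lebesgue_measure (interface_slice t d N k c) <= ((8 * N%:R + 8) * d)%:E)%E.
Proof.
move=> /andP[t0 t1] d0 k0; have kR : 0 < k%:R :> R by rewrite ltr0n.
have k1 : 1 <= k%:R :> R by rewrite ler1n.
pose m0 := Num.floor (c - k%:R * N%:R).
pose p1 (i : nat) : R := (m0%:~R + i%:R - c - 2 * d * (1 - t)) / k%:R.
pose p2 (i : nat) : R := (m0%:~R + i%:R - c + t - 2 * d * t) / k%:R.
pose l : R := 2 * d / k%:R.
have l0 : 0 < l by rewrite divr_gt0 // mulr_gt0.
pose A i : set R := `[p1 i, p1 i + l]%classic `|` `[p2 i, p2 i + l]%classic.
have mA i : measurable (A i) by apply: measurableU; exact: measurable_itv.
have leA i : (lebesgue_measure (A i) <= (2 * l)%:E)%E.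
  have ll p : lebesgue_measure (`[p, p + l]%classic : set R) = l%:E.
    by rewrite lebesgue_measure_itv /= lte_fin ltrDl l0 -EFinD; congr EFin; ring.
  apply: le_trans (measureU2 _ _ _) _; [exact: measurable_itv|exact: measurable_itv|].
  apply: (@le_trans _ _ (l%:E + l%:E)%E); last by rewrite -EFinD lee_fin; lra.
  by apply: leeD; rewrite le_eqVlt; apply/orP; left; apply/eqP; exact: ll.
set X := (X in lebesgue_measure X).
have mX : measurable X.
  apply: measurableI; first exact: measurable_itv.
  apply: closed_measurable; apply: (closed_comp (D := interface t d)); last exact: closed_interface.
  move=> s _; apply: cvgD; last exact: cvg_cst.
  by apply: cvgM; [exact: cvg_cst|exact: cvg_id].
have XA : X `<=` \big[setU/set0]_(i < (2 * N * k + 2)%N) A i.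
  move=> s [/= ]; rewrite in_itv /= => /andP[s1 s2] hs.
  rewrite -bigcup_mkord; set y := k%:R * s + c in hs.
  have /andP[f1 f2] : (Num.floor y)%:~R <= y < (Num.floor y + 1)%:~R by rewrite floor_le floorD1_gt.
  have /andP[g1 g2] : m0%:~R <= c - k%:R * N%:R < (m0 + 1)%:~R by rewrite floor_le floorD1_gt.
  rewrite !intrD1 in f2 g2.
  have ks1 : - (k%:R * N%:R) <= k%:R * s by rewrite -mulrN ler_pM2l.
  have ks2 : k%:R * s <= k%:R * N%:R by rewrite ler_pM2l.
  have mm : m0 <= Num.floor y by apply: le_floor; rewrite /y; lra.
  have [i iE] : exists i : nat, Num.floor y = m0 + i%:Z.
    by exists `|Num.floor y - m0|%N; rewrite gez0_abs ?subr_ge0 // addrCA subrr addr0.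
  have iR : (Num.floor y)%:~R = m0%:~R + i%:R :> R by rewrite iE intrD.
  have iN : (i <= 2 * N * k)%N.
    rewrite -ltnS -(ltr_nat R) -natr1 !natrM; rewrite iR /y in f1.
    lra.
  have [hA hB] := hs (Num.floor y).
  rewrite /phaseA /phaseB /= !in_itv /= iR in hA hB.
  have yl (p a : R) : p = (m0%:~R + i%:R + a - c) / k%:R ->
     m0%:~R + i%:R + a <= y -> y <= m0%:~R + i%:R + a + 2 * d -> p <= s <= p + l.
    move=> -> h1 h2; rewrite /l -mulrDl ler_pdivrMr // ler_pdivlMr // ![s * _]mulrC.
    by rewrite /y in h1 h2; apply/andP; split; lra.
  case: (lerP y (m0%:~R + i%:R + 2 * d * t)) => h1.
    exists i; first by rewrite /=; apply: leq_ltn_trans iN _; rewrite addn2.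
    left; rewrite /= in_itv /=; apply: (yl _ (- (2 * d * (1 - t)))).
    - by rewrite /p1; congr (_ / _); ring.
    - by have := mulr_gt0 (mulr_gt0 (ltr0Sn R 1) d0) (_ : 0 < 1 - t); rewrite subr_gt0 => /(_ t1); lra.
    - lra.
  case: (lerP (m0%:~R + i%:R + t - 2 * d * t) y) => h2; last first.
    by exfalso; apply: hA; apply/andP; split; lra.
  case: (lerP y (m0%:~R + i%:R + t + 2 * d * (1 - t))) => h3.
    exists i; first by rewrite /=; apply: leq_ltn_trans iN _; rewrite addn2.
    right; rewrite /= in_itv /=; apply: (yl _ (t - 2 * d * t)).
    - by rewrite /p2; congr (_ / _); ring.
    - lra.
    - lra.
  case: (lerP (m0%:~R + i%:R + 1 - 2 * d * (1 - t)) y) => h4; last first.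
    by exfalso; apply: hB; apply/andP; split; lra.
  (* The end of period [i] belongs to the interval around the next integer, so one index beyond the
     last period is required. *)
  exists i.+1; first by rewrite /= addn2 ltnS ltnS.
  left; rewrite /= in_itv /=; apply: (yl _ (1 - 2 * d * (1 - t))).
  - by rewrite /p1 -natr1; congr (_ / _); ring.
  - lra.
  - by have := mulr_gt0 (mulr_gt0 (ltr0Sn R 1) d0) t0; lra.
have hX : (lebesgue_measure X <= \sum_(i < (2 * N * k + 2)%N) lebesgue_measure (A i))%E.
  by apply: content_subadditive => // i _; exact: mA.
apply: le_trans hX _.
apply: (@le_trans _ _ (\sum_(i < (2 * N * k + 2)%N) (2 * l)%:E)%E).
  by apply: lee_sum => i _.
rewrite sumEFin lee_fin sumr_const card_ord -[leLHS]mulr_natr natrD !natrM.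
rewrite (_ : 2 * l * (2%:R * N%:R * k%:R + 2%:R) = 8 * N%:R * d * (k%:R / k%:R) + 8 * d / k%:R).
  have -> : k%:R / k%:R = 1 :> R by rewrite divff // gt_eqF.
  have hk : 8 * d / k%:R <= 8 * d by rewrite ler_pdivrMr // ler_peMr // mulr_ge0 // ltW.
  by rewrite mulr1; lra.
by rewrite /l; field; rewrite gt_eqF.
Qed.

(* [saw] drives the oscillation between the two phases of the laminate, while
   [cutA] and [cutB] switch on the maps built for each phase. *)
Record profile t d := Profile {
  saw : R -> R; cutA : R -> R; cutB : R -> R; dcutA : R -> R; dcutB : R -> R;
  cut_rate : R;
  is_derive_saw : forall s, is_derive s (1 : R) saw ((1 - t) * cutA s - t * cutB s);
  is_derive_cutA : forall s, is_derive s (1 : R) cutA (dcutA s);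
  is_derive_cutB : forall s, is_derive s (1 : R) cutB (dcutB s);
  continuous_dcutA : continuous dcutA;
  continuous_dcutB : continuous dcutB;
  saw_bound : forall s, `|saw s| <= 4;
  cutA_bound : forall s, `|cutA s| <= 1;
  cutB_bound : forall s, `|cutB s| <= 1;
  dcutA_bound : forall s, `|dcutA s| <= cut_rate;
  dcutB_bound : forall s, `|dcutB s| <= cut_rate;
  in_phaseA : forall s (m : int), phaseA t d (s - m%:~R) ->
    [/\ cutA s = 1, dcutA s = 0, cutB s = 0 & dcutB s = 0];
  in_phaseB : forall s (m : int), phaseB t d (s - m%:~R) ->
    [/\ cutA s = 0, dcutA s = 0, cutB s = 1 & dcutB s = 0] }.

(** The cut-offs are bumps rescaled to [[0, t]] and [[t, 1]]. The primitives in [h] carry the weight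
    [t * (1 - t)], which turns the scale factors [1 / t] and [1 / (1 - t)] into the slopes [1 - t]
    and [- t]; [h] returns to 0 at the end of a period because both bumps have the same integral. *)
Lemma profile_exists t d : 0 < t < 1 -> 0 < d < 4^-1 -> profile t d.
Proof.
move=> /andP[t0 t1] /andP[d0 d4].
have u0 : 0 < 1 - t by rewrite subr_gt0.
have ti0 : 0 < t^-1 by rewrite invr_gt0.
have ui0 : 0 < (1 - t)^-1 by rewrite invr_gt0.
have tt : t^-1 * t = 1 by rewrite mulVf // gt_eqF.
have uu : (1 - t)^-1 * (1 - t) = 1 by rewrite mulVf // gt_eqF.
set ti := t^-1 in ti0 tt *; set ui := (1 - t)^-1 in ui0 uu *.
pose fA s := bump d (ti * s + 0); pose fB s := bump d (ui * s + (- (ui * t))).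
pose gA s := ti * dbump d (ti * s + 0); pose gB s := ui * dbump d (ui * s + (- (ui * t))).
pose h s := t * (1 - t) * (ibump d (ti * s + 0) - ibump d (ui * s + (- (ui * t)))).
pose dh s := (1 - t) * fA s - t * fB s.
have dfA s : is_derive s (1 : R) fA (gA s) by exact: is_derive_affine (is_derive_bump _ _).
have dfB s : is_derive s (1 : R) fB (gB s) by exact: is_derive_affine (is_derive_bump _ _).
have ddh s : is_derive s (1 : R) h (dh s).
  have hh := is_deriveZ (t * (1 - t)) (is_deriveB
    (@is_derive_affine _ _ (bump d) ti 0 s (is_derive_ibump _ d0))
    (@is_derive_affine _ _ (bump d) ui (- (ui * t)) s (is_derive_ibump _ d0))).
  apply: (is_derive_eq hh); rewrite /dh -/(fA s) -/(fB s) /GRing.scale /=.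
  rewrite mulrBr (_ : t * (1 - t) * (ti * fA s) = (ti * t) * ((1 - t) * fA s)).
    rewrite (_ : t * (1 - t) * (ui * fB s) = (ui * (1 - t)) * (t * fB s)).
      by rewrite tt uu !mul1r.
    by ring.
  by ring.
pose e := d * (t * (1 - t)).
have tu0 : 0 < t * (1 - t) by rewrite mulr_gt0.
have e0 : 0 < e by rewrite mulr_gt0.
have e1 : e < 1 by rewrite /e; nra.
have edt : e <= d * t by rewrite /e; nra.
have edu : e <= d * (1 - t) by rewrite /e; nra.
have outA s : s <= d * t \/ t - d * t <= s -> fA s = 0 /\ gA s = 0.
  move=> hs; have [bE dE] : bump d (ti * s + 0) = 0 /\ dbump d (ti * s + 0) = 0.
    by apply: bump_out => //; case: hs => hs; [left|right]; rewrite addr0; nra.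
  by rewrite /fA /gA bE dE mulr0.
have outB s : s <= t + d * (1 - t) \/ 1 - d * (1 - t) <= s -> fB s = 0 /\ gB s = 0.
  move=> hs; have [bE dE] : bump d (ui * s - ui * t) = 0 /\ dbump d (ui * s - ui * t) = 0.
    by apply: bump_out => //; case: hs => hs; [left|right]; nra.
  by rewrite /fB /gB bE dE mulr0.
have outA' s : s <= e \/ 1 - e <= s -> fA s = 0 /\ gA s = 0.
  by move=> hs; apply: outA; case: hs => hs; [left|right]; nra.
have outB' s : s <= e \/ 1 - e <= s -> fB s = 0 /\ gB s = 0.
  by move=> hs; apply: outB; case: hs => hs; [left|right]; nra.
have outh s : s <= e \/ 1 - e <= s -> h s = 0 /\ dh s = 0.
  move=> hs; split; last by rewrite /dh (outA' s hs).1 (outB' s hs).1 !mulr0 subrr.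
  case: hs => hs; rewrite /h.
    by rewrite !ibump_le ?subrr ?mulr0 //; nra.
  by rewrite !ibump_ge ?subrr ?mulr0 //; nra.
have cont_affine a b : continuous (fun s : R => a * s + b).
  move=> s; apply: cvgD; last exact: cvg_cst.
  by apply: cvgM; [exact: cvg_cst|exact: cvg_id].
have cg a b : continuous (fun s => a * dbump d (a * s + b)).
  move=> s; apply: cvgM; first exact: cvg_cst.
  apply: (@continuous_comp _ _ _ (fun s => a * s + b) (dbump d)); first exact: cont_affine.
  exact: continuous_dbump.
have fl s (m : int) : 0 <= s - m%:~R -> s - m%:~R < 1 -> Num.floor s = m.
  by move=> h1 h2; apply: floor_def; rewrite intrD1; apply/andP; split; lra.
have per f s : periodize f s = f (s - (Num.floor s)%:~R) by [].
have dt0 : 0 < d * t by rewrite mulr_gt0.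
have du0 : 0 < d * (1 - t) by rewrite mulr_gt0.
exists (periodize h) (periodize fA) (periodize fB) (periodize gA) (periodize gB)
  (Num.max (ti * (4 / d)) (ui * (4 / d))).
- move=> s; exact: (periodize_is_derive s e0 e1 outh ddh).
- move=> s; exact: (periodize_is_derive s e0 e1 outA' dfA).
- move=> s; exact: (periodize_is_derive s e0 e1 outB' dfB).
- by apply: (periodize_continuous e0 e1 _ (cg ti 0)) => r hr; exact: (outA' r hr).2.
- by apply: (periodize_continuous e0 e1 _ (cg ui _)) => r hr; exact: (outB' r hr).2.
- move=> s; rewrite per /h normrM gtr0_norm //.
  set x := ibump _ _; set y := ibump _ _.
  have hx : `|x| <= 2 by exact: ibump_bound.
  have hy : `|y| <= 2 by exact: ibump_bound.
  have hxy : `|x - y| <= 4 by apply: le_trans (ler_normB _ _) _; lra.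
  have h0 := normr_ge0 (x - y); nra.
- by move=> s; exact: bump_bound.
- by move=> s; exact: bump_bound.
- move=> s; rewrite per /gA normrM gtr0_norm // le_max ler_wpM2l ?(ltW ti0) //.
  exact: dbump_bound.
- move=> s; rewrite per /gB normrM gtr0_norm // le_max orbC ler_wpM2l ?(ltW ui0) //.
  exact: dbump_bound.
- move=> s m; rewrite /phaseA /= in_itv /= => /andP[h1 h2].
  rewrite !per (fl s m); [|nra|nra]; set x := s - m%:~R in h1 h2 *.
  have [-> ->] : fB x = 0 /\ gB x = 0 by apply: outB; left; nra.
  rewrite /fA /gA; have [-> ->] : bump d (ti * x + 0) = 1 /\ dbump d (ti * x + 0) = 0.
    by apply: bump_in => //; rewrite addr0; nra.
  by rewrite mulr0.
- move=> s m; rewrite /phaseB /= in_itv /= => /andP[h1 h2].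
  rewrite !per (fl s m); [|nra|nra]; set x := s - m%:~R in h1 h2 *.
  have [-> ->] : fA x = 0 /\ gA x = 0 by apply: outA; right; nra.
  rewrite /fB /gB; have [-> ->] : bump d (ui * x - ui * t) = 1 /\ dbump d (ui * x - ui * t) = 0.
    by apply: bump_in => //; nra.
  by rewrite mulr0.
Qed.

End TwoPhase.

(** * One lamination step for attainable matrices *)

Section Lamination.
Context {R : realType}.
Implicit Types (L : set 'M[R]_3) (A B F : 'M[R]_3) (S : set (R3 R)) (a n : 'cV[R]_3).

Lemma closed_box N : closed (box N : set (R3 R)).
Proof.
rewrite boxE (_ : cbox _ _ = \bigcap_(i in setT) (crd i @^-1` `[- N, N]%classic)).
  by apply: closed_bigI => i _; apply: closed_comp; [move=> x _; exact: continuous_crd|exact: itv_closed].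
by apply/seteqP; split=> x h i; [move=> _; exact: h|exact: (h i I)].
Qed.

Lemma closed_dilate (k : R) S : closed S -> closed [set x | S (k *: x)].
Proof.
by move=> cS; apply: (closed_comp (D := S)) => // x _; exact: continuous_dilate.
Qed.

Lemma sparseU (c1 c2 : nat -> R) d S1 S2 : sparse c1 d S1 -> sparse c2 d S2 ->
  sparse (fun N => c1 N + c2 N) d (S1 `|` S2).
Proof.
move=> [cS1 h1] [cS2 h2]; split; first exact: closedU.
move=> N k k0.
rewrite (_ : _ `&` _ = (box N%:R `&` [set x | S1 (k%:R *: x)]) `|`
    (box N%:R `&` [set x | S2 (k%:R *: x)])); last by rewrite -setIUr.
have mS S : closed S -> measurable (box N%:R `&` [set x : R3 R | S (k%:R *: x)]).
  move=> cS; apply: closed_measurable3; apply: closedI; first exact: closed_box.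
  exact: closed_dilate.
rewrite mulrDl EFinD; apply: le_trans (leeD (h1 N k k0) (h2 N k k0)).
by apply: measureU2; exact: mS.
Qed.

(** The bound defining [sparse] is uniform over all integer dilations, and dilations by [k] and [l]
    compose to one by [k * l]. *)
Lemma sparse_dilate (c : nat -> R) d (k : nat) S : (0 < k)%N -> sparse c d S ->
  sparse c d [set x | S (k%:R *: x)].
Proof.
move=> k0 [cS h]; split; first exact: closed_dilate.
move=> N l l0; have := h N (k * l)%N; rewrite muln_gt0 k0 l0 => /(_ isT).
rewrite (_ : [set x | S ((k * l)%:R *: x)] = [set x | [set x | S (k%:R *: x)] (l%:R *: x)]) //.
by apply/funext => x /=; rewrite scalerA natrM.
Qed.

Lemma sparse_le (c : nat -> R) d1 d2 S : 0 < d1 -> d1 <= d2 -> sparse c d1 S ->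
  sparse c d2 S.
Proof.
move=> d0 d12 [cS h]; split=> // N k k0; apply: le_trans (h N k k0) _.
(* The sign [0 <= c N] comes from the bound itself, a measure being nonnegative and [d1]
   positive. *)
rewrite lee_fin ler_wpM2l // -(pmulr_lge0 _ d0) -lee_fin.
by apply: le_trans (h N k k0); exact: measure_ge0.
Qed.

Definition dotc n (x : R3 R) : R := \sum_i n i 0 * crd i x.

Lemma partial_of_dotc j n : partial_of j (dotc n) (fun=> n j 0).
Proof.
have := @partial_of_sum R j _ (index_enum 'I_3) (fun l x => n l 0 * crd l x)
  (fun l _ => n l 0 * (l == j)%:R) (fun l => partial_ofZ (n l 0) (partial_of_crd j l)).
congr partial_of; apply/funext => x; rewrite (bigD1 j) //= eqxx mulr1.
by rewrite big1 ?addr0 // => l /negbTE ->; rewrite mulr0.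
Qed.

Lemma dotc_upd j n x s : n j 0 = 1 -> dotc n (upd j x s) = s + (dotc n x - crd j x).
Proof.
move=> nj; rewrite /dotc (bigD1 j) //= crd_upd eqxx nj mul1r; congr (_ + _).
rewrite [X in _ = X - _](bigD1 j) //= nj mul1r [crd j x + _]addrC addrK.
by apply: eq_bigr => i /negbTE ij; rewrite crd_upd ij.
Qed.

Lemma dotcZ n k x : dotc n (k *: x) = k * dotc n x.
Proof. by rewrite /dotc mulr_sumr; apply: eq_bigr => i _; rewrite crdZ mulrCA. Qed.

(** Since [n j 0 = 1], the phase [dotc n] moves at unit speed along direction [j], so each slice is
    a one-dimensional interface. Integrating over the other two coordinates gives the factor
    [(2 * N) ^+ 2]. *)
Lemma sparse_interface j n t d : n j 0 = 1 -> 0 < t < 1 -> 0 < d ->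
  sparse (fun N => (8 * N%:R + 8) * (2 * N%:R) ^+ 2) d [set x | interface t d (dotc n x)].
Proof.
move=> nj ht d0.
have cS : closed [set x : R3 R | interface t d (dotc n x)].
  apply: (closed_comp (D := interface t d)); last exact: closed_interface.
  by move=> x _; have [h _ _] := partial_of_dotc j n; exact: h.
split=> // N k k0; set S := box _ `&` _.
have clS : closed S by apply: closedI; [exact: closed_box|exact: closed_dilate].
have mS : measurable S by exact: closed_measurable3.
have N0 : 0 <= N%:R :> R by [].
have c0 : 0 <= (8 * N%:R + 8) * d by rewrite mulr_ge0 ?addr_ge0 ?mulr_ge0 // ltW.
have mI : measurable_fun setT (\1_S : R3 R -> R) by exact: measurable_indic.
have bI x : `|\1_S x : R| <= 1 by rewrite indicE; case: (_ \in _); rewrite ?normr1 ?normr0.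
have oI x : ~ box N%:R x -> \1_S x = 0 :> R.
  by move=> nB; rewrite indicE memNset // => -[].
have sI x : (`|\int[lebesgue_measure]_s (\1_S (upd j x s))%:E| <= ((8 * N%:R + 8) * d)%:E)%E.
  pose S' := [set s | S (upd j x s)].
  have mS' : measurable S'.
    apply: closed_measurable; apply: (closed_comp (D := S)) => // s _.
    exact: continuous_upd.
  rewrite gee0_abs; last by apply: integral_ge0 => s _; rewrite lee_fin.
  rewrite (_ : (fun s => _) = (fun s => (\1_S' s)%:E)); last first.
    by apply/funext => s; rewrite !indicE; congr (_%:R%:E); apply/idP/idP; rewrite !in_setE.
  rewrite integral_indic // setIT.
  apply: le_trans (interface_measure N (k%:R * (dotc n x - crd j x)) ht d0 k0).
  have sub : S' `<=` interface_slice t d N k (k%:R * (dotc n x - crd j x)).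
    move=> s [/boxP /(_ j)]; rewrite crd_upd eqxx => h1 h2; split; first exact: h1.
    by move: h2; rewrite /= dotcZ dotc_upd // mulrDr.
  apply: le_measure => //; rewrite inE //.
  apply: measurableI; first exact: measurable_itv.
  apply: closed_measurable; apply: (closed_comp (D := interface t d)); last exact: closed_interface.
  move=> s _; apply: cvgD; last exact: cvg_cst.
  by apply: cvgM; [exact: cvg_cst|exact: cvg_id].
have := @slice_bound R j N%:R _ 1 _ N0 c0 mI bI oI sI.
have eI : (\int[leb3 R]_x (\1_S x)%:E = leb3 R S)%E.
  by rewrite integral_indic // setIT.
rewrite eI gee0_abs // => h; apply: le_trans h _; rewrite lee_fin le_eqVlt.
by apply/orP; left; apply/eqP; ring.
Qed.

Lemma attainable_lamination_coord L A B a n t j : n j 0 = 1 -> 0 < t < 1 ->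
  A - B = tensor a n -> attainable L A -> attainable L B ->
  attainable L (t *: A + (1 - t) *: B).
Proof.
move=> nj ht AB [MA [cA hA]] [MB [cB hB]].
have [t0 t1] := andP ht.
have MA0 : 0 <= MA.
  by have [|phi [G [S [_ h _ _ _]]]] := hA 1; [|exact: le_trans (h (0, 0, 0) 0)].
have MB0 : 0 <= MB.
  by have [|phi [G [S [_ h _ _ _]]]] := hB 1; [|exact: le_trans (h (0, 0, 0) 0)].
pose aa := \sum_i `|a i 0|; pose nn := \sum_i `|n i 0|.
have aa_le i : `|a i 0| <= aa by rewrite /aa (bigD1 i) //= lerDl sumr_ge0.
have nn_le i : `|n i 0| <= nn by rewrite /nn (bigD1 i) //= lerDl sumr_ge0.
have aa0 : 0 <= aa by rewrite sumr_ge0.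
have nn0 : 0 <= nn by rewrite sumr_ge0.
(* The terms bound the sawtooth, its gradient, the two inner maps (and their gradients), and the
   gradients of the cut-offs times the inner maps. *)
exists (aa * 4 + aa * nn * 2 + MA + MB + 1).
exists (fun N => (8 * N%:R + 8) * (2 * N%:R) ^+ 2 + (cA N + cB N)).
move=> delta delta0; pose d : R := Num.min delta 8^-1.
have d0 : 0 < d by rewrite lt_min delta0 invr_gt0 ltr0n.
have d4 : 0 < d < 4^-1.
  have h8 : 8^-1 < 4^-1 :> R by lra.
  by rewrite d0 gt_min h8 orbT.
have dd : d <= delta by rewrite ge_min lexx.
have [phiA [GA [SA [pA bA gA LA sA]]]] := hA d d0.
have [phiB [GB [SB [pB bB gB LB sB]]]] := hB d d0.
have P := profile_exists ht d4; set r := cut_rate P.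
have r0 : 0 <= r by exact: le_trans (dcutA_bound P 0).
pose K := nn * r * (MA + MB); pose k := (Num.bound K).+1.
have k0 : (0 < k%:R :> R) by rewrite ltr0n.
have k1 : (1 <= k%:R :> R) by rewrite ler1n.
have ki0 : 0 <= k%:R^-1 :> R by rewrite invr_ge0 ltW.
have K0 : 0 <= K by rewrite !mulr_ge0 // addr_ge0.
have Kk : K * k%:R^-1 <= 1.
  rewrite ler_pdivrMr // mul1r; apply: le_trans (ltW (archi_boundP K0)) _.
  by rewrite ler_nat.
have kk : k%:R^-1 * k%:R = 1 :> R by rewrite mulVf // gt_eqF.
have ki1 : k%:R^-1 <= 1 :> R by rewrite invf_le1.
pose th := dotc n.
pose uA (i : 'I_3) (x : R3 R) := k%:R^-1 * phiA (k%:R *: x) i 0.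
pose uB (i : 'I_3) (x : R3 R) := k%:R^-1 * phiB (k%:R *: x) i 0.
pose vA (i l : 'I_3) (x : R3 R) := GA (k%:R *: x) i l.
pose vB (i l : 'I_3) (x : R3 R) := GB (k%:R *: x) i l.
have puA i l : partial_of l (uA i) (vA i l).
  have := partial_ofZ (k%:R^-1) (partial_of_dilate k%:R (pA i l)).
  by congr partial_of; apply/funext => x; rewrite mulrA kk mul1r.
have puB i l : partial_of l (uB i) (vB i l).
  have := partial_ofZ (k%:R^-1) (partial_of_dilate k%:R (pB i l)).
  by congr partial_of; apply/funext => x; rewrite mulrA kk mul1r.
have uAb i x : `|uA i x| <= MA * k%:R^-1.
  by rewrite normrM ger0_norm // mulrC ler_wpM2r.
have uBb i x : `|uB i x| <= MB * k%:R^-1.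
  by rewrite normrM ger0_norm // mulrC ler_wpM2r.
have uAb' i x : `|uA i x| <= MA by apply: le_trans (uAb i x) _; rewrite ler_piMr.
have uBb' i x : `|uB i x| <= MB by apply: le_trans (uBb i x) _; rewrite ler_piMr.
pose dsaw s := (1 - t) * cutA P s - t * cutB P s.
have contP (f f' : R -> R) : (forall s, is_derive s (1 : R) f (f' s)) -> continuous f.
  by move=> df s; apply: differentiable_continuous; apply/derivable1_diffP; have [] := df s.
have cdsaw : continuous dsaw.
  move=> s; apply: cvgB; apply: cvgM; try exact: cvg_cst.
    exact: (contP _ _ (is_derive_cutA P)).
  exact: (contP _ _ (is_derive_cutB P)).
pose phi x : 'cV[R]_3 := \col_i (a i 0 * saw P (th x) +
  (cutA P (th x) * uA i x + cutB P (th x) * uB i x)).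
pose G x : 'M[R]_3 := \matrix_(i, l) (a i 0 * (n l 0 * dsaw (th x)) +
  ((cutA P (th x) * vA i l x + n l 0 * dcutA P (th x) * uA i x) +
   (cutB P (th x) * vB i l x + n l 0 * dcutB P (th x) * uB i x))).
exists phi, G, ([set x | interface t d (th x)] `|`
  ([set x | SA (k%:R *: x)] `|` [set x | SB (k%:R *: x)])); split.
- move=> i l; have pth := partial_of_dotc l n.
  have := partial_ofD (partial_ofZ (a i 0) (partial_of_comp cdsaw (is_derive_saw P) pth))
   (partial_ofD
    (partial_ofM (partial_of_comp (@continuous_dcutA _ _ _ P) (is_derive_cutA P) pth) (puA i l))
    (partial_ofM (partial_of_comp (@continuous_dcutB _ _ _ P) (is_derive_cutB P) pth) (puB i l))).
  by congr partial_of; apply/funext => x; rewrite mxE.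
- move=> x i; rewrite mxE.
  have h1 : `|a i 0 * saw P (th x)| <= aa * 4.
    by rewrite normrM ler_pM // saw_bound.
  have h2 : `|cutA P (th x) * uA i x| <= MA.
    by rewrite normrM -[leRHS]mul1r ler_pM // cutA_bound.
  have h3 : `|cutB P (th x) * uB i x| <= MB.
    by rewrite normrM -[leRHS]mul1r ler_pM // cutB_bound.
  have h4 : 0 <= aa * nn * 2 by rewrite !mulr_ge0.
  apply: le_trans (ler_normD _ _) _.
  have := ler_normD (cutA P (th x) * uA i x) (cutB P (th x) * uB i x); lra.
- move=> x i l; rewrite mxE.
  have ds2 : `|dsaw (th x)| <= 2.
    have h1 := cutA_bound P (th x); have h2 := cutB_bound P (th x).
    rewrite /dsaw; apply: le_trans (ler_normB _ _) _; rewrite !normrM.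
    rewrite [`|1 - t|]ger0_norm ?subr_ge0 ?(ltW t1) // [`|t|]gtr0_norm //.
    have h3 := normr_ge0 (cutA P (th x)); have h4 := normr_ge0 (cutB P (th x)); nra.
  have h1 : `|a i 0 * (n l 0 * dsaw (th x))| <= aa * nn * 2.
    by rewrite mulrA !normrM ler_pM ?mulr_ge0 // ler_pM.
  have h2 : `|cutA P (th x) * vA i l x| <= MA.
    by rewrite normrM -[leRHS]mul1r ler_pM //; do ?[exact: cutA_bound|exact: gA].
  have h3 : `|cutB P (th x) * vB i l x| <= MB.
    by rewrite normrM -[leRHS]mul1r ler_pM //; do ?[exact: cutB_bound|exact: gB].
  have h4 : `|n l 0 * dcutA P (th x) * uA i x| <= nn * r * (MA * k%:R^-1).
    by rewrite normrM ler_pM ?uAb // normrM ler_pM // dcutA_bound.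
  have h5 : `|n l 0 * dcutB P (th x) * uB i x| <= nn * r * (MB * k%:R^-1).
    by rewrite normrM ler_pM ?uBb // normrM ler_pM // dcutB_bound.
  have h6 : nn * r * (MA * k%:R^-1) + nn * r * (MB * k%:R^-1) <= 1.
    by apply: le_trans Kk; rewrite /K le_eqVlt; apply/orP; left; apply/eqP; ring.
  have h7 : 0 <= aa * 4 by rewrite mulr_ge0.
  apply: le_trans (ler_normD _ _) _.
  apply: le_trans (lerD h1 (ler_normD _ _)) _.
  have := ler_normD (cutA P (th x) * vA i l x) (n l 0 * dcutA P (th x) * uA i x).
  have := ler_normD (cutB P (th x) * vB i l x) (n l 0 * dcutB P (th x) * uB i x).
  lra.
- move=> x nS.
  have nSA : ~ SA (k%:R *: x) by move=> h; apply: nS; right; left.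
  have nSB : ~ SB (k%:R *: x) by move=> h; apply: nS; right; right.
  have {nS} : ~ interface t d (th x) by move=> h; apply: nS; left.
  move=> /existsNP[m /not_andP[/contrapT hm|/contrapT hm]].
    (* In phase A the sawtooth has slope [1 - t], and [t A + (1 - t) B + (1 - t) (A - B) = A]; in
       phase B the slope [- t] gives [B]. The cut-offs are locally constant there, so the inner
       gradient is added unaltered. *)
    have [e1 e2 e3 e4] := in_phaseA P hm.
    rewrite (_ : _ + G x = A + GA (k%:R *: x)); first exact: LA.
    apply/matrixP => i l; rewrite !mxE /dsaw e1 e2 e3 e4 /vA.
    have := congr1 (fun M : 'M[R]_3 => M i l) AB; rewrite !mxE => h.
    have -> : B i l = A i l - a i 0 * n l 0 by rewrite -h; ring.
    by ring.
  have [e1 e2 e3 e4] := in_phaseB P hm.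
  rewrite (_ : _ + G x = B + GB (k%:R *: x)); first exact: LB.
  apply/matrixP => i l; rewrite !mxE /dsaw e1 e2 e3 e4 /vB.
  have := congr1 (fun M : 'M[R]_3 => M i l) AB; rewrite !mxE => h.
  have -> : A i l = B i l + a i 0 * n l 0 by rewrite -h; ring.
  by ring.
- apply: (sparse_le d0 dd); apply: sparseU; first exact: sparse_interface nj ht d0.
  by apply: sparseU; exact: sparse_dilate.
Qed.

(** Reduction to [n j 0 = 1]: a nonzero entry of [n] is moved into [a]. For [n = 0] the two matrices
    coincide. *)
Lemma attainable_lamination L A B a n t : 0 <= t <= 1 ->
  A - B = tensor a n -> attainable L A -> attainable L B ->
  attainable L (t *: A + (1 - t) *: B).
Proof.
move=> /andP[t0 t1] AB hA hB.
have [->|tn0] := eqVneq t 0; first by rewrite scale0r add0r subr0 scale1r.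
have [->|tn1] := eqVneq t 1; first by rewrite subrr scale0r addr0 scale1r.
have ht : 0 < t < 1 by rewrite !lt_neqAle eq_sym tn0 t0 tn1 t1.
have [j nj|n0] := pickP (fun j => n j 0 != 0).
  apply: (@attainable_lamination_coord L A B (n j 0 *: a) ((n j 0)^-1 *: n) t j) => //.
    by rewrite mxE mulVf.
  by rewrite AB; apply/matrixP => i l; rewrite !mxE; field.
have -> : A = B.
  apply/eqP; rewrite -subr_eq0 AB; apply/eqP/matrixP => i l; rewrite !mxE.
  by have /negbFE/eqP -> := n0 l; rewrite mulr0.
by rewrite -scalerDl addrC subrK scale1r.
Qed.

Lemma attainable_mem L A : L A -> attainable L A.
Proof.
move=> LA; exists 0, (fun=> 0) => d d0.
exists (fun=> 0), (fun=> 0), set0; split.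
- by move=> i j; have := @partial_of_cst R j 0;
    congr partial_of; apply/funext => x; rewrite mxE.
- by move=> x i; rewrite mxE normr0.
- by move=> x i j; rewrite mxE normr0.
- by move=> x _; rewrite addr0.
- split; first exact: closed0.
  move=> N k k0; rewrite (_ : _ `&` _ = set0); last by apply/seteqP; split=> x [].
  by rewrite mul0r le_eqVlt; apply/orP; left; apply/eqP; exact: measure0.
Qed.

Inductive lam_hull L : 'M[R]_3 -> Prop :=
| lam_mem A : L A -> lam_hull L A
| lam_comb A B a n t : 0 <= t <= 1 -> A - B = tensor a n ->
    lam_hull L A -> lam_hull L B -> lam_hull L (t *: A + (1 - t) *: B).

Lemma lam_hull_sub_qc_hull (Omega : set (R3 R)) L F : bounded_domain Omega ->
  lam_hull L F -> qc_hull Omega L F.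
Proof.
move=> hO hF; apply: attainable_qc_hull => //.
elim: hF => [A LA|A B a n t ht AB _ hA _ hB]; first exact: attainable_mem.
exact: attainable_lamination AB hA hB.
Qed.

End Lamination.

(** * Laminates invariant under the cube group *)

Section Matrix33.
Context {R : realType}.
Implicit Types (A B F : 'M[R]_3).

Definition mx33 (a b c d e f g h i : R) : 'M[R]_3 :=
  \matrix_(p, q) (nth [::] [:: [:: a; b; c]; [:: d; e; f]; [:: g; h; i]] p)`_q.

Local Notation o2 := (Ordinal (isT : (2 < 3)%N)).

Lemma mx33_eta A : A = mx33 (A 0 0) (A 0 1) (A 0 o2) (A 1 0) (A 1 1) (A 1 o2)
  (A o2 0) (A o2 1) (A o2 o2).
Proof. by apply/matrixP => i j; rewrite mxE; elim/ord3P: i; elim/ord3P: j. Qed.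

Lemma sum3 (f : 'I_3 -> R) : \sum_i f i = f 0 + f 1 + f o2.
Proof.
rewrite !big_ord_recl big_ord0 addr0 addrA; congr (_ + f _ + f _); exact: val_inj.
Qed.

Lemma mul_mx33 a b c d e f g h i a' b' c' d' e' f' g' h' i' :
  mx33 a b c d e f g h i *m mx33 a' b' c' d' e' f' g' h' i' =
  mx33 (a * a' + b * d' + c * g') (a * b' + b * e' + c * h') (a * c' + b * f' + c * i')
       (d * a' + e * d' + f * g') (d * b' + e * e' + f * h') (d * c' + e * f' + f * i')
       (g * a' + h * d' + i * g') (g * b' + h * e' + i * h') (g * c' + h * f' + i * i').
Proof.
by apply/matrixP => p q; rewrite !mxE sum3 !mxE; elim/ord3P: p; elim/ord3P: q.
Qed.

Lemma tr_mx33 a b c d e f g h i : (mx33 a b c d e f g h i)^T = mx33 a d g b e h c f i.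
Proof. by apply/matrixP => p q; rewrite !mxE; elim/ord3P: p; elim/ord3P: q. Qed.

Lemma add_mx33 a b c d e f g h i a' b' c' d' e' f' g' h' i' :
  mx33 a b c d e f g h i + mx33 a' b' c' d' e' f' g' h' i' =
  mx33 (a + a') (b + b') (c + c') (d + d') (e + e') (f + f') (g + g') (h + h') (i + i').
Proof. by apply/matrixP => p q; rewrite !mxE; elim/ord3P: p; elim/ord3P: q. Qed.

Lemma scale_mx33 k a b c d e f g h i : k *: mx33 a b c d e f g h i =
  mx33 (k * a) (k * b) (k * c) (k * d) (k * e) (k * f) (k * g) (k * h) (k * i).
Proof. by apply/matrixP => p q; rewrite !mxE; elim/ord3P: p; elim/ord3P: q. Qed.

Lemma one_mx33 : 1%:M = mx33 1 0 0 0 1 0 0 0 1.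
Proof. by apply/matrixP => p q; rewrite !mxE; elim/ord3P: p; elim/ord3P: q. Qed.

Lemma det_mx22 (A : 'M[R]_2) : \det A = A 0 0 * A 1 1 - A 0 1 * A 1 0.
Proof.
rewrite (expand_det_row A 0) !big_ord_recl big_ord0 addr0 /cofactor !det_mx11 !mxE /=.
rewrite expr0 mul1r expr1 mulN1r mulrN.
by congr (_ * _ - _ * _); congr (A _ _); exact: val_inj.
Qed.

Lemma det_mx33 a b c d e f g h i : \det (mx33 a b c d e f g h i) =
  a * (e * i - f * h) - b * (d * i - f * g) + c * (d * h - e * g).
Proof.
rewrite (expand_det_row _ 0) sum3 /cofactor !det_mx22 !mxE /=.
by rewrite !(expr0, expr1, expr2); ring.
Qed.

Lemma cofactor_diag a b c d e f g h i :
  [/\ cofactor (mx33 a b c d e f g h i) 0 0 = e * i - f * h,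
      cofactor (mx33 a b c d e f g h i) 1 1 = a * i - c * g &
      cofactor (mx33 a b c d e f g h i) o2 o2 = a * e - b * d].
Proof.
by split; rewrite /cofactor det_mx22 !mxE /= -signr_odd /= ?expr0; ring.
Qed.

Lemma SO3_mx33 a b c d e f g h i :
  [/\ a * a + d * d + g * g = 1, b * b + e * e + h * h = 1 & c * c + f * f + i * i = 1] ->
  [/\ a * b + d * e + g * h = 0, a * c + d * f + g * i = 0 & b * c + e * f + h * i = 0] ->
  a * (e * i - f * h) - b * (d * i - f * g) + c * (d * h - e * g) = 1 ->
  SO3 (mx33 a b c d e f g h i).
Proof.
move=> [h1 h2 h3] [h4 h5 h6] hd; split; last by rewrite det_mx33.
have h4' : b * a + e * d + h * g = 0 by rewrite -h4; ring.
have h5' : c * a + f * d + i * g = 0 by rewrite -h5; ring.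
have h6' : c * b + f * e + i * h = 0 by rewrite -h6; ring.
by rewrite tr_mx33 mul_mx33 one_mx33 h1 h2 h3 h4 h5 h6 h4' h5' h6'.
Qed.

Lemma SO3M A B : SO3 A -> SO3 B -> SO3 (A *m B).
Proof.
move=> [tA dA] [tB dB]; split; last by rewrite det_mulmx dA dB mulr1.
by rewrite trmx_mul mulmxA -(mulmxA B^T) tA mulmx1.
Qed.

Lemma SO3_1 : SO3 (1%:M : 'M[R]_3).
Proof. by split; [rewrite trmx1 mulmx1|rewrite det1]. Qed.

Lemma P24_intro A : SO3 A -> (forall x, cube x -> cube (A *m x)) ->
  (forall x, cube x -> cube (A^T *m x)) -> P24 A.
Proof.
move=> sA hA hAT; split=> //; apply/seteqP; split=> [_ [x cx <-]|x cx]; first exact: hA.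
exists (A^T *m x); first exact: hAT.
by rewrite mulmxA; have /mulmx1C -> := sA.1; rewrite mul1mx.
Qed.

Lemma P24_tr_cube A x : P24 A -> cube x -> cube (A^T *m x).
Proof.
move=> [sA cA] cx; have : [set A *m y | y in cube] x by rewrite cA.
by move=> [y cy <-]; rewrite mulmxA sA.1 mul1mx.
Qed.

Lemma P24M A B : P24 A -> P24 B -> P24 (A *m B).
Proof.
move=> [sA cA] [sB cB]; split; first exact: SO3M.
rewrite -[RHS]cA -[in RHS]cB; apply/seteqP; split.
  by move=> _ [x cx <-]; exists (B *m x); [exists x|rewrite mulmxA].
by move=> _ [_ [x cx <-] <-]; exists x => //; rewrite mulmxA.
Qed.

Definition flip1 : 'M[R]_3 := mx33 1 0 0 0 (-1) 0 0 0 (-1).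
Definition flip2 : 'M[R]_3 := mx33 (-1) 0 0 0 1 0 0 0 (-1).
Definition flip3 : 'M[R]_3 := mx33 (-1) 0 0 0 (-1) 0 0 0 1.
(** The half-turn about the face diagonal [e_1 + e_2]; [cyc3] is the rotation by 120 degrees about
    [e_1 + e_2 + e_3]. *)
Definition swap12 : 'M[R]_3 := mx33 0 1 0 1 0 0 0 0 (-1).
Definition cyc3 : 'M[R]_3 := mx33 0 0 1 1 0 0 0 1 0.

(** The cube is the unit ball of the maximum norm, so absolute row sums at most 1 keep it inside
    itself. The same for the columns handles the transpose, which is the inverse. *)
Lemma P24_mx33 a b c d e f g h i : let A := mx33 a b c d e f g h i in
  SO3 A ->
  [/\ `|a| + `|b| + `|c| <= 1, `|d| + `|e| + `|f| <= 1 & `|g| + `|h| + `|i| <= 1] ->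
  [/\ `|a| + `|d| + `|g| <= 1, `|b| + `|e| + `|h| <= 1 & `|c| + `|f| + `|i| <= 1] ->
  P24 A.
Proof.
have row (p q r x y z : R) : `|p| + `|q| + `|r| <= 1 -> `|x| <= 1 -> `|y| <= 1 -> `|z| <= 1 ->
    `|p * x + q * y + r * z| <= 1.
  move=> h1 hx hy hz; apply: le_trans h1; apply: le_trans (ler_normD _ _) _.
  apply: lerD; last by rewrite normrM ler_piMr.
  by apply: le_trans (ler_normD _ _) _; apply: lerD; rewrite normrM ler_piMr.
move=> A sA [r1 r2 r3] [c1 c2 c3]; apply: P24_intro => // x cx l.
  by rewrite mxE sum3 !mxE; elim/ord3P: l => /=; apply: row; rewrite ?cx.
by rewrite mxE sum3 !mxE; elim/ord3P: l => /=; apply: row; rewrite ?cx.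
Qed.

Lemma P24_gens : [/\ P24 flip1, P24 flip2, P24 flip3, P24 swap12 & P24 cyc3].
Proof.
by split; apply: P24_mx33; try (by split; rewrite ?normrN ?normr0 ?normr1 ?addr0 ?add0r);
  apply: SO3_mx33; try split; ring.
Qed.

(** Closure properties of an arbitrary predicate, so that the same lemmas serve the hull of the
    rescaled wells and its image under a change of basis. *)
Definition lam_closed (X : 'M[R]_3 -> Prop) : Prop :=
  (forall A B (a n : 'cV[R]_3) t, 0 <= t <= 1 -> A - B = tensor a n ->
     X A -> X B -> X (t *: A + (1 - t) *: B)) /\
  (forall Q A, SO3 Q -> X A -> X (Q *m A)).

Definition flip_closed (X : 'M[R]_3 -> Prop) : Prop :=
  lam_closed X /\
  forall A, X A -> [/\ X (A *m flip1), X (A *m flip2) & X (A *m flip3)].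

Lemma SO3_flips : [/\ SO3 flip1, SO3 flip2 & SO3 flip3].
Proof. by have [[h1 _] [h2 _] [h3 _] _ _] := P24_gens. Qed.

(** Matrices that differ only in column [j] differ by a tensor [a (x) e_j], hence are rank-one
    connected. *)
Lemma lam_column (X : 'M[R]_3 -> Prop) A B C (j : 'I_3) t : lam_closed X -> 0 <= t <= 1 ->
  X A -> X B -> (forall i l, l != j -> A i l = B i l) -> C = t *: A + (1 - t) *: B -> X C.
Proof.
move=> [hX _] ht XA XB AB ->; apply: (hX _ _ (\col_i (A i j - B i j)) (\col_l (l == j)%:R)) => //.
apply/matrixP => i l; rewrite !mxE; case: (eqVneq l j) => [->|lj]; first by rewrite mulr1.
by rewrite (AB i l lj) subrr mulr0.
Qed.

(** Conjugation by [flip3] changes only the sign of [y] and [z], conjugation by [flip2] then only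
    that of [x]. Treating one column at a time keeps the averaged pair rank-one connected. *)
Lemma flip_diag_upper X a x y b z c : flip_closed X ->
  X (mx33 a x y 0 b z 0 0 c) -> X (mx33 a 0 0 0 b 0 0 0 c).
Proof.
move=> [hX hS] hA; have [_ sl] := hX; have [s1 s2 s3] := SO3_flips.
have ht : 0 <= (2^-1 : R) <= 1 by apply/andP; split; lra.
have hB : X (mx33 a x 0 0 b 0 0 0 c).
  have [_ _ h3] := hS _ hA; have h := sl _ _ s3 h3.
  rewrite /flip3 !mul_mx33 in h.
  apply: (@lam_column X _ _ _ o2 2^-1 hX ht hA h); last first.
    by rewrite !scale_mx33 add_mx33; congr mx33; field.
  by move=> i l; rewrite !mxE; elim/ord3P: l; elim/ord3P: i => //= _; ring.
have [_ h2 _] := hS _ hB; have h := sl _ _ s2 h2.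
rewrite /flip2 !mul_mx33 in h.
apply: (@lam_column X _ _ _ 1 2^-1 hX ht hB h); last first.
  by rewrite !scale_mx33 add_mx33; congr mx33; field.
by move=> i l; rewrite !mxE; elim/ord3P: l; elim/ord3P: i => //= _; ring.
Qed.

Lemma flip_shear X a x x' b c : flip_closed X -> `|x'| <= `|x| ->
  X (mx33 a x 0 0 b 0 0 0 c) -> X (mx33 a x' 0 0 b 0 0 0 c).
Proof.
move=> [hX hS] xx hA; have [_ sl] := hX; have [s1 s2 s3] := SO3_flips.
have [x0|x0] := eqVneq x 0.
  have -> : x' = x by move: xx; rewrite x0 normr0 normr_le0 => /eqP.
  exact: hA.
(* The weight solves [t * x + (1 - t) * (- x) = x']. *)
have ht : 0 <= (1 + x' / x) / 2 <= 1.
  have : `|x' / x| <= 1 by rewrite normrM normfV ler_pdivrMr ?normr_gt0 // mul1r.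
  by rewrite ler_norml => /andP[h1 h2]; apply/andP; split; lra.
have [_ h2 _] := hS _ hA; have h := sl _ _ s2 h2.
rewrite /flip2 !mul_mx33 in h.
apply: (@lam_column X _ _ _ 1 _ hX ht hA h); last first.
  by rewrite !scale_mx33 add_mx33; congr mx33; field.
by move=> i l; rewrite !mxE; elim/ord3P: l; elim/ord3P: i => //= _; ring.
Qed.

Lemma flip_diag_lower X a x b c : flip_closed X ->
  X (mx33 a 0 0 x b 0 0 0 c) -> X (mx33 a 0 0 0 b 0 0 0 c).
Proof.
move=> [hX hS] hA; have [_ sl] := hX; have [s1 s2 s3] := SO3_flips.
have ht : 0 <= (2^-1 : R) <= 1 by apply/andP; split; lra.
have [h1 _ _] := hS _ hA; have h := sl _ _ s1 h1.
rewrite /flip1 !mul_mx33 in h.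
apply: (@lam_column X _ _ _ 0 2^-1 hX ht hA h); last first.
  by rewrite !scale_mx33 add_mx33; congr mx33; field.
by move=> i l; rewrite !mxE; elim/ord3P: l; elim/ord3P: i => //= _; ring.
Qed.

Definition P24_closed (X : 'M[R]_3 -> Prop) : Prop :=
  lam_closed X /\ forall A P, P24 P -> X A -> X (A *m P).

Lemma P24_flip_closed X : P24_closed X -> flip_closed X.
Proof.
by move=> [hX hP]; split=> // A XA; have [h1 h2 h3 _ _] := P24_gens; split; exact: hP.
Qed.

Lemma lam_closed_mulr X N : lam_closed X -> lam_closed (fun A => X (A *m N)).
Proof.
move=> [h1 h2]; split; last by move=> Q A sQ XA; rewrite -mulmxA; exact: h2.
move=> A B a n t ht AB XA XB.
rewrite mulmxDl -!scalemxAl; apply: (h1 _ _ a (N^T *m n)) => //.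
rewrite -mulmxBl AB; apply/matrixP => i l; rewrite !mxE mulr_sumr.
by apply: eq_bigr => k _; rewrite !mxE -mulrA [N k l * _]mulrC.
Qed.

(** Certificate for an identity modulo one equation: with the multiplier [c] supplied, what remains
    is settled by [ring] or [field]. *)
Lemma lincomb1 (x y c u v : R) : u = v -> x - y = c * (u - v) -> x = y.
Proof. by move=> ->; rewrite subrr mulr0 => /eqP; rewrite subr_eq0 => /eqP. Qed.

(* [N] is, up to a factor, a rotation by 45 degrees in the plane of [e_1, e_2]; it
   conjugates the half-turns about the coordinate axes to elements of [P24], so the
   lemmas on [flip_closed] apply to [Y A := X (A *m N')]. *)
Lemma P24_diag_balance X a b c s : P24_closed X -> 0 < a -> 0 < b -> 0 < s ->
  s ^+ 2 = a * b -> X (mx33 a 0 0 0 b 0 0 0 c) -> X (mx33 s 0 0 0 s 0 0 0 c).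
Proof.
move=> hX a0 b0 s0 sab XD; have [hlam hP] := hX.
have [f1 f2 f3 sw _] := P24_gens.
pose N := mx33 1 (-1) 0 1 1 0 0 0 1; pose N' := mx33 2^-1 2^-1 0 (- 2^-1) 2^-1 0 0 0 1.
have NN' : N *m N' = 1%:M.
  by rewrite /N /N' mul_mx33 one_mx33; congr mx33; field.
have N'N : N' *m N = 1%:M.
  by rewrite /N /N' mul_mx33 one_mx33; congr mx33; field.
pose Y A := X (A *m N').
have hY : flip_closed Y.
  split; first exact: lam_closed_mulr.
  (* The relation [P *m N' = N' *m Q] converts right multiplication by [P] in [Y] into right
     multiplication by [Q] in [X]. *)
  have tw A P Q : P24 Q -> P *m N' = N' *m Q -> Y A -> Y (A *m P).
    by move=> pQ e YA; rewrite /Y -mulmxA e mulmxA; exact: hP.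
  move=> A YA; split.
  - apply: (tw _ _ swap12) => //; rewrite /flip1 /N' /swap12 !mul_mx33; congr mx33; ring.
  - apply: (tw _ _ (swap12 *m flip3)) => //; first exact: P24M.
    by rewrite /flip2 /flip3 /N' /swap12 !mul_mx33; congr mx33; ring.
  - apply: (tw _ _ flip3) => //.
    by rewrite /flip3 /N' !mul_mx33; congr mx33; ring.
have YD : Y (mx33 a 0 0 0 b 0 0 0 c *m N) by rewrite /Y -mulmxA NN' mulmx1.
have ab0 : 0 < a * b by rewrite mulr_gt0.
(* The first two columns of the diagonal matrix times [N] both have length [r]. The rotation in
   [sQ1] turns the first onto the [e_1] axis and the second into [(x, y, 0)]. *)
pose r : R := Num.sqrt (a ^+ 2 + b ^+ 2).
have r2 : r ^+ 2 = a ^+ 2 + b ^+ 2 by rewrite sqr_sqrtr // addr_ge0 // sqr_ge0.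
have r0 : 0 < r by rewrite sqrtr_gt0 addr_gt0 // exprn_gt0.
pose p : R := r^-1; have pr : p * r = 1 by rewrite mulVf // gt_eqF.
have p0 : 0 < p by rewrite invr_gt0.
pose x : R := p * (b ^+ 2 - a ^+ 2); pose y : R := p * (2 * a * b).
have y0 : 0 < y by rewrite !mulr_gt0.
have ry : r * y = 2 * a * b by rewrite mulrA [r * p]mulrC pr mul1r.
have p2r2 : p ^+ 2 * r ^+ 2 = 1 by rewrite -exprMn pr expr1n.
have sQ1 : SO3 (mx33 (p * a) (p * b) 0 (- (p * b)) (p * a) 0 0 0 1).
  have e : p ^+ 2 * (a ^+ 2 + b ^+ 2) = 1 by rewrite -r2.
  by apply: SO3_mx33; [split|split|]; first [ring|apply: (lincomb1 (c := 1) e); ring].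
have Y1 : Y (mx33 r x 0 0 y 0 0 0 c).
  have := hY.1.2 _ _ sQ1 YD; rewrite /N !mul_mx33.
  congr Y; congr mx33; rewrite /x /y; try ring.
  transitivity (p * r * r); last by rewrite pr mul1r.
  by apply: (lincomb1 (c := - p) r2); ring.
have xy : x ^+ 2 + y ^+ 2 = r ^+ 2.
  transitivity (p ^+ 2 * r ^+ 2 * r ^+ 2); last by rewrite p2r2 mul1r.
  apply: (lincomb1 (c := - (p ^+ 2 * (r ^+ 2 + a ^+ 2 + b ^+ 2))) r2).
  by rewrite /x /y; ring.
have ab2 : 2 * (a * b) <= r ^+ 2 by rewrite r2; have := sqr_ge0 (a - b); nra.
have yz : y ^+ 2 <= 2 * (a * b).
  have e : y ^+ 2 * r ^+ 2 = (2 * (a * b)) ^+ 2 by rewrite -exprMn [y * r]mulrC ry; ring.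
  rewrite -(ler_pM2r (exprn_gt0 2 r0)) e expr2 ler_pM2l //; last by rewrite mulr_gt0.
(* The shear is reduced until the second column has squared length [2 * (a * b)], which is also the
   determinant [r * y] of the block. Rotating this column onto the [e_2] axis then makes both
   diagonal entries equal to [z]. *)
pose x' : R := Num.sqrt (2 * (a * b) - y ^+ 2).
have x'2 : x' ^+ 2 = 2 * (a * b) - y ^+ 2 by rewrite sqr_sqrtr // subr_ge0.
have xx : `|x'| <= `|x|.
  rewrite -ler_sqr ?nnegrE // !real_normK ?num_real // x'2.
  by rewrite lerBlDr xy.
have Y2 := flip_shear hY xx Y1.
pose z : R := Num.sqrt (2 * (a * b)).
have z2 : z ^+ 2 = 2 * (a * b) by rewrite sqr_sqrtr // mulr_ge0 // ltW.
have z0 : 0 < z by rewrite sqrtr_gt0 mulr_gt0.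
pose q : R := z^-1; have qz : q * z = 1 by rewrite mulVf // gt_eqF.
have q2 : q ^+ 2 * z ^+ 2 = 1 by rewrite -exprMn qz expr1n.
have zxy : x' ^+ 2 + y ^+ 2 = z ^+ 2 by rewrite x'2 z2 subrK.
have sQ2 : SO3 (mx33 (q * y) (- (q * x')) 0 (q * x') (q * y) 0 0 0 1).
  have e : q ^+ 2 * (x' ^+ 2 + y ^+ 2) = 1 by rewrite zxy.
  by apply: SO3_mx33; [split|split|]; first [ring|apply: (lincomb1 (c := 1) e); ring].
have Y3 : Y (mx33 z 0 0 (q * x' * r) z 0 0 0 c).
  have := hY.1.2 _ _ sQ2 Y2; rewrite !mul_mx33.
  have e1 : q * (r * y) = z by rewrite ry -mulrA -z2 expr2 mulrA qz mul1r.
  have e2 : q * (x' ^+ 2 + y ^+ 2) = z by rewrite zxy expr2 mulrA qz mul1r.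
  by congr Y; congr mx33; first [ring|apply: (lincomb1 (c := 1) e1); ring|
    apply: (lincomb1 (c := 1) e2); ring].
have Y4 := flip_diag_lower hY Y3.
move: Y4; rewrite /Y /N' mul_mx33 => X4.
(* In the plane of [e_1, e_2], [z] times [N'] is [s] times a rotation by 45 degrees, with
   [z = s * w]; the rotation in [sQ3] undoes it. *)
pose w := Num.sqrt (2 : R); have w2 : w ^+ 2 = 2 by rewrite sqr_sqrtr.
have w0 : 0 < w by rewrite sqrtr_gt0.
have zw : z = s * w.
  apply/eqP; rewrite -(@eqrXn2 _ 2) ?mulr_ge0 ?(ltW z0) ?(ltW s0) ?(ltW w0) //.
  by rewrite exprMn z2 w2 sab mulrC.
pose v : R := w / 2; have vv : 2 * v ^+ 2 = 1 by rewrite /v expr_div_n w2; field.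
have sQ3 : SO3 (mx33 v (- v) 0 v v 0 0 0 1).
  by apply: SO3_mx33; [split|split|]; first [ring|apply: (lincomb1 (c := 1) vv); ring].
have := hlam.2 _ _ sQ3 X4; rewrite mul_mx33.
have e : s * (2 * v ^+ 2) = s by rewrite vv mulr1.
have zv : z = 2 * s * v by rewrite zw /v; field.
by rewrite zv; congr X; congr mx33; first [field|apply: (lincomb1 (c := 1) e); field].
Qed.

End Matrix33.

(** * From the Gram matrix of [U P] to the stretches [ct_stretch] *)

Section Stretches.
Context {R : realType}.
Implicit Types (A B F U : 'M[R]_3) (X : 'M[R]_3 -> Prop).

Local Notation o2 := (Ordinal (isT : (2 < 3)%N)).

(** Equal Gram matrices and determinants make [T *m invmx F] a rotation. *)
Lemma lam_closed_gram X F T : lam_closed X -> X F -> \det F != 0 ->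
  T^T *m T = F^T *m F -> \det T = \det F -> X T.
Proof.
move=> [_ hl] XF dF e de.
have uF : F \in unitmx by rewrite unitmxE unitfE.
have -> : T = (T *m invmx F) *m F by rewrite -mulmxA mulVmx // mulmx1.
apply: hl => //; split; last by rewrite det_mulmx det_inv de mulfV.
rewrite trmx_mul -mulmxA (mulmxA T^T) e -mulmxA mulmxV // mulmx1.
by rewrite -trmx_mul mulmxV // trmx1.
Qed.

(** The Cholesky factor: [r1 ^+ 2] is the first leading minor [u ^+ 4], [(r1 * r2) ^+ 2] the second
    one [c ^+ 4], and [r1 * r2 * r3 = D]. *)
Lemma cholesky33 (u c D g11 g12 g13 g22 g23 g33 : R) : 0 < u -> 0 < c ->
  u ^+ 4 = g11 -> c ^+ 4 = g11 * g22 - g12 ^+ 2 ->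
  D ^+ 2 = \det (mx33 g11 g12 g13 g12 g22 g23 g13 g23 g33) ->
  let r1 := u ^+ 2 in let r2 := c ^+ 2 / u ^+ 2 in let r3 := D / c ^+ 2 in
  let x := g12 / r1 in let y := g13 / r1 in let z := (g23 - x * y) / r2 in
  (mx33 r1 x y 0 r2 z 0 0 r3)^T *m mx33 r1 x y 0 r2 z 0 0 r3 =
  mx33 g11 g12 g13 g12 g22 g23 g13 g23 g33.
Proof.
move=> u0 c0 hu hc; rewrite det_mx33 => hD r1 r2 r3 x y z.
have un0 : u != 0 by rewrite gt_eqF.
have cn0 : c != 0 by rewrite gt_eqF.
(* Solving the minor equations for [g22] and [g33] makes the nine entries identities of rational
   functions. *)
have g22E : g22 = (c ^+ 4 + g12 ^+ 2) / u ^+ 4.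
  by rewrite hc hu subrK mulrAC mulfV ?mul1r // -hu expf_neq0.
have g33E : g33 = (D ^+ 2 + g12 * (g12 * g33 - g23 * g13) - g13 * (g12 * g23 - g22 * g13)
    + g11 * g23 * g23 - g12 ^+ 2 * g33) / c ^+ 4.
  have cc : c ^+ 4 != 0 by rewrite expf_neq0.
  apply: (mulIf cc); rewrite mulfVK // hD hc; ring.
have {}g33E : g33 = (D ^+ 2 - g12 * g23 * g13 - g13 * (g12 * g23 - g22 * g13)
    + u ^+ 4 * g23 * g23) / c ^+ 4 by rewrite {1}g33E -hu; congr (_ / _); ring.
rewrite tr_mx33 mul_mx33 /z /x /y /r1 /r2 /r3 g33E g22E -hu.
by congr mx33; field; rewrite ?un0 ?cn0.
Qed.

Lemma gram_diag X F u c : flip_closed X -> X F -> 0 < \det F -> 0 < u -> 0 < c ->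
  u ^+ 4 = (F^T *m F) 0 0 ->
  c ^+ 4 = (F^T *m F) 0 0 * (F^T *m F) 1 1 - (F^T *m F) 0 1 ^+ 2 ->
  X (mx33 (u ^+ 2) 0 0 0 (c ^+ 2 / u ^+ 2) 0 0 0 (\det F / c ^+ 2)).
Proof.
move=> hX XF dF u0 c0; set G := F^T *m F => hu hc.
have sG : G^T = G by rewrite /G trmx_mul trmxK.
have sGE i j : G i j = G j i by rewrite -{1}sG mxE.
have GE := mx33_eta G; rewrite (sGE 1 0) (sGE o2 0) (sGE o2 1) in GE.
have dG : (\det F) ^+ 2 = \det (mx33 (G 0 0) (G 0 1) (G 0 o2) (G 0 1) (G 1 1) (G 1 o2)
    (G 0 o2) (G 1 o2) (G o2 o2)) by rewrite -GE det_mulmx det_tr expr2.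
have e := cholesky33 u0 c0 hu hc dG; rewrite /= -GE in e.
apply: (flip_diag_upper hX); apply: (lam_closed_gram hX.1 XF _ e); first by rewrite gt_eqF.
have un0 : u != 0 by rewrite gt_eqF.
have cn0 : c != 0 by rewrite gt_eqF.
by rewrite det_mx33; field; rewrite un0 cn0.
Qed.

(** By the Cauchy-Binet identity the second quantity is the sum of the squared 2 by 2 minors of the
    first two columns. If it vanished, expanding the determinant along the third column would give
    0. *)
Lemma gram_pos F : \det F != 0 -> 0 < (F^T *m F) 0 0 /\
  0 < (F^T *m F) 0 0 * (F^T *m F) 1 1 - (F^T *m F) 0 1 ^+ 2.
Proof.
rewrite (mx33_eta F); move: (F 0 0) (F 0 1) (F 0 o2) (F 1 0) (F 1 1) (F 1 o2)
  (F o2 0) (F o2 1) (F o2 o2) => a b c d e f g h i.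
rewrite det_mx33 tr_mx33 mul_mx33 !mxE /= => dF; split.
  rewrite lt_neqAle; apply/andP; split; last by rewrite -!expr2 !addr_ge0 // sqr_ge0.
  apply: contra_neq dF => e0.
  have [a0 d0 g0] : [/\ a = 0, d = 0 & g = 0].
    have := sqr_ge0 a; have := sqr_ge0 d; have := sqr_ge0 g => h1 h2 h3.
    by split; apply/eqP; rewrite -sqrf_eq0; apply/eqP; lra.
  by rewrite a0 d0 g0; ring.
set m := (X in 0 < X).
have mE : m = (a * e - b * d) ^+ 2 + (a * h - b * g) ^+ 2 + (d * h - e * g) ^+ 2.
  by rewrite /m; ring.
rewrite mE lt_neqAle; apply/andP; split; last by rewrite !addr_ge0 // sqr_ge0.
apply: contra_neq dF => e0.
have [m1 m2 m3] : [/\ a * e - b * d = 0, a * h - b * g = 0 & d * h - e * g = 0].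
  have := sqr_ge0 (a * e - b * d); have := sqr_ge0 (a * h - b * g).
  have := sqr_ge0 (d * h - e * g) => h1 h2 h3.
  by split; apply/eqP; rewrite -sqrf_eq0; apply/eqP; lra.
transitivity (c * (d * h - e * g) - f * (a * h - b * g) + i * (a * e - b * d)); first by ring.
by rewrite m1 m2 m3; ring.
Qed.

(** The rotation brings axis [k] to the first place and axis [j] to the last, so the leading 2 by 2
    minor omits [j]. The six pairs give the six permutations; the sign that makes an odd one a
    rotation affects neither quantity. *)
Lemma perm_choice (C : 'M[R]_3) (j k : 'I_3) : C^T = C -> j != k -> exists2 P : 'M[R]_3, P24 P &
  (P^T *m C *m P) 0 0 = C k k /\
  (P^T *m C *m P) 0 0 * (P^T *m C *m P) 1 1 - (P^T *m C *m P) 0 1 ^+ 2 = cofactor C j j.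
Proof.
move=> sC; have sCE p q : C p q = C q p by rewrite -{1}sC mxE.
have CE := mx33_eta C; rewrite (sCE 1 0) (sCE o2 0) (sCE o2 1) in CE.
rewrite CE; move: (C 0 0) (C 0 1) (C 0 o2) (C 1 1) (C 1 o2) (C o2 o2) => a b c e f i.
have [k0 k1 k2] := cofactor_diag a b c b e f c f i.
have [_ _ _ sw cy] := @P24_gens R.
have cs := P24M cy sw; have cc := P24M cy cy; have ccs := P24M cc sw.
have p1 : P24 (1%:M : 'M[R]_3).
  by split; [exact: SO3_1|apply/seteqP; split=> [_ [x cx <-]|x cx]; rewrite ?mul1mx //;
     exists x; rewrite ?mul1mx].
elim/ord3P: j; elim/ord3P: k => // _; rewrite ?k0 ?k1 ?k2.
- exists cyc3 => //; rewrite /cyc3 tr_mx33 !mul_mx33 !mxE /=; split; ring.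
- exists (cyc3 *m swap12) => //; rewrite /cyc3 /swap12 mul_mx33 tr_mx33 !mul_mx33 !mxE /=; split; ring.
- exists (cyc3 *m cyc3 *m swap12) => //.
  rewrite /cyc3 /swap12 !mul_mx33 tr_mx33 !mul_mx33 !mxE /=; split; ring.
- exists (cyc3 *m cyc3) => //; rewrite /cyc3 mul_mx33 tr_mx33 !mul_mx33 !mxE /=; split; ring.
- exists 1%:M => //; rewrite trmx1 mul1mx mulmx1 !mxE /=; split; ring.
- exists swap12 => //; rewrite /swap12 tr_mx33 !mul_mx33 !mxE /=; split; ring.
Qed.

Lemma P24_diag_perm X a b c : P24_closed X -> X (mx33 a 0 0 0 b 0 0 0 c) ->
  X (mx33 b 0 0 0 a 0 0 0 c) /\ X (mx33 b 0 0 0 c 0 0 0 a).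
Proof.
move=> [[_ hl] hP] XD; have [_ _ _ [sw csw] [cy ccy]] := @P24_gens R.
have tr Q : SO3 Q -> SO3 (Q^T : 'M[R]_3).
  move=> [q1 q2]; split; last by rewrite det_tr.
  by rewrite trmxK; apply: mulmx1C.
split.
  have := hl _ _ (tr _ sw) (hP _ _ (conj sw csw) XD).
  by rewrite /swap12 tr_mx33 !mul_mx33; congr X; congr mx33; ring.
have := hl _ _ (tr _ cy) (hP _ _ (conj cy ccy) XD).
by rewrite /cyc3 tr_mx33 !mul_mx33; congr X; congr mx33; ring.
Qed.

Lemma ct_stretchE (k : R) :
  [/\ ct_stretch k 0 = mx33 (k ^+ 2) 0 0 0 k^-1 0 0 0 k^-1,
      ct_stretch k 1 = mx33 k^-1 0 0 0 (k ^+ 2) 0 0 0 k^-1 &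
      ct_stretch k o2 = mx33 k^-1 0 0 0 k^-1 0 0 0 (k ^+ 2)].
Proof.
by split; apply/matrixP => p q; rewrite !mxE; elim/ord3P: p; elim/ord3P: q.
Qed.

Lemma P24_ct_stretch X d k b1 b2 i : P24_closed X -> 0 < d -> 0 < k ->
  0 < b1 -> 0 < b2 -> (d / k) ^+ 2 = b1 * b2 ->
  X (mx33 b1 0 0 0 b2 0 0 0 (d * k ^+ 2)) -> X (d *: ct_stretch k i).
Proof.
move=> hX d0 k0 b10 b20 e XD.
have X2 := P24_diag_balance hX b10 b20 (divr_gt0 d0 k0) e XD.
have [_ X1] := P24_diag_perm hX X2; have [_ X0] := P24_diag_perm hX X1.
have [e0 e1 e2] := ct_stretchE k.
by elim/ord3P: i; rewrite ?e0 ?e1 ?e2 scale_mx33 !mulr0.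
Qed.

Lemma powR_root (x : R) n : 0 <= x -> (0 < n)%N -> (x `^ (1 / n%:R)) ^+ n = x.
Proof.
move=> x0 n0; rewrite -powR_mulrn ?powR_ge0 // -powRrM div1r mulVf ?powRr1 //.
by rewrite pnatr_eq0 -lt0n.
Qed.

Lemma pos_def_sym_det U : pos_def_sym U -> 0 < \det U.
Proof.
move=> [sU pU].
have sE p q : U p q = U q p by rewrite -{1}sU mxE.
have UE := mx33_eta U; rewrite (sE 1 0) (sE o2 0) (sE o2 1) in UE.
move: pU; rewrite UE det_mx33.
move: (U 0 0) (U 0 1) (U 0 o2) (U 1 1) (U 1 o2) (U o2 o2) => a b c e f i pU.
pose v (x y z : R) : 'cV[R]_3 := \col_l [:: x; y; z]`_l.
have vE x y z : ((v x y z)^T *m mx33 a b c b e f c f i *m v x y z) 0 0 =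
    x * (a * x + b * y + c * z) + y * (b * x + e * y + f * z) + z * (c * x + f * y + i * z).
  by rewrite !mxE sum3 !mxE !sum3 !mxE /=; ring.
have v0 x y z : (x != 0) || (y != 0) || (z != 0) -> v x y z != 0.
  apply: contraTneq => h; rewrite !negb_or !negbK.
  have hl l : v x y z l 0 = 0 by rewrite h mxE.
  by have := hl 0; have := hl 1; have := hl o2; rewrite !mxE /= => -> -> ->; rewrite !eqxx.
have a0 : 0 < a.
  by have := pU (v 1 0 0) (v0 _ _ _ _); rewrite vE oner_eq0 => /(_ isT); lra.
have m0 : 0 < a * e - b * b.
  have := pU (v (- b) a 0) (v0 _ _ _ _); rewrite vE (gt_eqF a0) orbT => /(_ isT) h.
  by rewrite -(pmulr_rgt0 _ a0); move: h; congr (0 < _); ring.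
(* The test vector is the last column of the adjugate, which the matrix sends to [\det U] times
   [e_3]. The form therefore equals [(a * e - b * b) * \det U]. *)
have := pU (v (b * f - c * e) (b * c - a * f) (a * e - b * b)) (v0 _ _ _ _).
rewrite vE (gt_eqF m0) orbT => /(_ isT) h.
by rewrite -(pmulr_rgt0 _ m0); move: h; congr (0 < _); ring.
Qed.

Lemma calS_ct_stretch X U k i : pos_def_sym U -> P24_closed X -> X U -> calS U k -> 0 < k ->
  X (\det U `^ (1 / 3) *: ct_stretch k i).
Proof.
move=> pU hX XU [j [l [jl hk]]] k0.
have D0 := pos_def_sym_det pU; have [sU _] := pU.
have sUU : (U *m U)^T = U *m U by rewrite trmx_mul sU.
have [P pP [h1 h2]] := perm_choice sUU jl.
pose F := U *m P.
have XF : X F by exact: hX.2.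
have dF : \det F = \det U by rewrite det_mulmx pP.1.2 mulr1.
have GF : F^T *m F = P^T *m (U *m U) *m P.
  by rewrite /F trmx_mul sU !mulmxA.
have [g1 g2] : 0 < (F^T *m F) 0 0 /\
  0 < (F^T *m F) 0 0 * (F^T *m F) 1 1 - (F^T *m F) 0 1 ^+ 2.
  by apply: gram_pos; rewrite dF gt_eqF.
rewrite GF h1 in g1; rewrite GF h2 in g2.
set u := (U *m U) l l `^ (1 / 4) in hk; set c := cofactor (U *m U) j j `^ (1 / 4) in hk.
have u4 : u ^+ 4 = (U *m U) l l by rewrite powR_root // ltW.
have c4 : c ^+ 4 = cofactor (U *m U) j j by rewrite powR_root // ltW.
have u0 : 0 < u by rewrite powR_gt0.
have c0 : 0 < c by rewrite powR_gt0.
have XD : X (mx33 (u ^+ 2) 0 0 0 (c ^+ 2 / u ^+ 2) 0 0 0 (\det U / c ^+ 2)).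
  rewrite -dF; apply: gram_diag => //; first exact: P24_flip_closed.
  - by rewrite dF.
  - by rewrite GF h1.
  - by rewrite GF h2.
set D := \det U in D0 XD hk *.
set d := D `^ (1 / 3) in hk *; set g := D `^ (1 / 6) in hk.
have d0 : 0 < d by rewrite powR_gt0.
have g0 : 0 < g by rewrite powR_gt0.
have d3 : D = d ^+ 3 by rewrite powR_root // ltW.
have gd : d = g ^+ 2.
  apply/eqP; rewrite -(@eqrXn2 _ 3) ?exprn_ge0 ?(ltW d0) ?(ltW g0) // -d3 -exprM.
  by rewrite powR_root // ltW.
rewrite d3 gd in XD *.
have gn : g != 0 by rewrite gt_eqF.
have un : u != 0 by rewrite gt_eqF.
have cn : c != 0 by rewrite gt_eqF.
have p1 : 0 < u ^+ 2 by rewrite exprn_gt0.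
have p2 : 0 < c ^+ 2 / u ^+ 2 by rewrite divr_gt0 ?exprn_gt0.
have p3 : 0 < (g ^+ 2) ^+ 3 / c ^+ 2 by rewrite divr_gt0 ?exprn_gt0.
have gg : 0 < g ^+ 2 by rewrite exprn_gt0.
(* In the three cases [d * k ^+ 2] is the third, second or first diagonal entry. The other two have
   product [(d / k) ^+ 2], since all three multiply to [d ^+ 3]. *)
rewrite gd in hk; case: hk => kE.
- apply: (P24_ct_stretch i hX gg k0 p1 p2); first by rewrite kE; field; rewrite ?gn ?un ?cn.
  by move: XD; congr X; congr mx33; rewrite kE; field; rewrite ?gn ?un ?cn.
- have [_ X1] := P24_diag_perm hX XD; have [_ X2] := P24_diag_perm hX X1.
  apply: (P24_ct_stretch i hX gg k0 p3 p1); first by rewrite kE; field; rewrite ?gn ?un ?cn.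
  by move: X2; congr X; congr mx33; rewrite kE; field; rewrite ?gn ?un ?cn.
- have [_ X1] := P24_diag_perm hX XD.
  apply: (P24_ct_stretch i hX gg k0 p2 p3); first by rewrite kE; field; rewrite ?gn ?un ?cn.
  by move: X1; congr X; congr mx33; rewrite kE; field; rewrite ?gn ?un ?cn.
Qed.

End Stretches.

(** * Scaling and compactness of the wells *)

Section Scaling.
Context {R : realType}.
Implicit Types (L : set 'M[R]_3) (A B F U P Q : 'M[R]_3) (c : R).

Lemma C_kZ c k (f : R3 R -> R) : C_k k f -> C_k k (fun x => c * f x).
Proof.
elim: k f => [|k IH] f /=; first by move=> cf x; apply: cvgM; [exact: cvg_cst|exact: cf].
move=> h i; have [df hf] := h i.
have E : 'D_(basis_pt i) (fun x => c * f x) = (fun x => c * 'D_(basis_pt i) f x).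
  by apply/funext => x; rewrite (@deriveZ _ _ _ f c) //; exact: df.
by rewrite E; split=> [x|]; [apply: (@derivableZ _ _ _ f c); exact: df|exact: IH].
Qed.

Lemma test_functionZ (Omega : set (R3 R)) c phi :
  test_function Omega phi -> test_function Omega (fun x => c * phi x).
Proof.
move=> [sphi [C [cC CO h]]]; split; first by move=> k; exact: C_kZ.
by exists C; split=> // x Cx; rewrite h ?mulr0.
Qed.

(** The factor is moved into the test function, which avoids extracting it from integrals of [u] and
    [g]. *)
Lemma weak_partialZ (Omega : set (R3 R)) c i u g :
  weak_partial Omega i u g -> weak_partial Omega i (fun x => c * u x) (fun x => c * g x).
Proof.
move=> h phi tphi; have := h _ (test_functionZ c tphi).
have E : 'D_(basis_pt i) (fun x : R3 R => c * phi x) = (fun x => c * 'D_(basis_pt i) phi x).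
  by apply/funext => x; rewrite (@deriveZ _ _ _ phi c) //; exact: (tphi.1 1%N i).1.
move=> e; transitivity (\int[leb3 R]_(x in Omega) (u x * 'D_(basis_pt i) (fun x : R3 R => c * phi x) x)).
  congr (Rintegral _ _ _); apply/funext => x.
  transitivity (u x * (c * 'D_(basis_pt i) phi x)); first by ring.
  exact: (esym (congr1 (fun D : R3 R -> R => u x * D x) E)).
by rewrite e; congr (- _); congr (Rintegral _ _ _); apply/funext => x; ring.
Qed.

Lemma integrable_finZl d (T : measurableType d) (mu : {measure set T -> \bar R}) (D : set T)
    (c : R) (g : T -> R) : measurable D -> mu.-integrable D (EFin \o g) ->
  mu.-integrable D (EFin \o (fun x => c * g x)).
Proof. by move=> mD ig; exact: (integrableZl mD c ig). Qed.

Lemma ae_le_scale d (T : measurableType d) (mu : {measure set T -> \bar R}) (D : set T)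
    (c M : R) (g : T -> R) : {ae mu, forall x, D x -> `|g x| <= M} ->
  {ae mu, forall x, D x -> `|c * g x| <= `|c| * M}.
Proof. by apply: filterS => x h Dx; rewrite normrM ler_wpM2l //; exact: h. Qed.

Lemma weak_star_LinftyZ (Omega : set (R3 R)) c u v : measurable Omega ->
  weak_star_Linfty Omega u v ->
  weak_star_Linfty Omega (fun k x => c * u k x) (fun x => c * v x).
Proof.
move=> mO h g ig.
have icg : (leb3 R).-integrable Omega (EFin \o (fun x => c * g x)).
  exact: (@integrable_finZl _ _ (leb3 R) Omega c g mO ig).
have := h _ icg.
rewrite (_ : (fun x => v x * (c * g x)) = (fun x => c * v x * g x)); last first.
  by apply/funext => x; ring.
rewrite (_ : (fun k => _) = (fun k => \int[leb3 R]_(x in Omega) (c * u k x * g x))) //.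
by apply/funext => k; congr (Rintegral _ _ _); apply/funext => x; ring.
Qed.

Lemma Linfty_leZ (Omega : set (R3 R)) c M u : measurable Omega ->
  Linfty_le Omega M u -> Linfty_le Omega (`|c| * M) (fun x => c * u x).
Proof.
move=> mO [mu hu]; split; first by apply: measurable_funM.
exact: ae_le_scale.
Qed.

Lemma continuous_scale3 c : continuous (fun A : 'M[R]_3 => c *: A).
Proof.
exact: scaler_continuous.
Qed.

(** The approximating sequence is scaled along; a neighbourhood of the scaled set pulls back under
    the scaling to a neighbourhood of [L]. *)
Lemma qc_hull_scale (Omega : set (R3 R)) c L F : open Omega -> qc_hull Omega L F ->
  qc_hull Omega [set c *: A | A in L] (c *: F).
Proof.
move=> oO [z [Dz [[M hM] [w1 w2] hL]]].
have mO : measurable Omega by exact: open_measurable3.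
exists (fun k x => c *: z k x), (fun k x => c *: Dz k x); split.
- exists (`|c| * M) => k; have [h1 h2 h3] := hM k; split.
  + move=> i; rewrite (_ : (fun x => _) = (fun x => c * z k x i 0)); last first.
      by apply/funext => x; rewrite mxE.
    exact: Linfty_leZ.
  + move=> i j; rewrite (_ : (fun x => _) = (fun x => c * Dz k x i j)); last first.
      by apply/funext => x; rewrite mxE.
    exact: Linfty_leZ.
  + move=> i j; have := weak_partialZ c (h3 i j).
    by congr weak_partial; apply/funext => x; rewrite mxE.
- split=> [i|i j].
    have := @weak_star_LinftyZ _ c _ _ mO (w1 i).
    by congr weak_star_Linfty; do ?[apply/funext => ?]; rewrite -?scalemxAl ?mxE.
  have := @weak_star_LinftyZ _ c _ _ mO (w2 i j).
  by congr weak_star_Linfty; do ?[apply/funext => ?]; rewrite ?mxE.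
- move=> O oO' LO; apply: (hL ((fun A => c *: A) @^-1` O)).
    by apply: open_comp => // A _; exact: continuous_scale3.
  by move=> A LA; apply: LO; exists A.
Qed.

End Scaling.

(** * Compactness and invariance of the wells *)

Section Wells.
Context {R : realType}.
Implicit Types (L : set 'M[R]_3) (A B F U P Q : 'M[R]_3) (c : R).

Lemma continuous_entry (i j : 'I_3) : continuous (fun A : 'M[R]_3 => A i j).
Proof. exact: coord_continuous. Qed.

Lemma continuous_mul (T : topologicalType) (f g : T -> R) :
  continuous f -> continuous g -> continuous (fun x => f x * g x).
Proof. by move=> cf cg x; apply: cvgM; [exact: cf|exact: cg]. Qed.

Lemma continuous_add (T : topologicalType) (f g : T -> R) :
  continuous f -> continuous g -> continuous (fun x => f x + g x).
Proof. by move=> cf cg x; apply: cvgD; [exact: cf|exact: cg]. Qed.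

Lemma continuous_sub (T : topologicalType) (f g : T -> R) :
  continuous f -> continuous g -> continuous (fun x => f x - g x).
Proof. by move=> cf cg x; apply: cvgB; [exact: cf|exact: cg]. Qed.

Lemma continuous_sum3 (T : topologicalType) (f : 'I_3 -> T -> R) :
  (forall i, continuous (f i)) -> continuous (fun x => \sum_i f i x).
Proof.
move=> cf.
rewrite (_ : (fun x => _) = (fun x => f 0 x + f 1 x + f (Ordinal (isT : (2 < 3)%N)) x)).
  by do 2?[apply: continuous_add => //].
by apply/funext => x; rewrite sum3.
Qed.

Lemma continuous_mulmx3 (T : topologicalType) (f g : T -> 'M[R]_3) :
  continuous f -> continuous g -> continuous (fun x => f x *m g x).
Proof.
move=> cf cg; apply: continuous_matrix => i j.
have ce (h : T -> 'M[R]_3) p q : continuous h -> continuous (fun x => h x p q).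
  by move=> ch x; apply: (@continuous_comp _ _ _ h (fun A => A p q)); [exact: ch|exact: continuous_entry].
rewrite (_ : (fun x => _) = (fun x => \sum_k f x i k * g x k j)); last first.
  by apply/funext => x; rewrite mxE.
by apply: continuous_sum3 => k; apply: continuous_mul; exact: ce.
Qed.

Lemma continuous_trmx3 : continuous (fun A : 'M[R]_3 => A^T).
Proof.
apply: continuous_matrix => i j; rewrite (_ : (fun x => _) = (fun A : 'M[R]_3 => A j i)).
  exact: continuous_entry.
by apply/funext => A; rewrite mxE.
Qed.

Lemma continuous_det3 : continuous (fun A : 'M[R]_3 => \det A).
Proof.
rewrite (_ : (fun A => _) = (fun A : 'M[R]_3 => let o2 := Ordinal (isT : (2 < 3)%N) in
  A 0 0 * (A 1 1 * A o2 o2 - A 1 o2 * A o2 1) - A 0 1 * (A 1 0 * A o2 o2 - A 1 o2 * A o2 0) +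
  A 0 o2 * (A 1 0 * A o2 1 - A 1 1 * A o2 0))); last first.
  by apply/funext => A /=; rewrite {1}(mx33_eta A) det_mx33.
have ce i j := @continuous_entry i j.
apply: continuous_add; last by apply: continuous_mul => //; apply: continuous_sub; exact: continuous_mul.
by apply: continuous_sub; apply: continuous_mul => //; apply: continuous_sub; exact: continuous_mul.
Qed.

Lemma closed_matrix_eq (T : topologicalType) (f : T -> 'M[R]_3) A : continuous f ->
  closed [set x | f x = A].
Proof.
move=> cf; rewrite (_ : [set x | _] = \bigcap_(i in setT) \bigcap_(j in setT)
    [set x | f x i j = A i j]); last first.
  apply/seteqP; split=> [x /= h i _ j _ /=|x h]; first by rewrite h.
  by apply/matrixP => i j; exact: h.
apply: closed_bigI => i _; apply: closed_bigI => j _.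
apply: (closed_comp (D := [set A i j]) (f := fun x => f x i j)); last exact: closed_eq.
by move=> x _; apply: (@continuous_comp _ _ _ f (fun A => A i j)); [exact: cf|exact: continuous_entry].
Qed.

Lemma closed_SO3 : closed (SO3 : set 'M[R]_3).
Proof.
apply: closedI; last first.
  apply: (closed_comp (D := [set 1]) (f := fun A : 'M[R]_3 => \det A)); last exact: closed_eq.
  by move=> A _; exact: continuous_det3.
apply: closed_matrix_eq; apply: continuous_mulmx3; first exact: continuous_trmx3.
by move=> A; exact: cvg_id.
Qed.

Lemma compact_matrix_box : compact [set A : 'M[R]_3 | forall i j, `|A i j| <= 1].
Proof.
have h := @rV_compact R (3 * 3)%N (fun=> `[-1, 1]%classic) (fun _ => @segment_compact R (-1) 1).
have cv : continuous (@vec_mx R 3 3).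
  apply: continuous_matrix => i j.
  rewrite (_ : (fun x => _) = (fun v : 'rV[R]_(3 * 3) => v 0 (mxvec_index i j))).
    exact: coord_continuous.
  by apply/funext => v; rewrite mxE.
have := continuous_compact (continuous_subspaceT cv) h; congr compact.
apply/seteqP; split=> [_ [v hv <-] i j|A hA].
  by rewrite mxE ler_norml; have := hv (mxvec_index i j); rewrite /= in_itv.
exists (mxvec A); last exact: mxvecK.
move=> k /=; case/mxvec_indexP: k => i j; rewrite mxvecE in_itv /= -ler_norml; exact: hA.
Qed.

Lemma SO3_entry_le Q i j : SO3 Q -> `|Q i j| <= 1.
Proof.
move=> [h _]; have := congr1 (fun A : 'M[R]_3 => A j j) h; rewrite !mxE eqxx.
rewrite (bigD1 i) //= mxE => e.
rewrite -(@ler_pXn2r _ 2) ?nnegrE // real_normK ?num_real // expr1n.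
rewrite -[leRHS]e expr2 lerDl.
by apply: sumr_ge0 => k _; rewrite mxE -expr2 sqr_ge0.
Qed.

Lemma compact_SO3 : compact (SO3 : set 'M[R]_3).
Proof.
apply: (subclosed_compact closed_SO3 compact_matrix_box) => Q sQ i j.
exact: SO3_entry_le.
Qed.

(** Equality of the image with the cube is not visibly a closed condition. For a rotation it amounts
    to [Q] and [Q^T] both mapping the cube into itself, an intersection of closed conditions over
    its points. Compactness follows without listing the group. *)
Lemma closed_P24 : closed (P24 : set 'M[R]_3).
Proof.
have cl (g : 'M[R]_3 -> 'M[R]_3) (x : 'cV[R]_3) : continuous g ->
    closed [set Q | cube (g Q *m x)].
  move=> cg; rewrite (_ : [set Q | _] = \bigcap_(i in setT)
     [set Q | `|(g Q *m x) i 0| <= 1]); last first.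
    by apply/seteqP; split=> [Q h i _|Q h i]; exact: h.
  apply: closed_bigI => i _.
  have cgi : continuous (fun Q => (g Q *m x) i 0).
    rewrite (_ : (fun Q => _) = (fun Q => \sum_k g Q i k * x k 0)).
      apply: continuous_sum3 => k; apply: continuous_mul; last exact: cst_continuous.
      by move=> Q; apply: (@continuous_comp _ _ _ g (fun A => A i k)); [exact: cg|exact: continuous_entry].
    by apply/funext => Q; rewrite mxE.
  rewrite (_ : [set Q | _] = (fun Q => (g Q *m x) i 0) @^-1` `[-1, 1]%classic).
    by apply: closed_comp; [move=> Q _; exact: cgi|exact: itv_closed].
  by apply/seteqP; split=> Q; rewrite /= in_itv /= -ler_norml.
rewrite (_ : P24 = SO3 `&` \bigcap_(x in cube) ([set Q | cube (Q *m x)] `&`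
   [set Q : 'M[R]_3 | cube (Q^T *m x)])); last first.
  apply/seteqP; split=> [Q pQ|Q [sQ h]]; last by apply: P24_intro => // x /h [].
  split; first exact: pQ.1.
  by move=> x cx; split; [rewrite /= -pQ.2; exists x|exact: P24_tr_cube].
apply: closedI; first exact: closed_SO3.
apply: closed_bigI => x _; apply: closedI.
  by apply: (cl id); move=> Q; exact: cvg_id.
by apply: cl; exact: continuous_trmx3.
Qed.

Lemma compact_wells U : compact (wells U).
Proof.
have cP : compact (P24 : set 'M[R]_3).
  by apply: (subclosed_compact closed_P24 compact_SO3) => Q [].
have cf : continuous (fun q : 'M[R]_3 * 'M[R]_3 => q.1 *m (q.2^T *m U *m q.2)).
  have c1 : continuous (fun q : 'M[R]_3 * 'M[R]_3 => q.1) by move=> q; exact: cvg_fst.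
  have c2 : continuous (fun q : 'M[R]_3 * 'M[R]_3 => q.2) by move=> q; exact: cvg_snd.
  have c2T : continuous (fun q : 'M[R]_3 * 'M[R]_3 => q.2^T).
    by move=> q; apply: (@continuous_comp _ _ _ snd (fun A : 'M[R]_3 => A^T)); [exact: c2|exact: continuous_trmx3].
  apply: (continuous_mulmx3 c1); apply: (fun h => continuous_mulmx3 h c2).
  by apply: (continuous_mulmx3 c2T) => q; exact: cvg_cst.
have := continuous_compact (continuous_subspaceT cf) (compact_setX compact_SO3 cP).
congr compact; apply/seteqP; split=> [_ [[Q P] [sQ pP] <-]|_ [Q sQ [P pP <-]]].
  by exists Q => //; exists P.
by exists (Q, P).
Qed.

Lemma wells_mem U : wells U U.
Proof.
exists 1%:M; first exact: SO3_1.
exists 1%:M; last by rewrite trmx1 !mul1mx mulmx1.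
by apply: P24_intro; rewrite ?trmx1; [exact: SO3_1| |] => x; rewrite mul1mx.
Qed.

Lemma wells_SO3 U Q A : SO3 Q -> wells U A -> wells U (Q *m A).
Proof.
move=> sQ [Q' sQ' [P pP <-]]; exists (Q *m Q'); first exact: SO3M.
by exists P => //; rewrite -(mulmxA Q).
Qed.

(** Since [P *m P^T = 1], the right factor is absorbed as
    [Q P'^T U P' P = (Q P) (P' P)^T U (P' P)]. *)
Lemma wells_P24 U P A : P24 P -> wells U A -> wells U (A *m P).
Proof.
move=> pP [Q sQ [P' pP' <-]]; exists (Q *m P); first exact: SO3M sQ pP.1.
exists (P' *m P); first exact: P24M.
rewrite trmx_mul !mulmxA; congr (_ *m _ *m _ *m _).
by rewrite -(mulmxA Q) (mulmx1C pP.1.1) mulmx1.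
Qed.

Lemma wells_det U A : wells U A -> \det A = \det U.
Proof.
by move=> [Q sQ [P pP <-]]; rewrite !det_mulmx det_tr sQ.2 pP.1.2 !mul1r mulr1.
Qed.

Lemma lam_hull_SO3 L Q A : (forall B, L B -> L (Q *m B)) -> lam_hull L A -> lam_hull L (Q *m A).
Proof.
move=> hL; elim=> [B LB|B C a n t ht BC _ hB _ hC]; first by apply: lam_mem; exact: hL.
rewrite mulmxDr -!scalemxAr; apply: (@lam_comb _ _ _ _ (Q *m a) n) => //.
rewrite -mulmxBr BC; apply/matrixP => i j; rewrite !mxE mulr_suml.
by apply: eq_bigr => k _; rewrite mxE mulrA.
Qed.

Lemma lam_hull_mulr L P A : (forall B, L B -> L (B *m P)) -> lam_hull L A -> lam_hull L (A *m P).
Proof.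
move=> hL; elim=> [B LB|B C a n t ht BC _ hB _ hC]; first by apply: lam_mem; exact: hL.
rewrite mulmxDl -!scalemxAl; apply: (@lam_comb _ _ _ _ a (P^T *m n)) => //.
rewrite -mulmxBl BC; apply/matrixP => i j; rewrite !mxE mulr_sumr.
by apply: eq_bigr => k _; rewrite !mxE -mulrA [P k j * _]mulrC.
Qed.

(** The predicate speaks of the unscaled matrix, so [calS_ct_stretch] applies to [U] itself although
    the hull is that of the scaled wells. *)
Lemma wells_lam_closed U c : P24_closed (fun A => lam_hull [set c *: B | B in wells U] (c *: A)).
Proof.
split; [split|].
- move=> A B a n t ht AB hA hB; rewrite scalerDr !scalerA !(mulrC c) -!scalerA.
  apply: (@lam_comb _ _ _ _ (c *: a) n) => //.
  by rewrite -scalerBr AB; apply/matrixP => i j; rewrite !mxE mulrA.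
- move=> Q A sQ hA; rewrite scalemxAr; apply: lam_hull_SO3 hA => _ [B hB <-].
  by exists (Q *m B); [exact: wells_SO3|rewrite scalemxAr].
- move=> A P pP hA; rewrite scalemxAl; apply: lam_hull_mulr hA => _ [B hB <-].
  by exists (B *m P); [exact: wells_P24|rewrite scalemxAl].
Qed.

Lemma continuous_frobenius A : continuous (fun B : 'M[R]_3 => frobenius (B - A)).
Proof.
have cs : continuous (fun B : 'M[R]_3 => \sum_i \sum_j (B - A) i j ^+ 2).
  apply: continuous_sum3 => i; apply: continuous_sum3 => j.
  have ce : continuous (fun B : 'M[R]_3 => (B - A) i j).
    rewrite (_ : (fun B => _) = (fun B : 'M[R]_3 => B i j + - A i j)).
      by apply: continuous_add; [exact: continuous_entry|exact: cst_continuous].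
    by apply/funext => B; rewrite !mxE.
  by apply: continuous_mul.
move=> B; apply: (@continuous_comp 'M[R]_3 _ _ (fun B => \sum_i \sum_j (B - A) i j ^+ 2) Num.sqrt).
  exact: cs.
exact: sqrt_continuous.
Qed.

End Wells.

Theorem corollary3p8 (R : realType) (Omega : set (R3 R))
    (hOmega : bounded_domain Omega)
    (U : 'M[R]_3) (Delta : R)
    (hU : pos_def_sym U) (hdet : \det U = Delta)
    (kappa eps : R)
    (hkappa : calS U kappa) (hkappa0 : 0 < kappa) (hkappa1 : kappa != 1)
    (heps : hull_radius Omega kappa eps)
    (hineq : `|Delta `^ (1 / 3) - 1| / Delta `^ (1 / 3) *
             Num.sqrt (Delta `^ (4 / 3) + 2 * Delta + Delta `^ (2 / 3) + 2)
             < eps) :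
  exists a n : 'cV[R]_3,
    rint (det_set Delta) (qc_hull Omega (wells U)) (1%:M + tensor a n).
Proof.
have D0 : 0 < Delta by rewrite -hdet; exact: pos_def_sym_det.
set d := Delta `^ (1 / 3) in hineq.
have d0 : 0 < d by rewrite powR_gt0.
have dn : d != 0 by rewrite gt_eqF.
have d3 : Delta = d ^+ 3 by rewrite powR_root // ltW.
have d4 : Delta `^ (4 / 3) = d ^+ 4.
  by rewrite -powR_mulrn ?(ltW d0) // -powRrM; congr (_ `^ _); field.
have d2 : Delta `^ (2 / 3) = d ^+ 2.
  by rewrite -powR_mulrn ?(ltW d0) // -powRrM; congr (_ `^ _); field.
have [oO _ _ _] := hOmega.
pose L : set 'M[R]_3 := [set d^-1 *: A | A in wells U].
have cL : compact L.
  exact: (continuous_compact (continuous_subspaceT (@continuous_scale3 R d^-1)) (@compact_wells R U)).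
have LD : L `<=` det_set 1.
  move=> _ [A hA <-]; rewrite /det_set /= detZ (wells_det hA) hdet d3.
  by rewrite -exprMn mulVf // expr1n.
have ctL : ct_wells kappa `<=` qc_hull Omega L.
  move=> _ [i _ [Q sQ <-]]; apply: lam_hull_sub_qc_hull => //.
  have hX := wells_lam_closed U d^-1.
  have XU : lam_hull L (d^-1 *: U) by apply: lam_mem; exists U => //; exact: wells_mem.
  have := calS_ct_stretch i hU hX XU hkappa hkappa0.
  rewrite hdet -/d => /(hX.1.2 Q _ sQ).
  by rewrite -scalemxAr scalerA mulVf // scale1r.
have hball := heps.2 L cL LD ctL.
have hull B : \det B = Delta -> frobenius (d^-1 *: B - 1%:M) < eps ->
    qc_hull Omega (wells U) B.
  move=> dB fB; have : qc_hull Omega L (d^-1 *: B).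
    apply: hball; split=> //.
    by rewrite /det_set /= detZ dB d3 -exprMn mulVf // expr1n.
  (* Scaling back by [d] turns [L] into [wells U] again. *)
  move=> /(@qc_hull_scale R Omega d L _ oO); rewrite scalerA mulfV // scale1r.
  congr (qc_hull Omega _ B); apply/seteqP; split=> [_ [_ [A hA <-] <-]|A hA].
    by rewrite scalerA mulfV // scale1r.
  by exists (d^-1 *: A); [exists A|rewrite scalerA mulfV // scale1r].
pose e1 : 'cV[R]_3 := \col_i (i == 0)%:R.
have FE : 1%:M + tensor ((Delta - 1) *: e1) e1 = mx33 Delta 0 0 0 1 0 0 0 1.
  rewrite one_mx33 (_ : tensor _ _ = mx33 (Delta - 1) 0 0 0 0 0 0 0 0).
    by rewrite add_mx33; congr mx33; ring.
  by apply/matrixP => i j; rewrite !mxE; elim/ord3P: i; elim/ord3P: j => /=; ring.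
exists ((Delta - 1) *: e1), e1; rewrite FE; split.
  by rewrite /det_set /= det_mx33; ring.
(* The difference is [diag(d^2 - 1, 1/d - 1, 1/d - 1)], whose squared norm is
   [((d - 1) / d)^2 (d^2 (d + 1)^2 + 2)]; expanding the second factor gives the radicand of the
   assumed inequality. *)
have fF : frobenius (d^-1 *: mx33 Delta 0 0 0 1 0 0 0 1 - 1%:M) < eps.
  rewrite (_ : frobenius _ = `|d - 1| / d *
     Num.sqrt (Delta `^ (4 / 3) + 2 * Delta + Delta `^ (2 / 3) + 2)) //.
  have -> : `|d - 1| / d = `|(d - 1) / d| by rewrite normf_div (gtr0_norm d0).
  rewrite d4 d2 d3 /frobenius -sqrtr_sqr -sqrtrM ?sqr_ge0 //.
  congr Num.sqrt; rewrite one_mx33 scale_mx33 !sum3 !mxE /=; field.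
  exact: dn.
have cF : continuous (fun B : 'M[R]_3 => frobenius (d^-1 *: B - 1%:M)).
  move=> B; apply: (@continuous_comp _ _ _ (fun B : 'M[R]_3 => d^-1 *: B)
    (fun B => frobenius (B - 1%:M))); [exact: continuous_scale3|exact: continuous_frobenius].
(* The assumed inequality is strict, so it persists near the chosen matrix, and [hull] covers all
   nearby matrices of determinant [Delta]. This gives an interior point relative to
   [det_set Delta]. *)
rewrite /within; have oE : open [set B : 'M[R]_3 | frobenius (d^-1 *: B - 1%:M) < eps].
  by apply: (open_comp (D := [set x : R | x < eps])) => [B _|]; [exact: cF|exact: open_lt].
have := open_nbhs_nbhs (conj oE fF); apply: filterS => B fB dB; exact: hull.
Qed.
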